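(* Let $\pi=(\pi_i)_{i\ge1}$ be a nonincreasing sequence of strictly positive reals with $\sum_{i\ge1}\pi_i=1$, and assume that $\pi_k\in\mathrm{RV}_{-1/\gamma}$ for some $0<\gamma<1$. Let $\vec r_k,\bar r_k$ ($k\ge1$) be the limiting directed and undirected degree masses of the range-renewal graph of $\pi$, that is, $$\vec r_k=\sum_{\ell\ge1} r_\ell(\gamma)\,\mathbb{P}(R_\ell=k),\qquad \bar r_k=\sum_{\ell\ge1} r_\ell(\gamma)\,\mathbb{P}(R_{2\ell}=k),$$ and let $\vec r_{k+}=\sum_{\ell\ge k}\vec r_\ell$, $\bar r_{k+}=\sum_{\ell\ge k}\bar r_\ell$ be their tails. Then, as $k\to\infty$, $$\vec r_{k+}\sim \pi_k^\gamma,\qquad \bar r_{k+}\sim 2^\gamma\pi_k^\gamma,$$ and $$\vec r_k\sim\frac{\pi_k^\gamma}{k},\qquad \bar r_k\sim\frac{2^\gamma\pi_k^\gamma}{k}.$$ Consequently, $\vec r_k\in\mathrm{RV}_{-2}$ and $\bar r_k\in\mathrm{RV}_{-2}$, and $\bar r_k/\vec r_k\to 2^\gamma$ as $k\to\infty$. Moreover, deleting self-loops does not alter these limiting distributions: for every fixed $k\ge1$, the loop-deleted degree frequencies satisfy $\vec r_{n,k}^{\,\circ}\to\vec r_k$ and $\bar r_{n,k}^{\,\circ}\to\bar r_k$ almost surely as $n\to\infty$.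
   Context: Regular variation: for a positive sequence $(a_k)_{k\ge1}$ and $\rho\in\mathbb{R}$, write $a_k\in\mathrm{RV}_\rho$ if for every $t>0$, $a_{\lceil tx\rceil}/a_{\lceil x\rceil}\to t^\rho$ as $x\to\infty$ ($x$ real). The notation $a_k\sim b_k$ means $a_k/b_k\to1$. Sampling: $\xi_1,\xi_2,\ldots$ are i.i.d. random variables with values in $\{1,2,\ldots\}$ and $\mathbb{P}(\xi_1=i)=\pi_i$. Put $V_n=\{\xi_1,\ldots,\xi_n\}$ and $R_n=\#V_n$ (the number of distinct values among the first $n$ samples). Sibuya weights: $r_\ell(\gamma)=\dfrac{\gamma\,\Gamma(\ell-\gamma)}{\Gamma(1-\gamma)\Gamma(\ell+1)}$ for $\ell\ge1$. Range-renewal graph: for symbols $x,y$ let $W_n(x,y)=\sum_{i=1}^{n-1}\mathbf 1_{\{\xi_i=x,\ \xi_{i+1}=y\}}$. Put $V_n^+(x)=\{y:W_n(x,y)\ge1\}$ and $\bar V_n(x)=\{y:W_n(x,y)+W_n(y,x)\ge1\}$. The out-degree is $D_n^+(x)=\#V_n^+(x)$ and the undirected degree is $\bar D_n(x)=\#\bar V_n(x)$ (repeated edges are suppressed; a self-loop contributes one neighbour). For $k\ge1$ set $\vec r_{n,k}=\#\{x\in V_{n-1}:D_n^+(x)=k\}/R_n$ and $\bar r_{n,k}=\#\{x\in V_n:\bar D_n(x)=k\}/R_n$. Known fact from earlier work (Chen, Xie, Ying), explaining the name ''limiting degree masses'': if $\pi$ is as in the claim, then for every fixed $k\ge1$, $\vec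 r_{n,k}\to\vec r_k$ and $\bar r_{n,k}\to\bar r_k$ almost surely as $n\to\infty$. Loop-deleted versions: for $x\in V_n$, $D_n^{+,\circ}(x)=\#(V_n^+(x)\setminus\{x\})$ and $\bar D_n^{\circ}(x)=\#(\bar V_n(x)\setminus\{x\})$; for $k\ge1$, $\vec r_{n,k}^{\,\circ}=\#\{x\in V_n:D_n^{+,\circ}(x)=k\}/R_n$ and $\bar r_{n,k}^{\,\circ}=\#\{x\in V_n:\bar D_n^{\circ}(x)=k\}/R_n$. *)

(* Defs.v *)
From HB Require Import structures.
From mathcomp Require Export all_boot all_order all_algebra finmap.
From mathcomp Require Export all_classical all_reals all_analysis.

Set Implicit Arguments.
Unset Strict Implicit.
Unset Printing Implicit Defensive.

Export Order.TTheory GRing.Theory Num.Theory.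
Export numFieldNormedType.Exports.

Local Open Scope classical_set_scope.
Local Open Scope ring_scope.

(* Sequences over {1, 2, ...} are encoded as functions on [nat]; their value
   at 0 is irrelevant. *)

Section RegularVariation.
Context {R : realType}.
Implicit Types a b : nat -> R.

Definition regularly_varying (a : nat -> R) (rho : R) : Prop :=
  (forall k, (0 < k)%N -> 0 < a k) /\
  forall t : R, 0 < t ->
    a `|Num.ceil (t * x)|%N / a `|Num.ceil x|%N @[x --> +oo] --> t `^ rho.

Definition asymp_equiv a b : Prop := a k / b k @[k --> \oo] --> (1 : R).

End RegularVariation.

Section Sibuya.
Context {R : realType}.

(* Euler's integral; only meaningful (and only used) for z > 0. *)
Definition Gamma (z : R) : R :=
  \int[lebesgue_measure]_(t in `]0, +oo[) (t `^ (z - 1) * expR (- t)).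

Definition sibuya (gamma : R) (l : nat) : R :=
  gamma * Gamma (l%:R - gamma) / (Gamma (1 - gamma) * Gamma (l%:R + 1)).

End Sibuya.

(* The range-renewal graph of a single trajectory s 1, s 2, s 3, ... *)
Section RangeRenewalGraph.
Variable s : nat -> nat.
Implicit Types n x y k : nat.

Definition visited n : {fset nat} := [fset s i | i in iota 1 n]%fset.

Definition range_size n : nat := #|` visited n|.

Definition transitions n x y : nat :=
  \sum_(1 <= i < n) ((s i == x) && (s i.+1 == y)).

(* The ambient finite set [visited n] costs nothing: see [in_out_nbrs] and
   [in_nbrs] below. *)
Definition out_nbrs n x : {fset nat} :=
  [fset y in visited n | (1 <= transitions n x y)%N]%fset.

Definition nbrs n x : {fset nat} :=
  [fset y in visited n | (1 <= transitions n x y + transitions n y x)%N]%fset.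

Definition out_degree_noloop n x : nat := #|` out_nbrs n x `\ x|%fset.

Definition degree_noloop n x : nat := #|` nbrs n x `\ x|%fset.

Definition out_degree_count_noloop n k : nat :=
  #|` [fset x in visited n | out_degree_noloop n x == k]|%fset.

Definition degree_count_noloop n k : nat :=
  #|` [fset x in visited n | degree_noloop n x == k]|%fset.

Lemma transitions_gt0 n x y : (1 <= transitions n x y)%N ->
  (x \in visited n) && (y \in visited n).
Proof.
rewrite /transitions lt0n sum_nat_seq_neq0 => /hasP[i].
rewrite mem_index_iota /= eqb0 negbK => /andP[i1 iN] /andP[/eqP <- /eqP <-].
apply/andP; split; apply/imfsetP; [exists i|exists i.+1] => //=.
- by rewrite mem_iota i1 add1n ltnS ltnW.
- by rewrite mem_iota add1n ltnS.
Qed.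

Lemma in_out_nbrs n x y : (y \in out_nbrs n x) = (1 <= transitions n x y)%N.
Proof.
rewrite !inE /=; case h: (1 <= _)%N; rewrite ?andbF ?andbT //.
by have /andP[_ ->] := transitions_gt0 h.
Qed.

Lemma in_nbrs n x y :
  (y \in nbrs n x) = (1 <= transitions n x y + transitions n y x)%N.
Proof.
rewrite !inE /=; case h: (1 <= _)%N; rewrite ?andbF ?andbT //.
by move: h; rewrite addn_gt0 => /orP[] /transitions_gt0 /andP[].
Qed.

End RangeRenewalGraph.

Section Sampling.
Context {R : realType} d {T : measurableType d} (P : probability T R).

Definition mutually_independent d' (T' : measurableType d') (I : set nat)
    (X : nat -> {RV P >-> T'}) : Prop :=
  forall (J : {fset nat}) (A : nat -> set T'),
    [set` J] `<=` I -> (forall i, i \in J -> measurable (A i)) ->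
    P (\bigcap_(i in [set` J]) (X i @^-1` A i)) =
    (\prod_(i <- J) P (X i @^-1` A i))%E.

Definition iid_sample (p : nat -> R) (xi : nat -> {RV P >-> nat}) : Prop :=
  [/\ forall n w, (1 <= n)%N -> (1 <= xi n w)%N,
      forall n i, (1 <= n)%N -> (1 <= i)%N ->
        P (xi n @^-1` [set i]) = (p i)%:E &
      mutually_independent [set n | (1 <= n)%N] xi].

Variables (gamma : R) (xi : nat -> {RV P >-> nat}).

Definition trajectory (w : T) : nat -> nat := fun n => xi n w.

Definition out_mass (k : nat) : R :=
  fine (\sum_(1 <= l <oo)
    (sibuya gamma l)%:E * P [set w | range_size (trajectory w) l = k])%E.

Definition mass (k : nat) : R :=
  fine (\sum_(1 <= l <oo)
    (sibuya gamma l)%:E * P [set w | range_size (trajectory w) (2 * l)%N = k])%E.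

Definition out_freq_noloop (n k : nat) (w : T) : R :=
  (out_degree_count_noloop (trajectory w) n k)%:R / (range_size (trajectory w) n)%:R.

Definition freq_noloop (n k : nat) (w : T) : R :=
  (degree_count_noloop (trajectory w) n k)%:R / (range_size (trajectory w) n)%:R.

End Sampling.

Definition tail {R : realType} (r : nat -> R) (k : nat) : R :=
  fine (\sum_(k <= l <oo) (r l)%:E)%E.

(* Main.v *)
Require Import Defs.
From mathcomp Require Import measurable_realfun.
From mathcomp Require Import ring lra zify.

(* For m ~ a / p_k the range R_m of m samples has mean ~ a^gamma Gamma(1-gamma) k
   and variance at most its mean, so it crosses the level k at m ~ astar / p_k,
   where astar^gamma Gamma(1-gamma) = 1.  Summation by parts writes the tails as
   sums of the regularly varying Sibuya tail weights against the increments in m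
   of P(R_m >= k), which only charge that scale.  For the masses, the increments
   of P(R_m >= k+1) are the expected unseen mass on {R_m = k}; at the critical
   scale the unseen mass concentrates around gamma k p_k / astar, and dividing by
   it turns the tail asymptotics into local ones.

   A symbol visited l times, at well separated times, has for neighbours the
   distinct values of 2 l independent samples (l samples for the out-neighbours).
   Counting such visits bounds from below the mean numbers of symbols of degree at
   least k and of degree less than k; since these add up to the mean range, both
   bounds are sharp.  The Efron-Stein inequality, with deletion of one sample,
   bounds the variance of the degree counts by a multiple of the mean range: a
   symbol of degree at least k has a certificate of k edges, hence at most 2 k
   critical samples.  Almost sure convergence follows by Borel-Cantelli along a
   subsequence on which the mean range grows like j^2, and by monotonicity. *)

Set Implicit Arguments.
Unset Strict Implicit.
Unset Printing Implicit Defensive.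

Local Open Scope classical_set_scope.
Local Open Scope ring_scope.

(** * Expectation over independent samples *)

(** Two obstacles shape the proof. Concentration of R_m at the critical scale locates the crossing
    of a level only in probability, while the weights, of order m^(-gamma) or m^(-1 - gamma), are
    much larger at small m than at that scale. The bound P(R_m >= k) <= C (m p_k)^2, from a second
    factorial moment, makes early crossings negligible for every weight index below 2. Secondly, the
    unseen mass has to be controlled at the random time at which the level is left. It decreases
    along a trajectory, so its values at two fixed times, one on each side of the critical scale,
    suffice; on the exceptional event the deterministic bound c k p_k <= unseen mass, valid whenever
    R_m = k, still permits the division. The undirected masses see even times only. They are
    compared with a sum over all times whose weights are constant on pairs of consecutive times. For
    the degrees, the two lower bounds exhaust the mean range because the Sibuya weights sum to 1;
    the symbols with crowded visits are thereby negligible without any estimate of their number. *)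

Section Averages.
Context {R : realType}.
Variables (w : nat -> R) (w_ge0 : forall x, 0 <= w x).
Hypothesis w_sum : series w @ \oo --> (1 : R).
Implicit Types (f g : nat -> R) (c C : R).

Definition bnd f := exists C, forall x, `|f x| <= C.
Definition avg f : R := limn (series (fun x => w x * f x)).

Lemma avg_cvg f : bnd f -> cvgn (series (fun x => w x * f x)).
Proof.
move=> [C fC]; apply: normed_cvg; apply: (@series_le_cvg _ _ (fun x => C * w x)).
- by move=> n /=.
- by move=> n; rewrite mulr_ge0// (le_trans _ (fC 0%N)).
- move=> n /=. rewrite normrM ger0_norm// mulrC ler_wpM2r//.
- apply: (is_cvg_seriesZ (f := w)); apply/cvg_ex; exists 1; exact: w_sum.
Qed.

Lemma avgD f g : bnd f -> bnd g -> avg (fun x => f x + g x) = avg f + avg g.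
Proof.
move=> /avg_cvg fb /avg_cvg gb; rewrite /avg -lim_seriesD//; congr (limn (series _)).
by apply/funext => x /=; rewrite mulrDr.
Qed.

Lemma avgZ c f : bnd f -> avg (fun x => c * f x) = c * avg f.
Proof.
move=> /avg_cvg fb; rewrite /avg.
have := lim_seriesZ c fb; rewrite /GRing.scale /= => <-; congr (limn (series _)).
by apply/funext => x /=; rewrite mulrCA.
Qed.

Lemma avg_le f g : bnd f -> bnd g -> (forall x, f x <= g x) -> avg f <= avg g.
Proof.
move=> /avg_cvg fb /avg_cvg gb fg; apply: lim_series_le => // n.
by rewrite ler_wpM2l.
Qed.

Lemma avg_cst c : avg (fun=> c) = c.
Proof.
have -> : avg (fun=> c) = c * avg (fun=> 1).
  rewrite -avgZ; last by exists 1 => x; rewrite normr1.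
  by congr avg; apply/funext => x; rewrite mulr1.
rewrite /avg; under [fun x => w x * 1]funext do rewrite mulr1.
by rewrite (cvg_lim _ w_sum) ?mulr1.
Qed.

Lemma avg_norm f C : (forall x, `|f x| <= C) -> `|avg f| <= C.
Proof.
move=> fC; have bf : bnd f by exists C.
have bC a : bnd (fun=> a) by exists `|a|.
rewrite ler_norml; apply/andP; split.
  rewrite -(avg_cst (- C)); apply: avg_le => // x.
  by have := fC x; rewrite ler_norml => /andP[].
rewrite -[leRHS](avg_cst C); apply: avg_le => // x.
by have := fC x; rewrite ler_norml => /andP[].
Qed.

Lemma avg_eq1 a : avg (fun x => (x == a)%:R) = w a.
Proof.
apply/cvg_lim => //; apply/cvg_ballP => e e0; near=> n.
rewrite /ball /= /series /= (bigD1_seq a) ?iota_uniq//=; last first.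
  rewrite mem_index_iota /=; near: n; exact: nbhs_infty_gt.
rewrite eqxx mulr1 big1 ?addr0 ?subrr ?normr0// => i /negPf ->.
by rewrite mulr0.
Unshelve. all: by end_near. Qed.

(** Expectation over [n] independent draws as an iterated series, the first draw outermost.
    Conditioning on some of the draws is then an induction on lists instead of a statement on
    product measures; [prob_sample] relates it to the given probability space. *)
Fixpoint Ex (n : nat) (f : seq nat -> R) : R :=
  if n is n'.+1 then avg (fun x => Ex n' (fun s => f (x :: s))) else f [::].

Implicit Types (F G : seq nat -> R) (s t : seq nat) (n m : nat).

(** Boundedness is asked on lists of length [n] only, so that counts such as the number of distinct
    values qualify. *)
Definition bnds n F := exists C, forall s, size s = n -> `|F s| <= C.

Lemma Ex_norm n F C : (forall s, size s = n -> `|F s| <= C) -> `|Ex n F| <= C.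
Proof.
elim: n F => [F h|n IH F h] /=; first exact: h.
by apply: avg_norm => x; apply: IH => s sn; apply: h; rewrite /= sn.
Qed.

Lemma bnds_cons n F x : bnds n.+1 F -> bnds n (fun s => F (x :: s)).
Proof. by move=> [C FC]; exists C => s sn; apply: FC; rewrite /= sn. Qed.

Lemma bnds_Ex n F : bnds n.+1 F -> bnd (fun x => Ex n (fun s => F (x :: s))).
Proof.
by move=> [C FC]; exists C => x; apply: Ex_norm => s sn; apply: FC; rewrite /= sn.
Qed.
#[local] Hint Resolve bnds_cons bnds_Ex : core.

Lemma bndsD n F G : bnds n F -> bnds n G -> bnds n (fun s => F s + G s).
Proof.
move=> [C FC] [C' GC]; exists (C + C') => s sn.
by rewrite (le_trans (ler_normD _ _))// lerD ?FC ?GC.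
Qed.

Lemma bndsM n F G : bnds n F -> bnds n G -> bnds n (fun s => F s * G s).
Proof.
move=> [C FC] [C' GC]; exists (C * C') => s sn.
by rewrite normrM ler_pM ?FC ?GC.
Qed.

Lemma bnds_cst n c : bnds n (fun=> c).
Proof. by exists `|c|. Qed.

Lemma bndsN n F : bnds n F -> bnds n (fun s => - F s).
Proof. by move=> [C FC]; exists C => s sn; rewrite normrN FC. Qed.

Lemma bndsB n F G : bnds n F -> bnds n G -> bnds n (fun s => F s - G s).
Proof. by move=> bF bG; apply: bndsD => //; apply: bndsN. Qed.

Lemma bndsX n F k : bnds n F -> bnds n (fun s => F s ^+ k).
Proof.
by move=> [C FC]; exists (C ^+ k) => s sn; rewrite normrX lerXn2r ?nnegrE ?FC// (le_trans _ (FC s sn)).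
Qed.

Lemma bnds_bool n (q : pred (seq nat)) : bnds n (fun s => (q s)%:R).
Proof. by exists 1 => s _; case: (q s); rewrite ?normr1// normr0 ler01. Qed.

Lemma bnds_nat n (q : seq nat -> nat) k :
  (forall s, size s = n -> (q s <= k)%N) -> bnds n (fun s => (q s)%:R).
Proof. by move=> h; exists k%:R => s sn; rewrite normr_nat ler_nat h. Qed.

Lemma bnds_sum n (I : Type) (r : seq I) (q : pred I) (F : I -> seq nat -> R) :
  (forall i, bnds n (F i)) -> bnds n (fun s => \sum_(i <- r | q i) F i s).
Proof.
move=> bF; elim: r => [|i r IH].
  by exists 0 => s _; rewrite big_nil normr0.
have [C hC] : bnds n (fun s => (if q i then F i s else 0) + \sum_(i <- r | q i) F i s).
  by apply: bndsD => //; case: (q i) => //; exact: bnds_cst.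
exists C => s /hC; rewrite big_cons; case: (q i) => //.
by rewrite add0r.
Qed.

Lemma eq_Ex n F G : (forall s, size s = n -> F s = G s) -> Ex n F = Ex n G.
Proof.
elim: n F G => [F G h|n IH F G h] /=; first exact: h.
by congr avg; apply/funext => x; apply: IH => s sn; apply: h; rewrite /= sn.
Qed.

Lemma ExD n F G : bnds n F -> bnds n G ->
  Ex n (fun s => F s + G s) = Ex n F + Ex n G.
Proof.
elim: n F G => [//|n IH F G bF bG] /=.
by rewrite -avgD; [congr avg; apply/funext => x; rewrite IH; auto|auto|auto].
Qed.

Lemma ExZ n c F : bnds n F -> Ex n (fun s => c * F s) = c * Ex n F.
Proof.
elim: n F => [//|n IH F bF] /=.
by rewrite -avgZ; [congr avg; apply/funext => x; rewrite IH; auto|auto].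
Qed.

Lemma ExN n F : bnds n F -> Ex n (fun s => - F s) = - Ex n F.
Proof.
move=> bF; rewrite -mulN1r -ExZ//; apply: eq_Ex => s _; by rewrite mulN1r.
Qed.

Lemma ExB n F G : bnds n F -> bnds n G ->
  Ex n (fun s => F s - G s) = Ex n F - Ex n G.
Proof. by move=> bF bG; rewrite ExD ?ExN//; apply: bndsN. Qed.

Lemma Ex_cst n c : Ex n (fun=> c) = c.
Proof.
elim: n => [//|n IH] /=; rewrite -[RHS](avg_cst c); congr avg.
by apply/funext.
Qed.

Lemma Ex_le n F G : bnds n F -> bnds n G ->
  (forall s, size s = n -> F s <= G s) -> Ex n F <= Ex n G.
Proof.
elim: n F G => [|n IH] F G bF bG h /=; first exact: h.
by apply: avg_le; auto => x; apply: IH; auto => s sn; apply: h; rewrite /= sn.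
Qed.

Lemma Ex_ge0 n F : bnds n F -> (forall s, size s = n -> 0 <= F s) -> 0 <= Ex n F.
Proof.
by move=> bF h; rewrite -(Ex_cst n 0); apply: Ex_le => //; exact: bnds_cst.
Qed.

Lemma Ex_sum n (I : Type) (r : seq I) (q : pred I) (F : I -> seq nat -> R) :
  (forall i, bnds n (F i)) ->
  Ex n (fun s => \sum_(i <- r | q i) F i s) = \sum_(i <- r | q i) Ex n (F i).
Proof.
move=> bF; elim: r => [|i r IH].
  rewrite big_nil -[RHS](Ex_cst n 0); apply: eq_Ex => s _; exact: big_nil.
rewrite big_cons -IH; case: ifP => qi.
  rewrite -ExD//; first by apply: eq_Ex => s _; rewrite big_cons qi.
  exact: bnds_sum.
by apply: eq_Ex => s _; rewrite big_cons qi.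
Qed.

Lemma Ex_rcons n F :
  Ex n.+1 F = Ex n (fun s => avg (fun x => F (rcons s x))).
Proof.
elim: n F => [//|n IH F].
by rewrite [LHS]/=; congr avg; apply/funext => x; exact: (IH (fun s => F (x :: s))).
Qed.

Lemma Ex_cat n m F :
  Ex (n + m) F = Ex n (fun s => Ex m (fun t => F (s ++ t))).
Proof.
elim: n F => [//|n IH F] /=.
by congr avg; apply/funext => x; rewrite IH.
Qed.

Lemma Ex_take n m F : (n <= m)%N -> Ex m (fun s => F (take n s)) = Ex n F.
Proof.
move=> nm; rewrite -(subnKC nm) Ex_cat; apply: eq_Ex => s sn.
by rewrite -[RHS](Ex_cst (m - n)); apply: eq_Ex => t _; rewrite take_size_cat.
Qed.

Lemma Ex_prod n (h : nat -> R) : bnd h ->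
  Ex n (fun s => \prod_(y <- s) h y) = avg h ^+ n.
Proof.
move=> bh; elim: n => [|n IH] /=; first by rewrite big_nil expr0.
rewrite exprS mulrC -IH -avgZ//; congr avg; apply/funext => x.
rewrite mulrC -ExZ.
  by apply: eq_Ex => s _; rewrite big_cons.
have [C hC] := bh; exists (C ^+ n) => s <-.
elim: s => [|y s IHs]; first by rewrite big_nil normr1 expr0.
by rewrite big_cons normrM exprS ler_pM.
Qed.

Definition Var n F := Ex n (fun s => (F s - Ex n F) ^+ 2).

Lemma Ex_sqB n F c : bnds n F ->
  Ex n (fun s => (F s - c) ^+ 2) = Ex n (fun s => F s ^+ 2) - 2 * c * Ex n F + c ^+ 2.
Proof.
move=> bF; rewrite -ExZ// -[X in _ + X](Ex_cst n) -ExB; [|exact: bndsX|].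
  rewrite -ExD; [|apply: bndsB; first exact: bndsX| exact: bnds_cst].
    by apply: eq_Ex => s _; ring.
  by apply: bndsM => //; exact: bnds_cst.
by apply: bndsM => //; exact: bnds_cst.
Qed.

Lemma VarE n F : bnds n F -> Var n F = Ex n (fun s => F s ^+ 2) - Ex n F ^+ 2.
Proof. by move=> bF; rewrite /Var Ex_sqB//; ring. Qed.

Lemma Var_ge0 n F : bnds n F -> 0 <= Var n F.
Proof.
move=> bF; apply: Ex_ge0; last by move=> *; rewrite sqr_ge0.
by apply: bndsX; apply: bndsB => //; exact: bnds_cst.
Qed.

Lemma Ex_sq_le n F : bnds n F -> Ex n F ^+ 2 <= Ex n (fun s => F s ^+ 2).
Proof. by move=> /[dup] /Var_ge0 + bF; rewrite VarE// subr_ge0. Qed.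

Lemma Chebyshev n F c : bnds n F -> 0 < c ->
  Ex n (fun s => (c <= `|F s - Ex n F|)%R%:R) <= Var n F / c ^+ 2.
Proof.
move=> bF c0; have bV : bnds n (fun s => (F s - Ex n F) ^+ 2).
  by apply: bndsX; apply: bndsB => //; exact: bnds_cst.
rewrite ler_pdivlMr ?exprn_gt0// mulrC -ExZ; last exact: bnds_bool.
apply: Ex_le => //; first by apply: bndsM; [exact: bnds_cst|exact: bnds_bool].
move=> s _; case: (lerP c `|F s - Ex n F|) => h /=; last by rewrite mulr0 sqr_ge0.
by rewrite mulr1 -[leRHS]real_normK ?num_real// lerXn2r// nnegrE ltW.
Qed.

(* Tensorization: conditioning on the first coordinate splits the variance into
   the mean of the conditional variance, handled by induction, and the variance
   of the conditional mean, handled by Jensen. *)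
Lemma Efron_Stein n F (G : seq nat -> seq nat -> R) : bnds n F ->
  (forall i, (i < n)%N -> bnds n (fun s => G (take i s) (drop i.+1 s))) ->
  Var n F <= \sum_(i < n) Ex n (fun s => (F s - G (take i s) (drop i.+1 s)) ^+ 2).
Proof.
elim: n F G => [|n IH] F G bF bG.
  by rewrite big_ord0 /Var /= subrr expr0n.
have bV x : bnds n (fun s => F (x :: s)) by exact: bnds_cons.
have bE : bnd (fun x => Ex n (fun s => F (x :: s))) by exact: bnds_Ex.
have bE' : bnds 1 (fun s => Ex n (fun t => F (head 0%N s :: t))).
  by case: bE => C hC; exists C => s _; apply: hC.
have b2 : bnds n.+1 (fun s => F s ^+ 2) by exact: bndsX.
have b2' : bnd (fun x => Ex n (fun s => F (x :: s) ^+ 2)) by exact: (bnds_Ex b2).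
have b22 : bnd (fun x => Ex n (fun s => F (x :: s)) ^+ 2).
  case: bE => C hC; exists (C ^+ 2) => x.
  by rewrite normrX lerXn2r ?nnegrE// (le_trans _ (hC x)).
have bd i : (i < n.+1)%N -> bnds n.+1 (fun s => (F s - G (take i s) (drop i.+1 s)) ^+ 2).
  by move=> i_n; apply: bndsX; apply: bndsB => //; exact: bG.
have VarF : Var n.+1 F = avg (fun x => Var n (fun s => F (x :: s))) +
    Var 1 (fun s => Ex n (fun t => F (head 0%N s :: t))).
  rewrite [in RHS]VarE//= VarE//=.
  have -> : avg (fun x => Var n (fun s => F (x :: s))) =
      avg (fun x => Ex n (fun s => F (x :: s) ^+ 2)) -
      avg (fun x => Ex n (fun s => F (x :: s)) ^+ 2).
    rewrite -mulN1r -avgZ// -avgD//.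
      by congr avg; apply/funext => x; rewrite VarE// mulN1r.
    by case: b22 => C hC; exists C => x; rewrite mulN1r normrN.
  by rewrite addrA subrK.
rewrite VarF big_ord_recl addrC lerD//.
  set c := Ex n (G [::]); have bG0 : bnds n (G [::]).
    have [C hC] := bG 0%N isT; exists C => s sn.
    by have := hC (0%N :: s); rewrite /= drop0 sn; apply.
  have le1 : Var 1 (fun s => Ex n (fun t => F (head 0%N s :: t))) <=
      Ex 1 (fun s => (Ex n (fun t => F (head 0%N s :: t)) - c) ^+ 2).
    rewrite Ex_sqB// VarE//=; set e2 := avg _; set e := avg _.
    rewrite -subr_ge0 [leRHS](_ : _ = (e - c) ^+ 2) ?sqr_ge0//; ring.
  apply: (le_trans le1) => /=; have b0 := bd 0%N isT.
  have b1 x : bnds n (fun s => F (x :: s) - G [::] s) by apply: bndsB.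
  apply: avg_le.
  - case: bE => C hC; exists ((C + `|c|) ^+ 2) => x.
    rewrite normrX lerXn2r ?nnegrE// ?(le_trans (ler_normB _ _)) ?lerD//.
    by rewrite addr_ge0// (le_trans _ (hC 0%N)).
  - have [C hC] := bnds_Ex b0; exists C => x; apply: le_trans (hC x).
    by rewrite (@eq_Ex _ _ (fun s => (F (x :: s) - G [::] s) ^+ 2))// => s _; rewrite drop0.
  - move=> x; rewrite -ExB//; apply: le_trans (Ex_sq_le (b1 x)) _.
    rewrite le_eqVlt; apply/orP; left; apply/eqP.
    by apply: eq_Ex => s _; rewrite drop0.
have bds i : (i < n)%N ->
    bnd (fun x => Ex n (fun s => (F (x :: s) - G (x :: take i s) (drop i.+1 s)) ^+ 2)).
  by move=> i_n; exact: (@bnds_Ex n _ (bd i.+1 i_n)).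
have -> : \sum_(i < n) Ex n.+1 (fun s => (F s - G (take (lift ord0 i) s) (drop (lift ord0 i).+1 s)) ^+ 2) =
   avg (fun x => \sum_(i < n) Ex n (fun s => (F (x :: s) - G (x :: take i s) (drop i.+1 s)) ^+ 2)).
  transitivity (Ex 1 (fun s => \sum_(i < n)
     Ex n (fun t => (F (head 0%N s :: t) - G (head 0%N s :: take i t) (drop i.+1 t)) ^+ 2))).
    rewrite Ex_sum//= => i; have [C hC] := bds _ (ltn_ord i).
    by exists C => s _; apply: hC.
  by [].
apply: avg_le.
- have [C1 h1] := b2'; have [C2 h2] := b22; exists (C1 + C2) => x.
  by rewrite VarE// (le_trans (ler_normB _ _))// lerD.
- have [|C hC] := @bnds_sum 1 _ (index_enum 'I_n) predT (fun i s => Ex n (fun t =>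
      (F (head 0%N s :: t) - G (head 0%N s :: take i t) (drop i.+1 t)) ^+ 2)).
    by move=> i; have [C hC] := bds _ (ltn_ord i); exists C => s _; apply: hC.
  by exists C => x; exact: (hC [:: x]).
- move=> x; apply: (IH (fun s => F (x :: s)) (fun t => G (x :: t))) => // i i_n.
  exact: (@bnds_cons n _ x (bG i.+1 _)).
Qed.

End Averages.

(** * Occupancy counts and unseen mass *)

Definition distinct (s : seq nat) : nat := size (undup s).
Definition del (s : seq nat) i := take i s ++ drop i.+1 s.

Lemma perm_del (s : seq nat) i : (i < size s)%N ->
  perm_eq s (nth 0%N s i :: del s i).
Proof.
move=> i_s; rewrite -{1}(cat_take_drop i s) (drop_nth 0%N i_s) /del.
by rewrite -cat_rcons -[in X in perm_eq _ X]cat1s catA perm_cat2r -cats1 perm_catC.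
Qed.

Lemma perm_distinct s t : perm_eq s t -> distinct s = distinct t.
Proof. by move=> st; rewrite /distinct (perm_size (perm_undup (perm_mem st))). Qed.

Lemma distinct_cons x s : distinct (x :: s) = ((x \notin s) + distinct s)%N.
Proof. by rewrite /distinct /=; case: ifP. Qed.

Lemma distinct_rcons x s : distinct (rcons s x) = ((x \notin s) + distinct s)%N.
Proof. by rewrite -distinct_cons; apply: perm_distinct; rewrite perm_rcons. Qed.

Lemma distinct_size s : (distinct s <= size s)%N.
Proof. exact: size_undup. Qed.

Lemma distinct_cat s t : (distinct s <= distinct (s ++ t))%N.
Proof.
apply: uniq_leq_size; first exact: undup_uniq.
by move=> x; rewrite !mem_undup mem_cat => ->.
Qed.

Lemma distinct_take m n s : (m <= n)%N -> (distinct (take m s) <= distinct (take n s))%N.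
Proof.
move=> mn; rewrite -(cat_take_drop m (take n s)) take_takel//; exact: distinct_cat.
Qed.

(** At most [h] distinct values lie below [h]; a large range therefore forces many samples into the
    tail. *)
Lemma distinct_le_count h s : (distinct s <= h + count (leq h) s)%N.
Proof.
rewrite /distinct -(count_predC (leq h) (undup s)) addnC leq_add//.
  rewrite -size_filter -[leqRHS](size_iota 0); apply: uniq_leq_size.
    by rewrite filter_uniq// undup_uniq.
  by move=> x; rewrite mem_filter mem_iota /= add0n ltnNge => /andP[].
elim: s => //= x s IH; case: ifP => _ /=; last by rewrite leq_add2l.
exact: leq_trans IH (leq_addl _ _).
Qed.

(** These are the values whose deletion changes the range or the unseen mass, so they carry the
    whole Efron-Stein sum of both. *)
Definition singletons (s : seq nat) := [seq y <- s | count_mem y s == 1%N].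

Lemma uniq_singletons s : uniq (singletons s).
Proof.
rewrite /singletons; apply/count_mem_uniq => x; rewrite count_filter mem_filter /=.
case: (boolP (count_mem x s == 1%N)) => [/eqP h|h].
  rewrite (eq_count (a2 := pred1 x)) ?h.
    by rewrite -has_pred1 has_count h.
  by move=> y /=; case: eqP => // ->; rewrite h eqxx.
rewrite (eq_count (a2 := pred0)) ?count_pred0// => y /=.
by case: eqP => // ->; rewrite (negbTE h).
Qed.

Lemma size_singletons s : (size (singletons s) <= distinct s)%N.
Proof.
apply: uniq_leq_size; first exact: uniq_singletons.
by move=> x; rewrite mem_filter mem_undup => /andP[].
Qed.

Lemma notin_del s i : (i < size s)%N ->
  (nth 0%N s i \notin del s i) = (count_mem (nth 0%N s i) s == 1%N).
Proof.
move=> i_s; have /permP/(_ (pred1 (nth 0%N s i))) -> := perm_del i_s.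
by rewrite /= eqxx add1n eqSS -has_pred1 has_count -leqNgt leqn0.
Qed.

Section Occupancy.
Context {R : realType}.
Variables (w : nat -> R) (w_ge0 : forall x, 0 <= w x).
Hypothesis w_sum : series w @ \oo --> (1 : R).
Local Notation avg := (avg w).
Local Notation Ex := (Ex w).
Local Notation Var := (Var w).

(** [series w M] sums over the indices below [M], so this is the mass of the values at least [M],
    with [M] included. *)
Definition tailmass M := 1 - series w M.
Definition unseen (s : seq nat) := 1 - \sum_(y <- undup s) w y.

Lemma tailmass_cvg0 : tailmass @ \oo --> (0 : R).
Proof.
by rewrite -(subrr 1); apply: cvgB => //; exact: cvg_cst.
Qed.

Lemma bnd_bool (q : pred nat) : bnd (fun x => (q x)%:R : R).
Proof. by exists 1 => x; case: (q x); rewrite ?normr1// normr0 ler01. Qed.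

Lemma avg_sum (r : seq nat) (f : nat -> nat -> R) : (forall i, bnd (f i)) ->
  avg (fun x => \sum_(i <- r) f i x) = \sum_(i <- r) avg (f i).
Proof.
move=> bf; have := @Ex_sum _ _ w_ge0 w_sum 1 _ r predT (fun i s => f i (head 0%N s)).
by apply => i; have [C hC] := bf i; exists C => s _; apply: hC.
Qed.

Lemma avg_notin_uniq r : uniq r ->
  avg (fun x => (x \notin r)%:R) = 1 - \sum_(y <- r) w y.
Proof.
move=> ur; under [in RHS]eq_bigr do rewrite -(avg_eq1 w).
rewrite -avg_sum; last by move=> i; exact: bnd_bool.
rewrite -[X in _ = X - _](avg_cst w_ge0 w_sum 1) -mulN1r.
have b2 : bnd (fun x => \sum_(i <- r) (x == i)%:R : R).
  exists (\sum_(i <- r) 1) => x; apply: le_trans (ler_norm_sum _ _ _) _.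
  by apply: ler_sum => i _; case: eqP; rewrite ?normr1// normr0 ler01.
rewrite -(avgZ w_ge0 w_sum)//. rewrite -(avgD w_ge0 w_sum).
- congr avg; apply/funext => x; rewrite mulN1r.
  case: (boolP (x \in r)) => xr /=.
    rewrite (bigD1_seq x)//= eqxx big1 ?addr0 ?subrr// => i.
    by rewrite eq_sym => /negbTE ->.
  rewrite big_seq big1 ?subr0// => i ir; case: eqP => // xi.
  by rewrite xi ir in xr.
- by exists 1 => x; rewrite normr1.
- by case: b2 => C hC; exists C => x; rewrite mulN1r normrN.
Qed.

Lemma avg_notin s : avg (fun x => (x \notin s)%:R) = unseen s.
Proof.
rewrite /unseen -avg_notin_uniq ?undup_uniq//; congr avg.
by apply/funext => x; rewrite mem_undup.
Qed.

Lemma avg_ge M : avg (fun x => (M <= x)%:R) = tailmass M.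
Proof.
rewrite /tailmass /series /= -avg_notin_uniq ?iota_uniq//; congr avg.
by apply/funext => x; rewrite mem_index_iota /= -leqNgt.
Qed.

Lemma avg_neq x : avg (fun y => (y != x)%:R) = 1 - w x.
Proof.
rewrite -[w x](@big_seq1 _ _ +%R _ x w) -avg_notin_uniq//.
by congr avg; apply/funext => y; rewrite inE.
Qed.

Lemma sum_uniq_le1 r : uniq r -> \sum_(y <- r) w y <= 1.
Proof.
move=> ur; rewrite -subr_ge0 -avg_notin_uniq// -(avg_cst w_ge0 w_sum 0).
apply: avg_le => //; first by exists 0 => x; rewrite normr0.
exact: bnd_bool.
Qed.

Lemma unseen_ge0 s : 0 <= unseen s.
Proof. by rewrite subr_ge0 sum_uniq_le1// undup_uniq. Qed.

Lemma unseen_le1 s : unseen s <= 1.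
Proof. by rewrite gerBl sumr_ge0. Qed.

Lemma tailmass_ge0 M : 0 <= tailmass M.
Proof. by rewrite subr_ge0 sum_uniq_le1// iota_uniq. Qed.

Lemma w_le1 x : w x <= 1.
Proof. by have := @sum_uniq_le1 [:: x] isT; rewrite big_seq1. Qed.

Lemma bnds_unseen n : bnds n unseen.
Proof. by exists 1 => s _; rewrite ger0_norm ?unseen_ge0 ?unseen_le1. Qed.

Lemma bnds_distinct n : bnds n (fun s => (distinct s)%:R : R).
Proof. by apply: (@bnds_nat _ _ _ n) => s <-; exact: distinct_size. Qed.

Lemma perm_unseen s t : perm_eq s t -> unseen s = unseen t.
Proof. by move=> st; rewrite /unseen (perm_big _ (perm_undup (perm_mem st))). Qed.

Lemma unseen_cons x s : unseen (x :: s) = unseen s - w x *+ (x \notin s).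
Proof.
rewrite /unseen /=; case: ifP => _ /=; first by rewrite mulr0n subr0.
by rewrite big_cons mulr1n; ring.
Qed.

Lemma unseen_cat s t : unseen (s ++ t) <= unseen s.
Proof.
elim: t s => [|x t IH] s; first by rewrite cats0.
rewrite -cat_rcons; apply: le_trans (IH _) _.
rewrite (@perm_unseen _ (x :: s)) ?perm_rcons// unseen_cons gerBl mulrn_wge0//.
Qed.

Lemma unseen_take m n s : (m <= n)%N -> unseen (take n s) <= unseen (take m s).
Proof.
move=> mn; rewrite -(cat_take_drop m (take n s)) take_takel//; exact: unseen_cat.
Qed.

Lemma Ex_notin n x : Ex n (fun s => (x \notin s)%:R) = (1 - w x) ^+ n.
Proof.
rewrite -avg_neq -(Ex_prod w_ge0 w_sum); last exact: bnd_bool.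
apply: eq_Ex => s _; elim: s => [|y s IH]; first by rewrite big_nil.
by rewrite big_cons -IH inE negb_or eq_sym -natrM mulnb.
Qed.

Lemma Ex_in n x : Ex n (fun s => (x \in s)%:R) = 1 - (1 - w x) ^+ n.
Proof.
rewrite -Ex_notin -[X in X - _](Ex_cst w_ge0 w_sum n) -(ExB w_ge0 w_sum).
- by apply: eq_Ex => s _; case: (x \in s); rewrite ?subr0 ?subrr.
- exact: bnds_cst.
- exact: bnds_bool.
Qed.

Lemma sum_iota_undup (h : nat -> R) M s :
  \sum_(0 <= x < M) h x * (x \in s)%:R = \sum_(y <- undup s | (y < M)%N) h y.
Proof.
transitivity (\sum_(x <- iota 0 M | x \in s) h x).
  rewrite /index_iota subn0 [RHS]big_mkcond; apply: eq_bigr => x _.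
  by case: (x \in s); rewrite ?mulr1 ?mulr0.
rewrite -big_filter -[RHS]big_filter; apply: perm_big; apply: uniq_perm.
- by rewrite filter_uniq// iota_uniq.
- by rewrite filter_uniq// undup_uniq.
- by move=> x; rewrite !mem_filter mem_iota mem_undup andbC.
Qed.

Lemma Ex_count n M : Ex n (fun s => (count (leq M) s)%:R) = n%:R * tailmass M.
Proof.
elim: n => [|n IH]; first by rewrite /= mul0r.
have bc m : bnds m (fun s => (count (leq M) s)%:R : R).
  by apply: (@bnds_nat _ _ _ m) => s <-; exact: count_size.
rewrite /= -[RHS](_ : tailmass M + n%:R * tailmass M = _); last first.
  by rewrite -natr1; ring.
rewrite -IH -avg_ge -[X in _ + X](avg_cst w_ge0 w_sum) -(avgD w_ge0 w_sum).
- congr avg; apply/funext => x; rewrite -[X in X + _](Ex_cst w_ge0 w_sum n) -(ExD w_ge0 w_sum)//.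
    by apply: eq_Ex => s _; rewrite natrD.
  exact: bnds_cst.
- exact: bnd_bool.
- by eexists => x; exact: lexx.
Qed.

(** Linearity handles the values below [M]. The distinct values left out are at most as many as the
    samples that are at least [M], whose mean [n * tailmass M] vanishes. *)
Lemma Ex_distinct_cvg n :
  series (fun x => 1 - (1 - w x) ^+ n) @ \oo --> Ex n (fun s => (distinct s)%:R).
Proof.
have E M : series (fun x => 1 - (1 - w x) ^+ n) M =
    Ex n (fun s => (count (fun y => (y < M)%N) (undup s))%:R).
  rewrite /series /=; under eq_bigr do rewrite -Ex_in.
  rewrite -(Ex_sum w_ge0 w_sum); last by move=> i; exact: bnds_bool.
  apply: eq_Ex => s _; transitivity (\sum_(0 <= x < M) 1 * (x \in s)%:R : R).
    by apply: eq_bigr => x _; rewrite mul1r.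
  rewrite sum_iota_undup -big_filter -size_filter.
  by rewrite big_const_seq count_predT iter_addr_0.
have bc M : bnds n (fun s => (count (fun y => (y < M)%N) (undup s))%:R : R).
  apply: (@bnds_nat _ _ _ n) => s <-.
  exact: leq_trans (count_size _ _) (distinct_size _).
have bc' M : bnds n (fun s => (count (leq M) s)%:R : R).
  by apply: (@bnds_nat _ _ _ n) => s <-; exact: count_size.
apply: (@squeeze_cvgr _ _ _ _ (fun M => Ex n (fun s => (distinct s)%:R) - n%:R * tailmass M)
   (fun=> Ex n (fun s => (distinct s)%:R))); last exact: cvg_cst.
  apply: nearW => M; rewrite E; apply/andP; split.
    rewrite -Ex_count lerBlDr -(ExD w_ge0 w_sum)//; apply: Ex_le => //.
    - exact: bnds_distinct.
    - exact: bndsD.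
    - move=> s _; rewrite -natrD ler_nat /distinct.
      rewrite -(count_predC (fun y => (y < M)%N) (undup s)) leq_add2l.
      rewrite (eq_count (a2 := leq M)); last by move=> y /=; rewrite -leqNgt.
      elim: s => //= x s IH; case: ifP => _ /=; last by rewrite leq_add2l.
      exact: leq_trans IH (leq_addl _ _).
  apply: Ex_le => //; first exact: bnds_distinct.
  by move=> s _; rewrite ler_nat count_size.
rewrite -[X in _ --> X]subr0; apply: cvgB; first exact: cvg_cst.
rewrite -[X in _ --> X](mulr0 n%:R); apply: cvgM; first exact: cvg_cst.
exact: tailmass_cvg0.
Qed.

(** The same truncation as for the range; here the values above [M] account for at most
    [tailmass M]. *)
Lemma Ex_unseen_cvg n :
  series (fun x => w x * (1 - w x) ^+ n) @ \oo --> Ex n unseen.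
Proof.
have E M : series (fun x => w x * (1 - w x) ^+ n) M =
    Ex n (fun s => series w M - \sum_(y <- undup s | (y < M)%N) w y).
  rewrite /series /=.
  transitivity (\sum_(0 <= x < M) Ex n (fun s => w x * (x \notin s)%:R)).
    by apply: eq_bigr => x _; rewrite -Ex_notin (ExZ w_ge0 w_sum)//; exact: bnds_bool.
  rewrite -(Ex_sum w_ge0 w_sum); last first.
    by move=> i; apply: bndsM; [exact: bnds_cst|exact: bnds_bool].
  apply: eq_Ex => s _; rewrite -sum_iota_undup -sumrB; apply: eq_bigr => x _.
  by case: (x \in s); rewrite ?mulr1 ?mulr0 ?subrr ?subr0.
have bc M : bnds n (fun s => series w M - \sum_(y <- undup s | (y < M)%N) w y).
  exists 1 => s _; rewrite -sum_iota_undup -sumrB.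
  under eq_bigr do rewrite -{1}[w _]mulr1 -mulrBr.
  have h x : 0 <= w x * (1 - (x \in s)%:R) <= w x.
    by case: (x \in s); rewrite ?subrr ?subr0 ?mulr0 ?mulr1 ?lexx ?w_ge0.
  rewrite ger0_norm; last by apply: sumr_ge0 => i _; have /andP[] := h i.
  apply: (@le_trans _ _ (\sum_(0 <= x < M) w x)); last by rewrite sum_uniq_le1 ?iota_uniq.
  by apply: ler_sum => i _; have /andP[] := h i.
apply: (@squeeze_cvgr _ _ _ _ (fun M => Ex n unseen - tailmass M) (fun=> Ex n unseen));
    last exact: cvg_cst.
  apply: nearW => M; rewrite E.
  have split s : \sum_(y <- undup s) w y = \sum_(y <- undup s | (y < M)%N) w y +
      \sum_(y <- undup s | ~~ (y < M)%N) w y by rewrite (bigID (fun y => (y < M)%N)).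
  apply/andP; split.
    rewrite lerBlDr -[tailmass M](Ex_cst w_ge0 w_sum n) -(ExD w_ge0 w_sum)//; last exact: bnds_cst.
    apply: Ex_le => //; [exact: bnds_unseen|by apply: bndsD => //; exact: bnds_cst|].
    move=> s _; rewrite /tailmass /unseen split.
    have : 0 <= \sum_(y <- undup s | ~~ (y < M)%N) w y by apply: sumr_ge0.
    by lra.
  apply: Ex_le => //; first exact: bnds_unseen.
  move=> s _; rewrite /unseen split.
  have : series w M + \sum_(y <- undup s | ~~ (y < M)%N) w y <= 1.
    rewrite -big_filter -big_cat; apply: sum_uniq_le1; rewrite cat_uniq iota_uniq.
    rewrite filter_uniq ?undup_uniq// andbT /=; apply/hasPn => x.
    by rewrite mem_filter mem_index_iota => /andP[].
  by lra.
rewrite -[X in _ --> X]subr0; apply: cvgB; first exact: cvg_cst.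
exact: tailmass_cvg0.
Qed.

(** Deleting a sample lowers the range by 1 if its value is a singleton and by 0 otherwise, so the
    Efron-Stein sum counts singletons, and there are at most as many as distinct values. *)
Lemma Var_distinct n : Var n (fun s => (distinct s)%:R) <= Ex n (fun s => (distinct s)%:R).
Proof.
apply: le_trans (Efron_Stein w_ge0 w_sum (G := fun s t => (distinct (s ++ t))%:R) _ _) _.
- exact: bnds_distinct.
- move=> i i_n; apply: (@bnds_nat _ _ _ n) => s sn.
  apply: leq_trans (distinct_size _) _.
  by rewrite size_cat size_take size_drop sn i_n; lia.
rewrite -(Ex_sum w_ge0 w_sum); last first.
  move=> i; apply: bndsX; apply: bndsB; first exact: bnds_distinct.
  apply: (@bnds_nat _ _ _ n) => s sn; apply: leq_trans (distinct_size _) _.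
  by rewrite size_cat size_take size_drop sn ltn_ord; have := ltn_ord i; lia.
have E s : size s = n -> \sum_(i < n)
    ((distinct s)%:R - (distinct (take i s ++ drop i.+1 s))%:R) ^+ 2
    = (size (singletons s))%:R :> R.
  move=> sn; rewrite -[RHS]mulr1 mulr_natl -[RHS](_ : \sum_(i <- singletons s) 1 = _); last first.
    by rewrite big_const_seq count_predT iter_addr_0.
  rewrite [RHS]big_filter [RHS]big_mkcond [RHS](big_nth 0%N) [RHS]big_mkord sn.
  apply: eq_bigr => i _; have i_s : (i < size s)%N by rewrite sn.
  rewrite (perm_distinct (perm_del i_s)) -/(del s i) distinct_cons notin_del//.
  by rewrite natrD addrK; case: eqP => _; rewrite ?expr1n ?expr0n.
rewrite (eq_Ex w E); apply: Ex_le => //.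
- by apply: (@bnds_nat _ _ _ n) => s <-; apply: leq_trans (size_singletons _) (distinct_size _).
- exact: bnds_distinct.
- by move=> s _; rewrite ler_nat size_singletons.
Qed.

End Occupancy.

Section OccupancyMoments.
Context {R : realType}.
Variables (w : nat -> R) (w_ge0 : forall x, 0 <= w x).
Hypothesis w_sum : series w @ \oo --> (1 : R).
Local Notation avg := (avg w).
Local Notation Ex := (Ex w).
Local Notation Var := (Var w).
Local Notation unseen := (unseen w).
Local Notation tailmass := (tailmass w).

Lemma avg_mix (x : nat) (a b : R) :
  avg (fun y => if y == x then a else b) = w x * a + (1 - w x) * b.
Proof.
transitivity (avg (fun y => b + (a - b) * (y == x)%:R)).
  by congr avg; apply/funext => y; case: eqP => _ /=; ring.
rewrite (avgD w_ge0 w_sum); [ |by exists (`|b|) | ].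
  by rewrite avg_cst// (avgZ w_ge0 w_sum) ?avg_eq1; [ring|exact: bnd_bool].
exists `|a - b| => y; rewrite normrM -[leRHS]mulr1 ler_wpM2l//.
by case: eqP; rewrite ?normr1 ?normr0 ?ler01.
Qed.

Lemma Ex_count1 n x : Ex n (fun s => (count_mem x s == 1%N)%:R) =
  n%:R * w x * (1 - w x) ^+ n.-1.
Proof.
elim: n => [|n IH]; first by rewrite /= !mul0r.
transitivity (avg (fun y => if y == x then (1 - w x) ^+ n
    else n%:R * w x * (1 - w x) ^+ n.-1)).
  rewrite /=; congr avg; apply/funext => y; case: eqP => _ /=.
    rewrite -(Ex_notin w_ge0 w_sum); apply: eq_Ex => s _.
    by rewrite add1n eqSS -leqn0 leqNgt -has_count has_pred1.
  by rewrite -IH; apply: eq_Ex => s _; rewrite add0n.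
rewrite avg_mix /=; case: n IH => [|n] _; first by rewrite expr0; ring.
by rewrite /= exprS -(natr1 n.+1); ring.
Qed.

(** Deleting a singleton y raises the unseen mass by [w y], so Efron-Stein gives the mean of the sum
    of (w y)^2 over singletons. A value is a singleton with probability
    [n * w x * (1 - w x) ^+ n.-1], whence the cube. The bound is asked on partial sums because the
    list may contain values above any cutoff [M]; these cost at most [n * tailmass M]. *)
Lemma Var_unseen n (B : R) :
  (forall M, \sum_(0 <= x < M) n%:R * w x ^+ 3 * (1 - w x) ^+ n.-1 <= B) ->
  Var n unseen <= B.
Proof.
move=> hB.
apply: le_trans (Efron_Stein w_ge0 w_sum (G := fun s t => unseen (s ++ t)) _ _) _.
- exact: bnds_unseen.
- by move=> i i_n; exists 1 => s _; rewrite ger0_norm ?unseen_ge0 ?unseen_le1.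
rewrite -(Ex_sum w_ge0 w_sum); last first.
  move=> i; apply: bndsX; apply: bndsB; first exact: bnds_unseen.
  by exists 1 => s _; rewrite ger0_norm ?unseen_ge0 ?unseen_le1.
have w2 x : 0 <= w x ^+ 2 <= 1.
  by rewrite sqr_ge0 expr_le1// (w_le1 w_ge0 w_sum).
have E s : size s = n -> \sum_(i < n)
    (unseen s - unseen (take i s ++ drop i.+1 s)) ^+ 2
    = \sum_(y <- singletons s) w y ^+ 2 :> R.
  move=> sn; rewrite [RHS]big_filter [RHS]big_mkcond [RHS](big_nth 0%N) [RHS]big_mkord sn.
  apply: eq_bigr => i _; have i_s : (i < size s)%N by rewrite sn.
  rewrite (perm_unseen w (perm_del i_s)) -/(del s i) unseen_cons notin_del//.
  case: eqP => _; first by rewrite mulr1n; ring.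
  by rewrite mulr0n subr0 subrr expr0n.
rewrite (eq_Ex w E).
have key M : Ex n (fun s => \sum_(y <- singletons s) w y ^+ 2) <= B + n%:R * tailmass M.
  apply: le_trans (_ : _ <= Ex n (fun s => \sum_(0 <= x < M) w x ^+ 2 * (count_mem x s == 1%N)%:R
       + (count (leq M) s)%:R)) _; last first.
    rewrite (ExD w_ge0 w_sum); first last.
    - by apply: (@bnds_nat _ _ _ n) => s <-; exact: count_size.
    - by apply: bnds_sum => x; apply: bndsM; [exact: bnds_cst|exact: bnds_bool].
    rewrite (Ex_count w_ge0 w_sum) lerD2r (Ex_sum w_ge0 w_sum); last first.
      by move=> x; apply: bndsM; [exact: bnds_cst|exact: bnds_bool].
    apply: le_trans (hB M); rewrite le_eqVlt; apply/orP; left; apply/eqP.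
    apply: eq_bigr => x _; rewrite (ExZ w_ge0 w_sum) ?Ex_count1; last exact: bnds_bool.
    by ring.
  apply: Ex_le => //.
  - exists n%:R => s sn; rewrite ger0_norm; last by apply: sumr_ge0 => y _; have /andP[] := w2 y.
    apply: (@le_trans _ _ (\sum_(y <- singletons s) 1)).
      by apply: ler_sum => y _; have /andP[] := w2 y.
    rewrite big_const_seq count_predT iter_addr_0 ler_nat -sn.
    exact: leq_trans (size_singletons _) (distinct_size _).
  - apply: bndsD; last by apply: (@bnds_nat _ _ _ n) => s <-; exact: count_size.
    by apply: bnds_sum => x; apply: bndsM; [exact: bnds_cst|exact: bnds_bool].
  - move=> s _; rewrite (bigID (fun y => (y < M)%N))/=; apply: lerD.
      rewrite [leRHS](_ : _ = \sum_(0 <= x < M) w x ^+ 2 * (x \in singletons s)%:R).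
        by rewrite (sum_iota_undup (fun x => w x ^+ 2)) undup_id ?uniq_singletons.
      apply: eq_bigr => x _; congr (_ * _%:R); rewrite mem_filter /=.
      by case: eqP => // h; rewrite -has_pred1 has_count h.
    apply: (@le_trans _ _ (\sum_(y <- singletons s | ~~ (y < M)%N) 1)).
      by apply: ler_sum => y _; have /andP[] := w2 y.
    rewrite big_const_seq iter_addr_0 ler_nat (eq_count (a2 := leq M)); last first.
      by move=> y; rewrite /= -leqNgt.
    by rewrite /singletons count_filter sub_count// => y /= /andP[].
have cB : (fun M => B + n%:R * tailmass M) @ \oo --> B.
  rewrite -[X in _ --> X]addr0 -[X in _ --> _ + X](mulr0 n%:R).
  apply: cvgD; first exact: cvg_cst.
  by apply: cvgM; [exact: cvg_cst|exact: tailmass_cvg0].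
rewrite -(cvg_lim _ cB)//; apply: limr_ge; first by apply/cvg_ex; exists B.
exact: nearW.
Qed.

(** The number of samples in the tail is binomial, and this is its second factorial moment. *)
Lemma Ex_falling2 n h : Ex n (fun s => (count (leq h) s * (count (leq h) s).-1)%:R) =
  n%:R * n.-1%:R * tailmass h ^+ 2.
Proof.
have bc m : bnds m (fun s => (count (leq h) s)%:R : R).
  by apply: (@bnds_nat _ _ _ m) => s <-; exact: count_size.
have bf m : bnds m (fun s => (count (leq h) s * (count (leq h) s).-1)%:R : R).
  apply: (@bnds_nat _ _ _ (m * m)%N) => s <-; rewrite leq_mul ?count_size//.
  exact: leq_trans (leq_pred _) (count_size _ _).
elim: n => [|n IH]; first by rewrite /= !mul0r.
transitivity (avg (fun y => n%:R * n.-1%:R * tailmass h ^+ 2 +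
   (2 * (n%:R * tailmass h)) * (h <= y)%:R)).
  rewrite /=; congr avg; apply/funext => y.
  rewrite -IH -(Ex_count w_ge0 w_sum) -mulrA [X in _ + _ * X]mulrC mulrA.
  rewrite -(ExZ w_ge0 w_sum)// -(ExD w_ge0 w_sum)//; last first.
    by apply: bndsM => //; exact: bnds_cst.
  apply: eq_Ex => s _; set N := count _ s; case: (h <= y)%N => /=; last first.
    by rewrite mulr0 mul0r addr0 add0n.
  rewrite add1n /= mulr1 -natrM -natrD; congr (_%:R).
  by case: N => // N /=; lia.
rewrite (avgD w_ge0 w_sum) ?avg_cst// ?(avgZ w_ge0 w_sum) ?avg_ge//.
- by case: n {IH} => [|n] /=; [ring|rewrite -(natr1 n.+1) -(natr1 n); ring].
- exact: bnd_bool.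
- by eexists => x; exact: lexx.
- have := @bnd_bool R (leq h); case => C hC; exists (`|2 * (n%:R * tailmass h)| * C) => x.
  by rewrite normrM ler_wpM2l.
Qed.

(** If the range reaches [k], at least [k - h] samples are at least [h]; Markov's inequality is
    applied to the second factorial moment. A first moment would only give a bound linear in [n],
    too weak for weights of index 1 + gamma. *)
Lemma distinct_ge_le n k h : (h.+1 < k)%N ->
  Ex n (fun s => (k <= distinct s)%:R) <=
  n%:R ^+ 2 * tailmass h ^+ 2 / ((k - h) * (k - h).-1)%:R.
Proof.
move=> hk; have kh0 : (0 < (k - h) * (k - h).-1)%N by rewrite muln_gt0; apply/andP; split; lia.
rewrite ler_pdivlMr ?ltr0n// mulrC -(ExZ w_ge0 w_sum); last exact: bnds_bool.
apply: (@le_trans _ _ (n%:R * n.-1%:R * tailmass h ^+ 2)); last first.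
  by rewrite ler_wpM2r ?sqr_ge0// expr2 ler_wpM2l// ler_nat leq_pred.
rewrite -Ex_falling2; apply: Ex_le => //.
- by apply: bndsM; [exact: bnds_cst|exact: bnds_bool].
- apply: (@bnds_nat _ _ _ (n * n)%N) => s <-; rewrite leq_mul ?count_size//.
  exact: leq_trans (leq_pred _) (count_size _ _).
- move=> s _; case: (leqP k (distinct s)) => [kd|_]; last by rewrite mulr0.
  rewrite mulr1 ler_nat leq_mul//; have := distinct_le_count h s; first lia.
  by move=> ?; rewrite -!subn1 leq_sub2r//; lia.
Qed.

(** Given the first [n] draws, the next one is new with conditional probability [unseen]; [Q]
    records a restriction on these first draws. *)
Lemma Ex_new n k (Q : pred (seq nat)) :
  Ex n.+1 (fun s => [&& distinct (take n s) == k, distinct s == k.+1 & Q (take n s)]%:R) =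
  Ex n (fun s => unseen s * ((distinct s == k) && Q s)%:R).
Proof.
rewrite Ex_rcons; apply: eq_Ex => s sn.
rewrite -(avg_notin w_ge0 w_sum).
rewrite mulrC -(avgZ w_ge0 w_sum); last exact: bnd_bool.
congr avg; apply/funext => x; rewrite -cats1 take_size_cat// cats1 distinct_rcons.
case: eqP => [->|] /=; last by rewrite mul0r.
by case: (Q s); rewrite ?andbF ?mul0r// andbT mul1r; case: (x \in s); rewrite ?eqxx// add0n ltn_eqF.
Qed.

End OccupancyMoments.

Section UnseenLower.
Context {R : realType}.
Variables (w : nat -> R).
Hypothesis w0 : w 0%N = 0.
Hypothesis w_ge0 : forall x, 0 <= w x.
Hypothesis w_noninc : forall x y, (1 <= x)%N -> (x <= y)%N -> w y <= w x.

(** Among sets of given size, the initial segment has the largest weight. The induction removes one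
    element that is at least the size of the list. *)
Lemma sum_pos_uniq_le (s : seq nat) : uniq s -> all (leq 1) s ->
  \sum_(y <- s) w y <= \sum_(1 <= x < (size s).+1) w x.
Proof.
move: {2}(size s) (leqnn (size s)) => n; elim: n s => [|n IH] s.
  by rewrite leqn0 size_eq0 => /eqP -> _ _; rewrite !(big_nil, big_geq).
move=> sn us s1; have [s0|s0] := posnP (size s).
  by move/eqP: s0; rewrite size_eq0 => /eqP ->; rewrite !(big_nil, big_geq).
(* Pigeonhole: distinct positive numbers all below the size of the list would be too few. *)
have /hasP[y ys sy] : has (leq (size s)) s.
  apply/negPn/negP => /hasPn h.
  have : (size s <= size (iota 1 (size s).-1))%N.
    apply: uniq_leq_size => // x xs; rewrite mem_iota (allP s1)//= add1n prednK//.
    by rewrite ltnNge h.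
  by rewrite size_iota; lia.
rewrite (perm_big _ (perm_to_rem ys)) big_cons big_nat_recr//= addrC lerD//.
  have -> : size s = (size (rem y s)).+1 by rewrite size_rem// prednK.
  apply: IH; [by rewrite size_rem// -ltnS prednK|exact: rem_uniq|].
  by apply/allP => x /mem_rem /(allP s1).
exact: w_noninc.
Qed.

(** The least unseen mass for a given range R is reached when the visited values are 1, ..., R. The
    value 0 may occur in the list but has no weight. *)
Lemma unseen_ge_tailmass s : tailmass w (distinct s).+1 <= unseen w s.
Proof.
rewrite /tailmass /unseen lerB// /series /= big_nat_recl// w0 add0r.
apply: (@le_trans _ _ (\sum_(y <- [seq y <- undup s | leq 1 y]) w y)).
  rewrite big_filter [leRHS]big_mkcond; apply: ler_sum => y _.
  by case: y => [|y] /=; rewrite ?w0.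
apply: le_trans (sum_pos_uniq_le _ _) _; [|exact: filter_all|].
  by rewrite filter_uniq// undup_uniq.
rewrite big_add1 /= size_filter /distinct.
rewrite [leRHS](big_cat_nat (n := count (leq 1) (undup s)))//= ?count_size//.
by rewrite lerDl sumr_ge0.
Qed.

End UnseenLower.

(** * The Gamma function and the Sibuya weights *)

Section HalfLine.
Context {R : realType}.
Local Notation mu := (@lebesgue_measure R).
Local Notation pos := (`](0 : R), +oo[%classic).
Implicit Types (f G : R -> R) (z x : R).

Lemma continuous_powR z x : 0 < x -> {for x, continuous (@powR R ^~ z)}.
Proof.
move=> x0; apply: differentiable_continuous; apply/derivable1_diffP.
by apply: derivable_powR; rewrite in_itv/= andbT.
Qed.

(** Monotone convergence. Integration by parts and changes of variable are carried out on compact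
    intervals and reach the half-line through this limit. *)
Lemma integral_halfline_cvg f (a b : nat -> R) :
  (forall t, 0 < t -> 0 <= f t) -> measurable_fun pos f ->
  (forall n, 0 < a n) ->
  {homo a : m n / (m <= n)%N >-> n <= m} -> {homo b : m n / (m <= n)%N >-> m <= n} ->
  a @ \oo --> (0 : R) -> b @ \oo --> +oo ->
  (\int[mu]_(t in `[a n, b n]) (f t)%:E @[n --> \oo] -->
   \int[mu]_(t in pos) (f t)%:E)%E.
Proof.
move=> f0 mf a0 amono bmono acvg bcvg.
have sub n : `[a n, b n] `<=` pos.
  by move=> t /=; rewrite !in_itv/= andbT => /andP[/(lt_le_trans (a0 n))].
have E n : (\int[mu]_(t in `[a n, b n]) (f t)%:E =
    \int[mu]_(t in pos) ((fun t => (f t)%:E) \_ `[a n, b n]) t)%E.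
  rewrite [LHS]integral_mkcond [RHS]integral_mkcond; apply: eq_integral => t _.
  rewrite !patchE; have [tab|_] := boolP (t \in `[a n, b n]%classic); last by case: ifPn.
  by rewrite mem_set//; apply: (sub n); rewrite inE in tab.
rewrite (funext E) {E}.
rewrite [X in _ --> X](_ : _ = \int[mu]_(t in pos)
    (fun t => limn (fun n => ((fun t => (f t)%:E) \_ `[a n, b n]) t)) t)%E.
  have := @cvg_monotone_convergence _ _ R mu pos (measurable_itv _)
    (fun n => (fun t => (f t)%:E) \_ `[a n, b n]); apply.
  - move=> n; apply: (@measurable_funS _ _ _ _ setT) => //.
    rewrite (_ : _ \_ _ = EFin \o (f \_ `[a n, b n])); last exact: restrict_EFin.
    apply/measurable_EFinP.
    apply/(measurable_restrictT _ _).1 => //; apply: measurable_funS mf => //; exact: sub.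
  - move=> n t /=; rewrite in_itv/= andbT => t0; rewrite patchE; case: ifPn => // _.
    by rewrite lee_fin f0.
  - move=> t /=; rewrite in_itv/= andbT => t0 m n mn; rewrite !patchE.
    case: ifPn => [|_]; last by case: ifPn => // _; rewrite lee_fin f0.
    rewrite inE /= in_itv/= => /andP[h1 h2]; rewrite mem_set//= in_itv/=.
    by rewrite (le_trans (amono _ _ mn))//= (le_trans h2)//; exact: bmono.
apply: eq_integral => t; rewrite inE /= in_itv/= andbT => t0; symmetry.
apply/cvg_lim => //; apply: cvg_near_cst; near=> n.
rewrite patchE mem_set//= in_itv/=; apply/andP; split.
  near: n; exact: (cvgr_le _ acvg).
by near: n; move/cvgryPge : bcvg; apply.
Unshelve. all: by end_near. Qed.

Definition expand n : R := n.+1%:R.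

Lemma expand_gt0 n : 0 < expand n. Proof. by rewrite ltr0n. Qed.

Lemma expand_cvgy : expand @ \oo --> +oo.
Proof.
apply/cvgryPge => A; near=> n; rewrite /expand.
apply: (@le_trans _ _ n%:R); last by rewrite ler_nat.
by near: n; exact: nbhs_infty_ger.
Unshelve. all: by end_near. Qed.

Lemma expandV_cvg0 : (fun n => (expand n)^-1) @ \oo --> (0 : R).
Proof. exact: cvg_harmonic. Qed.

Lemma integral_halfline_expand f :
  (forall t, 0 < t -> 0 <= f t) -> measurable_fun pos f ->
  (\int[mu]_(t in `[((expand n)^-1)%R, expand n]) (f t)%:E @[n --> \oo] -->
   \int[mu]_(t in pos) (f t)%:E)%E.
Proof.
move=> f0 mf; apply: integral_halfline_cvg => //.
- by move=> n; rewrite invr_gt0 expand_gt0.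
- by move=> m n mn; rewrite lef_pV2 ?posrE ?expand_gt0// ler_nat.
- by move=> m n mn; rewrite ler_nat.
- exact: expandV_cvg0.
- exact: expand_cvgy.
Qed.

Lemma continuous_halfline_measurable f :
  (forall t, 0 < t -> {for t, continuous f}) -> measurable_fun pos f.
Proof.
move=> cf; apply: open_continuous_measurable_fun; first exact: interval_open.
by move=> t; rewrite inE/= in_itv/= andbT => /cf.
Qed.

Lemma continuous_halfline_within f (a b : R) : 0 < a ->
  (forall t, 0 < t -> {for t, continuous f}) -> {within `[a, b], continuous f}.
Proof.
move=> a0 cf; apply: continuous_in_subspaceT => t; rewrite inE/= in_itv/= => /andP[at_ _].
by apply: cf; exact: lt_le_trans at_.
Qed.

Lemma derivable_halfline_LR (F : R -> R) (a b : R) : 0 < a -> a < b ->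
  (forall t : R, 0 < t -> derivable F t 1) -> derivable_oo_LRcontinuous F a b.
Proof.
move=> a0 ab dF; have cF t : 0 < t -> {for t, continuous F}.
  by move=> t0; apply: differentiable_continuous; apply/derivable1_diffP; exact: dF.
split.
- by move=> t; rewrite in_itv/= => /andP[at_ _]; apply: dF; exact: lt_trans at_.
- by apply: cvg_at_right_filter; exact: cF.
- by apply: cvg_at_left_filter; apply: cF; exact: lt_trans ab.
Qed.

Lemma exp_ge_pow (t : R) n : 0 <= t -> t ^+ n / n`!%:R <= expR t.
Proof.
case: n => [|n] t0; first by rewrite expr0 divr1; have := expR_ge1Dx t; lra.
by have := expR_ge1Dxn n t0; lra.
Qed.

Lemma exp_ge_pow' (t : R) n : 0 <= t -> t ^+ n * expR (- t) <= n`!%:R.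
Proof.
move=> t0; rewrite expRN ler_pdivrMr ?expR_gt0// mulrC -ler_pdivrMr ?ltr0n ?fact_gt0//.
exact: exp_ge_pow.
Qed.

Definition gkernel z (t : R) : R := t `^ (z - 1) * expR (- t).

Lemma gkernel_ge0 z t : 0 <= gkernel z t.
Proof. by rewrite mulr_ge0 ?powR_ge0 ?expR_ge0. Qed.

Lemma continuous_expRN (t : R) : {for t, continuous (fun x : R => expR (- x))}.
Proof.
apply: (@continuous_comp _ _ _ (fun x : R => - x) expR); first exact: opp_continuous.
exact: continuous_expR.
Qed.

Lemma gkernel_continuous z t : 0 < t -> {for t, continuous (gkernel z)}.
Proof.
move=> t0; apply: cvgM; [exact: continuous_powR|exact: continuous_expRN].
Qed.

Lemma gkernel_measurable z : measurable_fun pos (gkernel z).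
Proof. by apply: continuous_halfline_measurable => t; exact: gkernel_continuous. Qed.

(** Kept in the extended reals so that the functional equation can be proved before finiteness is
    known; finiteness for 0 < z < 1 is then deduced from it. *)
Definition eGamma z : \bar R := (\int[mu]_(t in pos) (gkernel z t)%:E)%E.

Lemma GammaE z : Gamma z = fine (eGamma z). Proof. by []. Qed.

Lemma eGamma_ge0 z : (0 <= eGamma z)%E.
Proof. by apply: integral_ge0 => t _; rewrite lee_fin gkernel_ge0. Qed.

Lemma integral_expRN (c : R) : 0 < c ->
  (\int[mu]_(t in pos) (expR (- (c * t)))%:E = (c^-1)%:E)%E.
Proof.
move=> c0.
have d (t : R) : is_derive t (1 : R) (fun t : R => - c^-1 * expR (- (c * t))) (expR (- (c * t))).
  apply: is_derive_eq.
  by rewrite /GRing.scale/=; field; rewrite gt_eqF.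
rewrite integral_itv_obnd_cbnd; last first.
  apply/measurable_EFinP; apply: continuous_halfline_measurable => t _.
  apply: (@continuous_comp _ _ _ (fun t : R => - (c * t)) expR); last exact: continuous_expR.
  by apply: continuousN; apply: continuousM => //; exact: cst_continuous.
rewrite (@ge0_continuous_FTC2y _ _ (fun t => - c^-1 * expR (- (c * t))) 0 0)//.
- by rewrite mulr0 oppr0 expR0 mulr1 -EFinB sub0r opprK.
- apply: continuous_subspaceT => t.
  apply: (@continuous_comp _ _ _ (fun t : R => - (c * t)) expR); last exact: continuous_expR.
  by apply: continuousN; apply: continuousM => //; exact: cst_continuous.
- rewrite -[X in _ --> X](mulr0 (- c^-1)); apply: cvgM; first exact: cvg_cst.
  apply: (@cvg_comp _ _ _ (fun t : R => c * t) (fun x => expR (- x)) _ +oo); last exact: cvgr_expR.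
  by apply: gt0_cvgMry.
- apply: cvg_at_right_filter; have /derivable1_diffP/differentiable_continuous :
    derivable (fun t : R => - c^-1 * expR (- (c * t))) 0 1 by have [] := d 0.
  exact.
- by move=> t _; rewrite derive1E; have [_ ->] := d t.
Qed.

End HalfLine.

Section GammaFunction.
Context {R : realType}.
Local Notation mu := (@lebesgue_measure R).
Local Notation pos := (`](0 : R), +oo[%classic).
Implicit Types (z x t : R).

Lemma eGamma_ge1_lty z : 1 <= z -> (eGamma z < +oo)%E.
Proof.
move=> z1; set m := (Num.bound (z - 1)).
have zm : z - 1 <= m%:R by apply/ltW/archi_boundP; lra.
(* The summand 1 serves for t <= 1, where the power is at most 1; the other one serves for t > 1
   through t^m e^(-t/2) <= 2^m m!. *)
pose C : R := 1 + 2 ^+ m * m`!%:R.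
have C0 : 0 <= C by rewrite addr_ge0// mulr_ge0 ?exprn_ge0.
apply: (@le_lt_trans _ _ (\int[mu]_(t in pos) (C%:E * (expR (- (2^-1 * t)))%:E))%E).
  apply: ge0_le_integral => //.
  - by move=> t _; rewrite lee_fin gkernel_ge0.
  - by apply/measurable_EFinP; exact: gkernel_measurable.
  - apply: measurable_funeM; apply/measurable_EFinP.
    apply: continuous_halfline_measurable => t _.
    apply: (@continuous_comp _ _ _ (fun t : R => - (2^-1 * t)) expR); last exact: continuous_expR.
    by apply: continuousN; apply: continuousM => //; exact: cst_continuous.
  - move=> t /=; rewrite in_itv/= andbT => t0; rewrite -EFinM lee_fin /gkernel.
    have -> : expR (- t) = expR (- (2^-1 * t)) * expR (- (2^-1 * t)).
      by rewrite -expRD; congr expR; field.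
    rewrite mulrA ler_wpM2r ?expR_ge0//.
    have e1 : expR (- (2^-1 * t)) <= 1 by rewrite expR_le1; nra.
    have [t1|t1] := lerP t 1.
      apply: (@le_trans _ _ (1 * 1)); last by rewrite mulr1 lerDl mulr_ge0 ?exprn_ge0.
      rewrite ler_pM ?powR_ge0 ?expR_ge0//.
      rewrite -[leRHS](powRr0 t); apply: ger_powR; [by rewrite t0 t1|lra].
    apply: (@le_trans _ _ (t ^+ m * expR (- (2^-1 * t)))).
      rewrite ler_wpM2r ?expR_ge0// -powR_mulrn ?(ltW t0)//.
      by apply: ler_powR => //; exact: ltW.
    have -> : t ^+ m = 2 ^+ m * (2^-1 * t) ^+ m.
      by rewrite -exprMn; congr (_ ^+ _); field.
    rewrite -mulrA /C; apply: (@le_trans _ _ (2 ^+ m * m`!%:R)); last by rewrite lerDr.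
    by rewrite ler_wpM2l ?exprn_ge0//; apply: exp_ge_pow'; lra.
rewrite ge0_integralZl//.
- by rewrite integral_expRN// -EFinM ltry.
- apply/measurable_EFinP; apply: continuous_halfline_measurable => t _.
  apply: (@continuous_comp _ _ _ (fun t : R => - (2^-1 * t)) expR); last exact: continuous_expR.
  by apply: continuousN; apply: continuousM => //; exact: cst_continuous.
Qed.

Lemma gkernel_parts z (a b : R) : 0 < z -> 0 < a -> a < b ->
  (z%:E * \int[mu]_(t in `[a, b]) (gkernel z t)%:E =
   (expR (- b) * b `^ z - expR (- a) * a `^ z)%:E +
     \int[mu]_(t in `[a, b]) (gkernel (z + 1) t)%:E)%E.
Proof.
move=> z0 a0 ab.
have dF (t : R) : is_derive t (1 : R) (fun t : R => expR (- t)) (- expR (- t)).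
  by apply: is_derive_eq; rewrite /GRing.scale/=; ring.
have := @integration_by_parts R (fun t => expR (- t)) (fun t => t `^ z)
  (fun t => - expR (- t)) (fun t => z * t `^ (z - 1)) a b ab.
have <- : (z%:E * \int[mu]_(t in `[a, b]) (gkernel z t)%:E =
    \int[mu]_(t in `[a, b]) (expR (- t) * (z * t `^ (z - 1)))%:E)%E.
  rewrite -ge0_integralZl//.
  - by apply: eq_integral => t _; rewrite -EFinM /gkernel; congr EFin; ring.
  - apply/measurable_EFinP; apply: measurable_funS (gkernel_measurable z) => //.
    by move=> t /=; rewrite !in_itv/= andbT => /andP[/(lt_le_trans a0)].
  - by move=> t _; rewrite lee_fin gkernel_ge0.
  - by rewrite lee_fin ltW.
move=> ->; first last.
- by move=> t; rewrite in_itv/= => /andP[at_ _]; rewrite powR_derive1// in_itv/= andbT (lt_trans a0).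
- apply: derivable_halfline_LR => // t t0.
  by apply: derivable_powR; rewrite in_itv/= andbT.
- apply: continuous_halfline_within => // t t0; apply: cvgM; first exact: cvg_cst.
  exact: continuous_powR.
- by move=> t _; rewrite derive1E; have [_ ->] := dF t.
- by apply: derivable_halfline_LR => // t t0; have [] := dF t.
- apply: continuous_halfline_within => // t t0; apply: cvgN; exact: continuous_expRN.
congr (_ + _)%E; rewrite (_ : (\int[mu]_(x in _) _ = - \int[mu]_(t in `[a, b]) (gkernel (z + 1) t)%:E)%E).
  by rewrite oppeK.
rewrite -integral_ge0N; last by move=> t _; rewrite lee_fin gkernel_ge0.
by apply: eq_integral => t _; rewrite -EFinN /gkernel addrK; congr EFin; ring.
Qed.

Lemma expR_powR_cvg0 z :
  (fun n => expR (- expand n) * (expand n : R) `^ z) @ \oo --> (0 : R).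
Proof.
set m := Num.bound `|z|.
have zm : z <= m%:R by apply: le_trans (ler_norm z) _; apply/ltW/archi_boundP.
apply: (@squeeze_cvgr _ _ _ _ (fun=> 0) (fun n => m.+1`!%:R * (expand n)^-1)).
- apply: nearW => n; rewrite mulr_ge0 ?expR_ge0 ?powR_ge0//=.
  have b0 := @expand_gt0 R n; rewrite ler_pdivlMr//.
  apply: le_trans (exp_ge_pow' m.+1 (ltW b0)).
  have h : (expand n : R) `^ z <= expand n ^+ m.
    by rewrite -powR_mulrn ?(ltW b0)//; apply: ler_powR => //; rewrite /expand ler1n.
  rewrite exprSr [leLHS](_ : _ = expand n `^ z * expand n * expR (- expand n)); last by ring.
  rewrite ler_wpM2r ?expR_ge0//.
  by rewrite ler_wpM2r ?(ltW b0).
- exact: cvg_cst.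
- rewrite -[X in _ --> X](mulr0 (m.+1`!%:R : R)); apply: cvgM; first exact: cvg_cst.
  exact: expandV_cvg0.
Qed.

Lemma powR_expandV_cvg0 z : 0 < z -> (fun n => ((expand n)^-1 : R) `^ z) @ \oo --> (0 : R).
Proof.
move=> z0; have /cvg_at_rightP := powR_cvg0 z0; apply; split.
  by move=> n; rewrite invr_gt0 expand_gt0.
exact: expandV_cvg0.
Qed.

Lemma eGamma_rec z : 0 < z -> (z%:E * eGamma z = eGamma (z + 1))%E.
Proof.
move=> z0.
have c1 : (z%:E * \int[mu]_(t in `[((expand n)^-1)%R, expand n]) (gkernel z t)%:E
    @[n --> \oo] --> z%:E * eGamma z)%E.
  apply: cvgeZl => //; apply: integral_halfline_expand.
    by move=> t _; exact: gkernel_ge0.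
  exact: gkernel_measurable.
have c2 : (z%:E * \int[mu]_(t in `[((expand n)^-1)%R, expand n]) (gkernel z t)%:E
    @[n --> \oo] --> eGamma (z + 1))%E.
  rewrite -[X in _ --> X]add0e.
  apply: (cvg_trans (G := ((expR (- expand n) * (expand n : R) `^ z -
      expR (- (expand n)^-1) * ((expand n)^-1 : R) `^ z)%:E +
     \int[mu]_(t in `[((expand n)^-1)%R, expand n]) (gkernel (z + 1) t)%:E)%E @[n --> \oo])).
    apply: near_eq_cvg; near=> n; rewrite gkernel_parts//.
      by rewrite invr_gt0 expand_gt0.
    have n1 : 1 < expand n :> R.
      by rewrite /expand ltr1n ltnS; near: n; exact: nbhs_infty_gt.
    by apply: lt_trans (n1); rewrite invf_lt1 ?expand_gt0.
  apply: cvgeD => //.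
    apply: cvg_EFin; first exact: nearW.
    rewrite -(subr0 0); apply: cvgB; first exact: expR_powR_cvg0.
    apply: (@squeeze_cvgr _ _ _ _ (fun=> 0) (fun n => ((expand n)^-1 : R) `^ z)).
    - apply: nearW => n; rewrite mulr_ge0 ?expR_ge0 ?powR_ge0//=.
      by rewrite ler_piMl ?powR_ge0// expR_le1 oppr_le0 invr_ge0 ltW// expand_gt0.
    - exact: cvg_cst.
    - exact: powR_expandV_cvg0.
  apply: integral_halfline_expand.
    by move=> t _; exact: gkernel_ge0.
  exact: gkernel_measurable.
exact: (cvg_unique _ c1 c2).
Unshelve. all: by end_near. Qed.

Lemma eGamma_fin_num z : 0 < z -> eGamma z \is a fin_num.
Proof.
move=> z0; rewrite ge0_fin_numE ?eGamma_ge0//.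
have := @eGamma_ge1_lty (z + 1) (ltac:(lra)).
rewrite -eGamma_rec//; case: (eGamma z) (eGamma_ge0 z) => //=.
  by move=> r _ _; rewrite ltry.
by move=> _; rewrite mulry gtr0_sg// mul1e.
Qed.

Lemma Gamma_rec z : 0 < z -> Gamma (z + 1) = z * Gamma z.
Proof. by move=> z0; rewrite !GammaE -eGamma_rec// fineM ?eGamma_fin_num. Qed.

Lemma Gamma_ge0 z : 0 <= Gamma z.
Proof. by rewrite GammaE fine_ge0// eGamma_ge0. Qed.

Lemma Gamma1 : Gamma 1 = 1 :> R.
Proof.
rewrite GammaE /eGamma (_ : (\int[mu]_(t in pos) _ = 1%:E)%E)//.
rewrite -[X in X%:E](invr1) -integral_expRN//; apply: eq_integral => t.
rewrite inE/= in_itv/= andbT => t0.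
by rewrite /gkernel subrr powRr0 !mul1r.
Qed.

Lemma Gamma_nat n : Gamma (n%:R + 1) = n`!%:R :> R.
Proof.
elim: n => [|n IH]; first by rewrite add0r Gamma1.
have n0 : 0 < n%:R + 1 :> R by rewrite natr1 ltr0n.
by rewrite -[n.+1%:R]natr1 Gamma_rec// IH factS natrM natr1.
Qed.

Lemma young_powR (s gamma : R) : 0 < gamma < 1 -> 0 <= s ->
  s `^ gamma <= 1 - gamma + gamma * s.
Proof.
move=> /andP[g0 g1] s0.
have := @conjugate_powR R (s `^ gamma) 1 (gamma^-1) ((1 - gamma)^-1) (powR_ge0 _ _) ler01.
rewrite !invr_gt0 subr_gt0 => /(_ g0 g1); rewrite !invrK mulr1 powR1 mul1r.
by rewrite -powRrM mulfV ?gt_eqF// powRr1// addrC subrK => /(_ erefl); lra.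
Qed.

(* Convexity of t^gamma, in Young's form, stands in for the log-convexity of Gamma. *)
Lemma Gamma_shift_le x (gamma : R) : 0 < gamma < 1 -> 0 < x ->
  Gamma (x + gamma) <= x `^ gamma * Gamma x.
Proof.
move=> /[dup] g01 /andP[g0 g1] x0.
have xg0 : 0 < x + gamma by lra.
have x10 : 0 < x + 1 by lra.
rewrite -lee_fin GammaE fineK ?eGamma_fin_num//.
pose A := x `^ gamma * (1 - gamma); pose B := x `^ gamma * gamma / x.
have A0 : 0 <= A by rewrite mulr_ge0 ?powR_ge0//; lra.
have B0 : 0 <= B by rewrite !mulr_ge0 ?powR_ge0 ?invr_ge0//; lra.
apply: (@le_trans _ _ (A%:E * eGamma x + B%:E * eGamma (x + 1))%E); last first.
  rewrite -eGamma_rec// muleA -EFinM GammaE.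
  rewrite -(fineK (eGamma_fin_num x0)) -!EFinM -EFinD lee_fin /=.
  rewrite (_ : _ + _ = x `^ gamma * fine (eGamma x))//.
  by rewrite /A /B; field; rewrite gt_eqF.
rewrite -ge0_integralZl//; last 2 first.
- by apply/measurable_EFinP; exact: gkernel_measurable.
- by move=> t _; rewrite lee_fin gkernel_ge0.
rewrite -ge0_integralZl//; last 2 first.
- by apply/measurable_EFinP; exact: gkernel_measurable.
- by move=> t _; rewrite lee_fin gkernel_ge0.
rewrite -ge0_integralD//; last 4 first.
- by move=> t _; rewrite -EFinM lee_fin mulr_ge0// gkernel_ge0.
- by apply: measurable_funeM; apply/measurable_EFinP; exact: gkernel_measurable.
- by move=> t _; rewrite -EFinM lee_fin mulr_ge0// gkernel_ge0.
- by apply: measurable_funeM; apply/measurable_EFinP; exact: gkernel_measurable.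
apply: ge0_le_integral => //.
- by move=> t _; rewrite lee_fin gkernel_ge0.
- by apply/measurable_EFinP; exact: gkernel_measurable.
- by apply: emeasurable_funD; apply: measurable_funeM; apply/measurable_EFinP;
    exact: gkernel_measurable.
move=> t /=; rewrite in_itv/= andbT => t0; rewrite -!EFinM -EFinD lee_fin /gkernel.
rewrite !mulrA -mulrDl ler_wpM2r ?expR_ge0//.
have -> : t `^ (x + gamma - 1) = t `^ (x - 1) * t `^ gamma.
  by rewrite -powRD; [congr (_ `^ _); ring|rewrite (gt_eqF t0) implybT].
have -> : t `^ (x + 1 - 1) = t `^ (x - 1) * t.
  by rewrite -{3}(powRr1 (ltW t0)) -powRD; [congr (_ `^ _); ring|rewrite (gt_eqF t0) implybT].
have -> : t `^ gamma = x `^ gamma * (t / x) `^ gamma.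
  rewrite -powRM ?divr_ge0 ?ltW//; congr (_ `^ _); field; by rewrite gt_eqF.
have := @young_powR (t / x) gamma g01 (divr_ge0 (ltW t0) (ltW x0)).
set y := _ `^ gamma => hy; set u := t `^ (x - 1); set v := x `^ gamma.
have uv : 0 <= u * v by rewrite mulr_ge0// powR_ge0.
rewrite (_ : A * u + B * (u * t) = u * v * (1 - gamma + gamma * (t / x))); last first.
  by rewrite /A /B -/v; field; rewrite gt_eqF.
by rewrite mulrA ler_wpM2l.
Qed.

(** If Gamma vanished at z, shifting by 1 - z would give Gamma(1) <= 0. *)
Lemma Gamma_gt0 z : 0 < z < 1 -> 0 < Gamma z.
Proof.
move=> /andP[z0 z1]; rewrite lt_neqAle Gamma_ge0 andbT eq_sym; apply/negP => /eqP G0.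
have := @Gamma_shift_le z (1 - z) (ltac:(lra)) z0.
by rewrite G0 mulr0 addrC subrK Gamma1 ler10.
Qed.

End GammaFunction.

(** * Tail of the Sibuya law *)

Section SibuyaTail.
Context {R : realType}.
Variable (gamma : R).
Hypothesis gamma01 : 0 < gamma < 1.

(** The Sibuya tail, the sum of r_l over l >= n, which equals Gamma(n - gamma) / (Gamma(1 - gamma)
    Gamma(n)) for n >= 1. The product form reads it as the probability of surviving past time n - 1
    when death at time j has probability gamma / j. *)
Definition sib (n : nat) : R := \prod_(1 <= j < n) (1 - gamma / j%:R).

Lemma sib_factor_gt0 j : (0 < j)%N -> 0 < 1 - gamma / j%:R.
Proof.
case/andP: gamma01 => g0 g1 j0; rewrite subr_gt0 ltr_pdivrMr ?ltr0n// mul1r.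
by apply: lt_le_trans g1 _; rewrite ler1n.
Qed.

Lemma sib_gt0 n : 0 < sib n.
Proof.
rewrite /sib big_nat; apply: prodr_gt0 => j /andP[j1 _]; exact: sib_factor_gt0.
Qed.

Lemma sib1 : sib 1 = 1. Proof. by rewrite /sib big_geq. Qed.

Lemma sibS n : (0 < n)%N -> sib n.+1 = sib n * (1 - gamma / n%:R).
Proof. by move=> n0; rewrite /sib big_nat_recr. Qed.

Lemma Gamma_sib n : Gamma (n.+1%:R - gamma) = Gamma (1 - gamma) * n`!%:R * sib n.+1.
Proof.
case/andP: gamma01 => g0 g1.
elim: n => [|n IH]; first by rewrite sib1 !mulr1.
have n0 : 0 < n.+1%:R - gamma by rewrite subr_gt0 (lt_le_trans g1)// ler1n.
rewrite (_ : n.+2%:R - gamma = n.+1%:R - gamma + 1); last by rewrite -[n.+2%:R]natr1; ring.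
rewrite Gamma_rec// IH (sibS (n := n.+1))// factS natrM.
by field; rewrite nat1r pnatr_eq0.
Qed.

Lemma sibuyaE n : (0 < n)%N -> sibuya gamma n = gamma / n%:R * sib n.
Proof.
case: n => // n _; rewrite /sibuya Gamma_sib Gamma_nat factS natrM.
case/andP: gamma01 => g0 g1.
have G0 : Gamma (1 - gamma) != 0 by rewrite gt_eqF// Gamma_gt0//; lra.
by field; rewrite ?G0 ?nat1r ?pnatr_eq0 -?lt0n ?fact_gt0.
Qed.

Lemma sibuya_diff n : (0 < n)%N -> sibuya gamma n = sib n - sib n.+1.
Proof. by move=> n0; rewrite sibuyaE// sibS//; ring. Qed.

Lemma sibuya_gt0 n : (0 < n)%N -> 0 < sibuya gamma n.
Proof.
by move=> n0; rewrite sibuyaE// mulr_gt0 ?sib_gt0// divr_gt0 ?ltr0n//; case/andP: gamma01.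
Qed.

Lemma sib_noninc m n : (m <= n)%N -> sib n <= sib m.
Proof.
elim: n => [|n IH]; first by rewrite leqn0 => /eqP ->.
rewrite leq_eqVlt => /predU1P[-> //|]; rewrite ltnS => /IH; apply: le_trans.
case: n {IH} => [|n]; first by rewrite /sib !big_geq.
by rewrite -subr_ge0 -sibuya_diff// ltW// sibuya_gt0.
Qed.

(** [Gamma_shift_le] is used at n + 1 - gamma with shift gamma and at n with shift 1 - gamma. The
    two bounds compare Gamma(n + 1 - gamma) with n! from opposite sides and agree in the limit, so
    Stirling's formula is avoided. *)
Lemma sib_asymp : (fun n => n%:R `^ gamma * sib n) @ \oo --> (Gamma (1 - gamma))^-1.
Proof.
case/andP: (gamma01) => g0 g1; set c := Gamma _.
have c0 : 0 < c by apply: Gamma_gt0; lra.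
have bound n : (0 < n)%N ->
    c^-1 <= n.+1%:R `^ gamma * sib n.+1 <= c^-1 * (1 + n%:R^-1) `^ gamma.
  move=> n0.
  have f0 : 0 < n`!%:R :> R by rewrite ltr0n fact_gt0.
  have n1 : 0 < n.+1%:R - gamma by rewrite subr_gt0 (lt_le_trans g1)// ler1n.
  have h1 := @Gamma_shift_le R (n.+1%:R - gamma) gamma gamma01 n1.
  have h2 := @Gamma_shift_le R n%:R (1 - gamma) (ltac:(lra)) (ltac:(by rewrite ltr0n)).
  rewrite subrK Gamma_sib -/c -natr1 Gamma_nat in h1.
  rewrite addrA natr1 Gamma_sib -/c in h2.
  have GN : Gamma n%:R = n`!%:R / n%:R :> R.
    have := @Gamma_rec R n%:R (ltac:(by rewrite ltr0n)); rewrite Gamma_nat => ->.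
    by field; rewrite pnatr_eq0 -lt0n.
  rewrite GN in h2; apply/andP; split.
    rewrite -div1r ler_pdivrMr// -(ler_pM2r f0) mul1r.
    have : (n%:R + 1 - gamma) `^ gamma <= n.+1%:R `^ gamma.
      by apply: ge0_ler_powR; rewrite ?nnegrE; [lra|rewrite natr1; lra|rewrite ler0n|rewrite natr1; lra].
    have s0 := sib_gt0 n.+1 => hp.
    have : (n%:R + 1 - gamma) `^ gamma * (c * n`!%:R * sib n.+1) <=
        n.+1%:R `^ gamma * (c * n`!%:R * sib n.+1).
      by rewrite ler_wpM2r// ltW// !mulr_gt0.
    by move=> /(le_trans h1); rewrite [leRHS](_ : _ = n.+1%:R `^ gamma * sib n.+1 * c * n`!%:R)//; ring.
  have nr0 : 0 < n%:R :> R by rewrite ltr0n.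
  have -> : n.+1%:R `^ gamma = (1 + n%:R^-1) `^ gamma * n%:R `^ gamma :> R.
    rewrite -powRM ?addr_ge0 ?invr_ge0//; congr (_ `^ _); rewrite -natr1.
    by field; rewrite gt_eqF.
  rewrite -mulrA mulrC ler_wpM2r ?powR_ge0// -div1r ler_pdivlMr//.
  rewrite [leRHS](_ : 1 = n%:R `^ gamma * (n%:R `^ (1 - gamma) * n%:R^-1) :> R); last first.
    rewrite mulrA -powRD; last by rewrite (gt_eqF nr0) implybT.
    by rewrite (addrC gamma) subrK powRr1 ?ltW// mulfV// gt_eqF.
  rewrite [leLHS](_ : _ = n%:R `^ gamma * (c * sib n.+1)); last by ring.
  rewrite ler_wpM2l ?powR_ge0// -(ler_pM2r f0).
  rewrite [leLHS](_ : _ = c * n`!%:R * sib n.+1); last by ring.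
  by rewrite [leRHS](_ : _ = n%:R `^ (1 - gamma) * (n`!%:R / n%:R))//; ring.
rewrite -cvg_shiftS /=.
apply: (@squeeze_cvgr _ _ _ _ (fun=> c^-1) (fun n => c^-1 * (1 + n%:R^-1) `^ gamma)).
- by near=> n; apply: bound; near: n; exact: nbhs_infty_gt.
- exact: cvg_cst.
- rewrite -[X in _ --> X]mulr1; apply: cvgM; first exact: cvg_cst.
  have c1 : {for 1, continuous (@powR R ^~ gamma)} by exact: continuous_powR.
  have c3 : (fun n : nat => 1 + n%:R^-1) @ \oo --> (1 : R).
    rewrite -[X in _ --> X]addr0; apply: cvgD; first exact: cvg_cst.
    rewrite -cvg_shiftS; exact: cvg_harmonic.
  have := @cvg_comp _ _ _ (fun n : nat => 1 + n%:R^-1) (@powR R ^~ gamma) _ (nbhs (1 : R))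
    (nbhs ((1 : R) `^ gamma)) c3 c1.
  by rewrite powR1; apply.
Unshelve. all: by end_near. Qed.

Lemma powRn_cvg0 (z : R) : 0 < z -> (fun n : nat => n%:R `^ (- z)) @ \oo --> (0 : R).
Proof.
move=> z0; rewrite -cvg_shiftS /=.
rewrite (_ : (fun n => _) = (fun n => ((expand n)^-1 : R) `^ z)).
  exact: powR_expandV_cvg0.
by apply/funext => n; rewrite /expand -[in RHS]powR_inv1// -powRrM mulN1r.
Qed.

Lemma powRn_cvgy (z : R) : 0 < z -> (fun n : nat => (n%:R : R) `^ z) @ \oo --> +oo.
Proof.
move=> z0; apply/cvgryPge => A; near=> n.
apply: (le_trans (ler_norm A)).
rewrite (_ : `|A| = (`|A| `^ z^-1) `^ z); last by rewrite -powRrM mulVf ?gt_eqF// powRr1.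
apply: ge0_ler_powR; rewrite ?nnegrE ?powR_ge0 ?(ltW z0)//.
near: n; exact: nbhs_infty_ger.
Unshelve. all: by end_near. Qed.

Lemma sib_cvg0 : sib @ \oo --> (0 : R).
Proof.
case/andP: (gamma01) => g0 _.
have h : (fun n : nat => n%:R `^ (- gamma) * (n%:R `^ gamma * sib n)) @ \oo --> (0 : R).
  rewrite -(mul0r (Gamma (1 - gamma))^-1); apply: cvgM; last exact: sib_asymp.
  exact: powRn_cvg0.
apply: cvg_trans h; apply: near_eq_cvg; near=> n; rewrite mulrA -powRD; last first.
  rewrite pnatr_eq0 -lt0n implybE orbC (_ : (0 < n)%N)//; near: n; exact: nbhs_infty_gt.
by rewrite addNr powRr0 mul1r.
Unshelve. all: by end_near. Qed.

End SibuyaTail.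

(** * Integrals arising as limits of occupancy sums *)

Section Substitution.
Context {R : realType}.
Local Notation mu := (@lebesgue_measure R).
Local Notation pos := (`](0 : R), +oo[%classic).
Variables (gamma a : R).
Hypothesis gamma01 : 0 < gamma < 1.
Hypothesis a_gt0 : 0 < a.

(** [F] inverts v |-> a v^(-1/gamma), which will be the limit of m w_x at x = v k when m p_k tends
    to a; [f] is minus its derivative. Since [F] decreases, the ends of the truncated intervals are
    exchanged. *)
Let F (y : R) := a `^ gamma * y `^ (- gamma).
Let f (y : R) := gamma * a `^ gamma * y `^ (- gamma - 1).

Let F_gt0 y : 0 < y -> 0 < F y.
Proof. by move=> y0; rewrite mulr_gt0// powR_gt0. Qed.

Let isF (y : R) : 0 < y -> is_derive y (1 : R) F (- f y).
Proof.
move=> y0; rewrite /F; have h := is_derive1_powR (- gamma) y0.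
apply: is_derive_eq; rewrite /GRing.scale /= /f; ring.
Qed.

Let cont_dF (y : R) : 0 < y -> {for y, continuous F^`()%classic}.
Proof.
move=> y0; have cf : {for y, continuous (fun y => - f y)}.
  apply: cvgN; apply: cvgM; first exact: cvg_cst.
  exact: continuous_powR.
have dFE (x : R) : 0 < x -> F^`()%classic x = - f x.
  by move=> x0; rewrite derive1E; have [_ ->] := isF x0.
change (F^`()%classic x @[x --> y] --> F^`()%classic y).
rewrite dFE//; apply: cvg_trans cf; apply: near_eq_cvg; near=> x.
by rewrite dFE//; near: x; exact: lt_nbhsr.
Unshelve. all: by end_near. Qed.

Lemma powR_substitution (G : R -> R) :
  (forall v, 0 < v -> 0 <= G v) -> (forall v, 0 < v -> {for v, continuous G}) ->
  (\int[mu]_(v in pos) (G v)%:E =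
   \int[mu]_(y in pos) (G (F y) * f y)%:E)%E.
Proof.
move=> G0 cG; case/andP: gamma01 => g0 g1.
have cF y : 0 < y -> {for y, continuous F}.
  by move=> y0; apply: cvgM; [exact: cvg_cst|exact: continuous_powR].
have f0 y : 0 < y -> 0 <= f y by move=> y0; rewrite !mulr_ge0 ?powR_ge0// ltW.
have cGF y : 0 < y -> {for y, continuous (fun y => G (F y) * f y)}.
  move=> y0; apply: cvgM.
    by apply: (@continuous_comp _ _ _ F G); [exact: cF|apply: cG; exact: F_gt0].
  by apply: cvgM; [exact: cvg_cst|exact: continuous_powR].
have c1 := @integral_halfline_expand R _
   (fun t t0 => mulr_ge0 (G0 _ (F_gt0 t0)) (f0 _ t0)) (continuous_halfline_measurable cGF).
have dec (x y : R) : 0 < x -> x < y -> F y < F x.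
  move=> x0 xy; have y0 := lt_trans x0 xy; rewrite ltr_pM2l ?powR_gt0// !powRN ltf_pV2 ?posrE ?powR_gt0//.
  by apply: gt0_ltr_powR => //; rewrite nnegrE ltW.
have c2 := @integral_halfline_cvg R G (fun n => F (expand n)) (fun n => F (expand n)^-1).
have E n : (\int[mu]_(v in `[F (expand n), F ((expand n)^-1)%R]) (G v)%:E =
   \int[mu]_(y in `[((expand n)^-1)%R, expand n]) (G (F y) * f y)%:E)%E.
  have e0 : 0 < (expand n)^-1 :> R by rewrite invr_gt0 expand_gt0.
  have e1 : (expand n)^-1 <= expand n :> R.
    by rewrite (@le_trans _ _ 1)// ?invf_le1 ?expand_gt0// /expand ler1n.
  rewrite (integration_by_substitution_decreasing e1).
  - apply: eq_integral => y; rewrite inE/= in_itv/= => /andP[/(lt_le_trans e0) y0 _].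
    rewrite /= fctE; congr ((_ * _)%:E).
    by rewrite fctE derive1E; have [_ ->] := isF y0; rewrite opprK.
  - by move=> x y; rewrite !in_itv/= => _ /andP[y0 _]; apply: dec; exact: lt_le_trans y0.
  - by move=> x; rewrite in_itv/= => /andP[x0 _]; apply: cont_dF; exact: lt_trans x0.
  - apply/cvg_ex; exists (F^`()%classic (expand n)^-1); apply: cvg_at_right_filter; exact: cont_dF.
  - apply/cvg_ex; exists (F^`()%classic (expand n)); apply: cvg_at_left_filter; apply: cont_dF.
    exact: expand_gt0.
  - have : (expand n)^-1 <= expand n :> R by [].
    (* For [n = 0] the interval is reduced to the point 1 and its interior is empty. *)
    rewrite le_eqVlt => /predU1P[ee|lt_e]; last first.
      by apply: derivable_halfline_LR => // t t0; have [] := isF t0.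
    have e10 := @expand_gt0 R n.
    split; first by move=> x; rewrite in_itv/= ee => /andP[h1 h2]; have := lt_trans h1 h2; rewrite ltxx.
      by apply: cvg_at_right_filter; exact: cF.
    by apply: cvg_at_left_filter; exact: cF.
  - apply: continuous_halfline_within => //; apply: F_gt0; exact: expand_gt0.
have {}c2 : (\int[mu]_(v in `[F (expand n), F ((expand n)^-1)%R]) (G v)%:E @[n --> \oo] -->
    \int[mu]_(v in pos) (G v)%:E)%E.
  apply: c2 => //.
  - exact: continuous_halfline_measurable.
  - by move=> n; apply: F_gt0; exact: expand_gt0.
  - move=> m n; rewrite leq_eqVlt => /predU1P[-> //|mn]; apply/ltW/dec; first exact: expand_gt0.
    by rewrite ltr_nat.
  - move=> m n; rewrite leq_eqVlt => /predU1P[-> //|mn]; apply/ltW/dec.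
      by rewrite invr_gt0 expand_gt0.
    by rewrite ltf_pV2 ?posrE ?expand_gt0// ltr_nat.
  - rewrite -(mulr0 (a `^ gamma)); apply: cvgM; first exact: cvg_cst.
    by have := powRn_cvg0 g0; rewrite -cvg_shiftS.
  - rewrite (_ : (fun n => _) = (fun n => a `^ gamma * (expand n : R) `^ gamma)).
      have ag : 0 < a `^ gamma by rewrite powR_gt0.
      have h := powRn_cvgy g0; rewrite -cvg_shiftS in h.
      move/cvgryPge : h => h; apply/cvgryPge => A; near=> n.
      rewrite mulrC -ler_pdivrMr//; near: n; exact: h.
    by apply/funext => n; rewrite /F -powR_inv1 ?ltW ?expand_gt0// -powRrM mulN1r opprK.
rewrite (funext E) in c2.
exact: (cvg_unique _ c2 c1).
Unshelve. all: by end_near. Qed.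

End Substitution.

Section KarlinIntegrals.
Context {R : realType}.
Local Notation mu := (@lebesgue_measure R).
Local Notation pos := (`](0 : R), +oo[%classic).
Variables (gamma : R).
Hypothesis gamma01 : 0 < gamma < 1.

(** The image of Lebesgue measure under v |-> a v^(-1/gamma) has density a^gamma gamma y^(-gamma -
    1); limits of sums over symbols thus become Gamma integrals. *)
Lemma integral_powR_subst (phi : R -> R) (a : R) : 0 < a ->
  (forall y, 0 < y -> 0 <= phi y) -> (forall y, 0 < y -> {for y, continuous phi}) ->
  (\int[mu]_(v in pos) (phi (a * v `^ (- gamma^-1)))%:E =
   (a `^ gamma)%:E * \int[mu]_(y in pos) (phi y * (gamma * y `^ (- gamma - 1)))%:E)%E.
Proof.
move=> a0 phi0 cphi; case/andP: (gamma01) => g0 g1.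
have y0 (v : R) : 0 < v -> 0 < a * v `^ (- gamma^-1).
  by move=> v0; rewrite mulr_gt0// powR_gt0.
rewrite (powR_substitution gamma01 a0 (G := fun v => phi (a * v `^ (- gamma^-1)))).
- rewrite -ge0_integralZl//.
  + apply: eq_integral => y; rewrite inE/= in_itv/= andbT => yp.
    rewrite -EFinM; congr EFin.
    rewrite (_ : a * _ = y); first by ring.
    rewrite powRM ?powR_ge0// -!powRrM.
    rewrite (_ : gamma * - gamma^-1 = -1); last by field; rewrite gt_eqF.
    rewrite (_ : - gamma * - gamma^-1 = 1); last by field; rewrite gt_eqF.
    by rewrite powR_inv1 ?ltW// powRr1 ?ltW//; field; rewrite gt_eqF.
  + apply/measurable_EFinP; apply: continuous_halfline_measurable => t t0.
    apply: cvgM; first exact: cphi.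
    by apply: cvgM; [exact: cvg_cst|exact: continuous_powR].
  + move=> y; rewrite /= in_itv/= andbT => yp.
    by rewrite lee_fin !mulr_ge0 ?powR_ge0 ?phi0// ltW.
  + by rewrite lee_fin powR_ge0.
- by move=> v v0; rewrite phi0// y0.
- move=> v v0; apply: (@continuous_comp _ _ _ (fun v => a * v `^ (- gamma^-1)) phi).
    by apply: cvgM; [exact: cvg_cst|exact: continuous_powR].
  exact/cphi/y0.
Qed.

Definition pois (l : nat) (y : R) : R := y ^+ l * expR (- y).

Lemma pois_ge0 l y : 0 <= y -> 0 <= pois l y.
Proof. by move=> y0; rewrite mulr_ge0 ?exprn_ge0 ?expR_ge0. Qed.

Lemma pois_continuous l y : {for y, continuous (pois l)}.
Proof.
apply: cvgM; last exact: continuous_expRN.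
exact: exprn_continuous.
Qed.

Lemma integral_pois l (a : R) : (0 < l)%N -> 0 < a ->
  (\int[mu]_(v in pos) (pois l (a * v `^ (- gamma^-1)))%:E =
   (a `^ gamma * (gamma * Gamma (l%:R - gamma)))%:E)%E.
Proof.
move=> l0 a0; case/andP: (gamma01) => g0 g1.
have lg : 0 < l%:R - gamma by rewrite subr_gt0 (lt_le_trans g1)// ler1n.
rewrite integral_powR_subst//; last 2 first.
- by move=> y /ltW; exact: pois_ge0.
- by move=> y _; exact: pois_continuous.
rewrite [RHS]EFinM; congr (_ * _)%E; rewrite [RHS]EFinM GammaE fineK ?eGamma_fin_num//.
rewrite -ge0_integralZl//; last 3 first.
- by apply/measurable_EFinP; exact: gkernel_measurable.
- by move=> y _; rewrite lee_fin gkernel_ge0.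
- by rewrite lee_fin ltW.
apply: eq_integral => y; rewrite inE/= in_itv/= andbT => y0; rewrite -EFinM; congr EFin.
rewrite /pois /gkernel (_ : l%:R - gamma - 1 = l%:R + (- gamma - 1)); last by ring.
rewrite [y `^ (l%:R + _)]powRD; last by rewrite (gt_eqF y0) implybT.
by rewrite powR_mulrn ?ltW//; ring.
Qed.

(** Integrating by parts against -y^(-gamma) turns 1 - e^(-y) into e^(-y) and leaves Gamma(1 -
    gamma). The boundary term at 0 is at most y^(1 - gamma), the one at infinity at most
    y^(-gamma). *)
Lemma integral_occupied (a : R) : 0 < a ->
  (\int[mu]_(v in pos) (1 - expR (- (a * v `^ (- gamma^-1))))%:E =
   (a `^ gamma * Gamma (1 - gamma))%:E)%E.
Proof.
move=> a0; case/andP: (gamma01) => g0 g1.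
have phi0 (y : R) : 0 < y -> 0 <= 1 - expR (- y) by move=> y0; rewrite subr_ge0 expR_le1; lra.
have phic (y : R) : {for y, continuous (fun y => 1 - expR (- y))}.
  by apply: cvgB; [exact: cvg_cst|exact: continuous_expRN].
rewrite (integral_powR_subst (phi := fun y => 1 - expR (- y)))//.
rewrite [RHS]EFinM; congr (_ * _)%E; rewrite GammaE fineK; last by apply: eGamma_fin_num; lra.
have h0 (y : R) : 0 < y -> 0 <= (1 - expR (- y)) * (gamma * y `^ (- gamma - 1)).
  by move=> y0; rewrite !mulr_ge0 ?powR_ge0 ?phi0// ltW.
have hc (y : R) : 0 < y -> {for y, continuous (fun y => (1 - expR (- y)) * (gamma * y `^ (- gamma - 1)))}.
  move=> y0; apply: cvgM; first exact: phic.
  by apply: cvgM; [exact: cvg_cst|exact: continuous_powR].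
have c1 := integral_halfline_expand h0 (continuous_halfline_measurable hc).
have parts (b c : R) : 0 < b -> b < c ->
  (\int[mu]_(t in `[b, c]) ((1 - expR (- t)) * (gamma * t `^ (- gamma - 1)))%:E =
   ((1 - expR (- b)) * b `^ (- gamma) - (1 - expR (- c)) * c `^ (- gamma))%:E +
     \int[mu]_(t in `[b, c]) (gkernel (1 - gamma) t)%:E)%E.
  move=> b0 bc.
  have dF (t : R) : is_derive t (1 : R) (fun t : R => 1 - expR (- t)) (expR (- t)).
    by apply: is_derive_eq; rewrite /GRing.scale/=; ring.
  have dG (t : R) : 0 < t -> is_derive t (1 : R) (fun t : R => - t `^ (- gamma)) (gamma * t `^ (- gamma - 1)).
    move=> t0; have h := is_derive1_powR (- gamma) t0.
    by apply: is_derive_eq; ring.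
  rewrite (@integration_by_parts R (fun t => 1 - expR (- t)) (fun t => - t `^ (- gamma))
    (fun t => expR (- t)) (fun t => gamma * t `^ (- gamma - 1)) b c bc).
  - rewrite (_ : \int[mu]_(t in `[b, c]) (expR (- t) * - t `^ (- gamma))%:E =
        - (\int[mu]_(t in `[b, c]) (gkernel (1 - gamma) t)%:E))%E.
      by rewrite oppeK; congr (_%:E + _)%E; ring.
    rewrite -integral_ge0N; last by move=> t _; rewrite lee_fin gkernel_ge0.
    apply: eq_integral => t _; rewrite -EFinN /gkernel; congr EFin.
    by rewrite (_ : 1 - gamma - 1 = - gamma); ring.
  - by apply: continuous_halfline_within => // t _; exact: continuous_expRN.
  - by apply: derivable_halfline_LR => // t _; have [] := dF t.
  - by move=> t _; rewrite derive1E; have [_ ->] := dF t.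
  - apply: continuous_halfline_within => // t t0.
    by apply: cvgM; [exact: cvg_cst|exact: continuous_powR].
  - by apply: derivable_halfline_LR => // t t0; have [] := dG t t0.
  - move=> t; rewrite in_itv/= => /andP[/(lt_trans b0) t0 _].
    by rewrite derive1E; have [_ ->] := dG t t0.
have c2 : (\int[mu]_(t in `[((expand n)^-1)%R, expand n])
    ((1 - expR (- t)) * (gamma * t `^ (- gamma - 1)))%:E
    @[n --> \oo] --> eGamma (1 - gamma))%E.
  rewrite -[X in _ --> X]add0e.
  apply: (cvg_trans (G := (((1 - expR (- (expand n)^-1)) * ((expand n)^-1 : R) `^ (- gamma) -
      (1 - expR (- expand n)) * (expand n : R) `^ (- gamma))%:E +
     \int[mu]_(t in `[((expand n)^-1)%R, expand n]) (gkernel (1 - gamma) t)%:E)%E @[n --> \oo])).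
    apply: near_eq_cvg; near=> n; rewrite parts//.
      by rewrite invr_gt0 expand_gt0.
    have n1 : 1 < expand n :> R.
      by rewrite /expand ltr1n ltnS; near: n; exact: nbhs_infty_gt.
    by apply: lt_trans (n1); rewrite invf_lt1 ?expand_gt0.
  apply: cvgeD => //.
    apply: cvg_EFin; first exact: nearW.
    rewrite -(subr0 0); apply: cvgB.
      apply: (@squeeze_cvgr _ _ _ _ (fun=> 0) (fun n => ((expand n)^-1 : R) `^ (1 - gamma))).
      - apply: nearW => n; have e0 : 0 < (expand n)^-1 :> R by rewrite invr_gt0 expand_gt0.
        rewrite mulr_ge0 ?powR_ge0 ?phi0//=.
        rewrite powRD; last by rewrite (gt_eqF e0) implybT.
        rewrite powRr1 ?(ltW e0)// ler_wpM2r ?powR_ge0//.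
        rewrite lerBlDr -lerBlDl; exact: expR_ge1Dx.
      - exact: cvg_cst.
      - by apply: powR_expandV_cvg0; lra.
    apply: (@squeeze_cvgr _ _ _ _ (fun=> 0) (fun n => (expand n : R) `^ (- gamma))).
    - apply: nearW => n; have e0 := @expand_gt0 R n.
      rewrite mulr_ge0 ?powR_ge0 ?phi0//= ler_piMl ?powR_ge0//. 

    - exact: cvg_cst.
    - by have := powRn_cvg0 g0; rewrite -cvg_shiftS.
  apply: integral_halfline_expand.
    by move=> t _; exact: gkernel_ge0.
  exact: gkernel_measurable.
exact: (cvg_unique _ c1 c2).
Unshelve. all: by end_near. Qed.

End KarlinIntegrals.

(** * Regular variation and occupancy asymptotics *)

Section RegularVariation.
Context {R : realType}.
Local Notation cl x := `|Num.ceil x|%N.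

Lemma cl_nat n : cl (n%:R : R) = n.
Proof. by rewrite -[n%:R]/(n%:~R) intrKceil. Qed.

Lemma cl_ge (x : R) (m : nat) : m%:R <= x -> (m <= cl x)%N.
Proof.
move=> mx; have x0 : 0 <= x by apply: le_trans mx.
have h : 0 <= Num.ceil x by rewrite ceil_ge0; lra.
have : m%:R <= (Num.ceil x)%:~R :> R by apply: le_trans mx (ceil_ge x).
by rewrite -{1}(gez0_abs h) -[X in _ <= X]/(`|Num.ceil x|%N%:R) ler_nat.
Qed.

Lemma cl_gt0 (x : R) : 0 < x -> (0 < cl x)%N.
Proof. by move=> x0; rewrite absz_gt0 gt_eqF// ceil_gt0. Qed.

Lemma cl_eq (x : R) n : n%:R < x <= n.+1%:R -> cl x = n.+1.
Proof.
move=> h; have -> : Num.ceil x = n.+1%:Z; last by [].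
by apply: ceil_def; rewrite -[n.+1%:Z%:~R]/(n.+1%:R) intrB -[n.+1%:Z%:~R]/(n.+1%:R) -natr1 addrK natr1.
Qed.

Variables (p : nat -> R) (gamma : R).
Hypothesis gamma01 : 0 < gamma < 1.
Hypothesis p_gt0 : forall i, (1 <= i)%N -> 0 < p i.
Hypothesis p_noninc : forall i j, (1 <= i)%N -> (i <= j)%N -> p j <= p i.
Hypothesis p_rv : regularly_varying p (- gamma^-1).

Lemma rv_seq (k : nat -> nat) (t : R) : k @ \oo --> \oo -> 0 < t ->
  p (cl (t * (k n)%:R)) / p (k n) @[n --> \oo] --> t `^ (- gamma^-1).
Proof.
move=> koo t0; have [_ /(_ t t0) h] := p_rv.
have kR : (k n)%:R @[n --> \oo] --> (+oo : set_system R) by exact/cvgrnyP.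
have := cvg_comp _ _ kR h; apply: cvg_trans; apply: near_eq_cvg.
by apply: nearW => n /=; rewrite cl_nat.
Qed.

Lemma rv_nat (t : R) : 0 < t ->
  p (cl (t * n%:R)) / p n @[n --> \oo] --> t `^ (- gamma^-1).
Proof. by apply: rv_seq; exact: cvg_id. Qed.

Lemma rv_mulnat (c : nat) : (0 < c)%N ->
  p (c * n)%N / p n @[n --> \oo] --> (c%:R : R) `^ (- gamma^-1).
Proof.
move=> c0; have := @rv_nat c%:R (ltac:(by rewrite ltr0n)).
by under eq_fun do rewrite -natrM cl_nat.
Qed.

(** The midpoint of 1 and 1 / gamma: below 1 / gamma, so that [p] eventually decays at least at this
    rate, and above 1, so that v^(-beta) is integrable at infinity. *)
Definition potter_exp : R := (1 + gamma^-1) / 2.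
Local Notation beta := potter_exp.

Lemma potter_exp_gt1 : 1 < beta.
Proof.
case/andP: gamma01 => g0 g1; have : 1 < gamma^-1 by rewrite invf_gt1.
rewrite /potter_exp; lra.
Qed.

Lemma potter_exp_lt : beta < gamma^-1.
Proof.
case/andP: gamma01 => g0 g1; have : 1 < gamma^-1 by rewrite invf_gt1.
rewrite /potter_exp; lra.
Qed.

Lemma gt1_ltr_powR (a x y : R) : 1 < a -> x < y -> a `^ x < a `^ y.
Proof.
move=> a1 xy; rewrite /powR gt_eqF ?(lt_trans _ a1)// ltr_expR ltr_pM2r//.
exact: ln_gt0.
Qed.

Lemma dyadic_decay : exists2 K : nat, (0 < K)%N & forall k, (K <= k)%N ->
  p (2 * k)%N <= 2 `^ (- beta) * p k.
Proof.
have h := @rv_mulnat 2 isT.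
have lt2 : (2 : R) `^ (- gamma^-1) < 2 `^ (- beta).
  by apply: gt1_ltr_powR; [lra|have := potter_exp_lt; lra].
have [N _ hN] := cvgr_lt _ h _ lt2.
exists N.+1 => // k Nk; rewrite -ler_pdivrMr ?p_gt0 ?(leq_trans _ Nk)//.
by apply: ltW; apply: hN => /=; exact: ltnW.
Qed.

Lemma dyadic_decayX : exists2 K : nat, (0 < K)%N & forall k j, (K <= k)%N ->
  p (2 ^ j * k)%N <= 2 `^ (- beta) ^+ j * p k.
Proof.
have [K K0 hK] := dyadic_decay; exists K => // k j Kk.
elim: j => [|j IH]; first by rewrite expn0 mul1n expr0 mul1r.
rewrite expnS -mulnA exprS -mulrA; apply: le_trans (hK _ _) _.
  by rewrite (leq_trans Kk)// leq_pmull// expn_gt0.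
by rewrite ler_wpM2l ?powR_ge0.
Qed.

(** The upper half of Potter's bound. With 2^j <= v < 2^(j+1), apply j dyadic decays; the factor
    2^beta pays for rounding v down to a power of 2. *)
Lemma potter : exists2 K : nat, (0 < K)%N & forall k (v : R), (K <= k)%N -> 1 <= v ->
  p (cl (k%:R * v)) <= 2 `^ beta * v `^ (- beta) * p k.
Proof.
have [K K0 hK] := dyadic_decayX; exists K => // k v Kk v1.
have b1 := potter_exp_gt1; have v0 : 0 < v by lra.
have k0 : (0 < k)%N by exact: leq_trans Kk.
set m := Num.truncn v.
have mv : m%:R <= v by rewrite truncn_le ?ltW.
have vm : v < m.+1%:R by exact: truncnS_gt.
have m0 : (0 < m)%N by rewrite truncn_gt0.
set j := trunc_log 2 m.
have jm : (2 ^ j <= m)%N by exact: trunc_logP.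
have mj : (m < 2 ^ j.+1)%N by exact: trunc_log_ltn.
apply: (@le_trans _ _ (p (2 ^ j * k)%N)).
  apply: p_noninc; first by rewrite muln_gt0 expn_gt0.
  apply: cl_ge; rewrite mulnC natrM ler_wpM2l//.
  by apply: le_trans mv; rewrite ler_nat.
apply: le_trans (hK _ _ Kk) _; rewrite ler_wpM2r ?(ltW (p_gt0 _))//.
have vj : v <= (2 : R) ^+ j.+1.
  by apply/ltW/(lt_le_trans vm); rewrite -natrX ler_nat.
have -> : (2 : R) `^ (- beta) ^+ j = 2 `^ beta * (2 ^+ j.+1) `^ (- beta).
  rewrite -!powR_mulrn ?powR_ge0// -!powRrM -powRD; last by rewrite pnatr_eq0 implybT.
  by congr (_ `^ _); rewrite -natr1; ring.
rewrite ler_wpM2l ?powR_ge0// !powRN lef_pV2 ?posrE ?powR_gt0 ?exprn_gt0//.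
by apply: ge0_ler_powR; rewrite ?nnegrE ?exprn_ge0//; lra.
Qed.

(** The block from 2^i h to 2^(i+1) h has 2^i h terms, each at most 2^(-beta i) p_h, so block sums
    decrease geometrically with ratio 2^(1 - beta) < 1. *)
Lemma sum_dyadic_le : exists2 K : nat, (0 < K)%N & forall h j, (K <= h)%N ->
  \sum_(h <= x < 2 ^ j * h) p x <= (1 - 2 `^ (1 - beta))^-1 * (h%:R * p h).
Proof.
have [K K0 hK] := dyadic_decayX; exists K => // h j Kh.
have b1 := potter_exp_gt1; have h0 : (0 < h)%N by exact: leq_trans Kh.
set q := (2 : R) `^ (1 - beta).
have q0 : 0 < q by rewrite powR_gt0.
have q1 : q < 1 by rewrite -(powRr0 (2 : R)); apply: gt1_ltr_powR; lra.
have qE : q = 2 * 2 `^ (- beta).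
  by rewrite /q powRD ?pnatr_eq0 ?implybT// powRr1.
have key i : \sum_(h <= x < 2 ^ i * h) p x <= (h%:R * p h) * \sum_(0 <= l < i) q ^+ l.
  elim: i => [|i IH]; first by rewrite expn0 mul1n !big_geq// mulr0.
  rewrite (big_cat_nat (n := (2 ^ i * h)%N))//=; last 2 first.
  - by rewrite leq_pmull// expn_gt0.
  - by rewrite leq_mul2r leq_exp2l// leqnSn orbT.
  rewrite big_nat_recr//= mulrDr lerD//.
  apply: (@le_trans _ _ (\sum_(2 ^ i * h <= x < 2 ^ i.+1 * h) p (2 ^ i * h)%N)).
    rewrite big_nat [leRHS]big_nat; apply: ler_sum => x /andP[hx _].
    by apply: p_noninc => //; rewrite muln_gt0 expn_gt0.
  rewrite big_const_nat iter_addr_0 -mulnBl expnS mul2n -addnn addnK -[leLHS]mulr_natl.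
  rewrite qE exprMn natrM natrX.
  rewrite [leRHS](_ : _ = 2 ^+ i * h%:R * (2 `^ (- beta) ^+ i * p h)); last by ring.
  by rewrite ler_wpM2l ?mulr_ge0 ?exprn_ge0// hK.
apply: le_trans (key j) _; rewrite mulrC ler_wpM2r ?mulr_ge0 ?(ltW (p_gt0 _))//.
rewrite -[leRHS]div1r ler_pdivlMr ?subr_gt0//.
have -> : (\sum_(0 <= l < j) q ^+ l) * (1 - q) = 1 - q ^+ j.
  elim: j => [|j IHj]; first by rewrite big_geq// mul0r expr0 subrr.
  by rewrite big_nat_recr//= mulrDl IHj exprS; ring.
by rewrite gerBl exprn_ge0// ltW.
Qed.

End RegularVariation.

Lemma cvg_EFinP {R : realType} (u : nat -> R) (l : R) :
  ((u n)%:E @[n --> \oo] --> l%:E)%E -> u @ \oo --> l.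
Proof. by move=> h; have /fine_cvgP[_] := h. Qed.

Lemma nneseries_cvg_real {R : realType} (u : nat -> R) (m : nat) (l : R) :
  (forall n, (m <= n)%N -> 0 <= u n) -> (\sum_(m <= i <oo) (u i)%:E = l%:E)%E ->
  (fun n => \sum_(m <= i < n) u i) @ \oo --> l.
Proof.
move=> u0 ul; apply: cvg_EFinP.
rewrite (_ : (fun n => _) = (fun n => \sum_(m <= i < n) (u i)%:E)%E); last first.
  by apply/funext => n; rewrite sumEFin.
rewrite -ul; apply: is_cvg_nneseries => n mn _; rewrite lee_fin u0//.
Qed.

Lemma nneseries_real {R : realType} (u : nat -> R) (m : nat) (l : R) :
  (fun n => \sum_(m <= i < n) u i) @ \oo --> l -> (\sum_(m <= i <oo) (u i)%:E = l%:E)%E.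
Proof.
move=> h; apply/cvg_lim => //.
rewrite (_ : (fun n => _) = EFin \o (fun n => \sum_(m <= i < n) u i)).
  by apply: cvg_EFin => //; exact: nearW.
by apply/funext => n; rewrite /= sumEFin.
Qed.

Section Weights.
Context {R : realType}.
Variables (p : nat -> R) (gamma : R).
Hypothesis gamma01 : 0 < gamma < 1.
Hypothesis p_gt0 : forall i, (1 <= i)%N -> 0 < p i.
Hypothesis p_noninc : forall i j, (1 <= i)%N -> (i <= j)%N -> p j <= p i.
Hypothesis p_sum : (\sum_(1 <= i <oo) (p i)%:E = 1)%E.
Hypothesis p_rv : regularly_varying p (- gamma^-1).

(** [p 0] is arbitrary; giving 0 the weight 0 yields a probability on all of [nat]. *)
Definition weight (x : nat) : R := if x is 0%N then 0 else p x.
Local Notation w := weight.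

Lemma weight0 : w 0%N = 0. Proof. by []. Qed.
Lemma weightE x : (0 < x)%N -> w x = p x. Proof. by case: x. Qed.

Lemma weight_ge0 x : 0 <= w x.
Proof. by case: x => // x; exact/ltW/p_gt0. Qed.

Lemma weight_noninc x y : (1 <= x)%N -> (x <= y)%N -> w y <= w x.
Proof. by case: x => // x _; case: y => // y xy; exact: p_noninc. Qed.

Lemma weight_sum : series w @ \oo --> (1 : R).
Proof.
have := nneseries_cvg_real (fun n n1 => ltW (p_gt0 n1)) p_sum.
rewrite -[X in _ -> X]cvg_shiftS -[X in X -> _]cvg_shiftS; apply: cvg_trans.
apply: near_eq_cvg; apply: nearW => n; rewrite /series /= [RHS]big_nat_recl//= add0r.
by rewrite big_add1.
Qed.

Lemma weight_pos_cvg : p n @[n --> \oo] --> (0 : R).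
Proof.
have := cvg_series_cvg_0 (cvgP _ weight_sum).
by rewrite -cvg_shiftS -[X in _ -> X]cvg_shiftS.
Qed.

Local Notation tl := (tailmass w).

Lemma tailmass_split m n : (m <= n)%N -> tl m = \sum_(m <= x < n) w x + tl n.
Proof.
move=> mn; rewrite /tailmass /series /= (@big_cat_nat _ _ _ m 0 n)//=; ring.
Qed.

Lemma tailmass_le : exists2 C : R, 0 < C &
  \forall h \near \oo, tl h <= C * (h%:R * p h).
Proof.
have [K K0 hK] := sum_dyadic_le gamma01 p_gt0 p_noninc p_rv.
have b1 := potter_exp_gt1 gamma01.
set C := (1 - _)^-1 in hK.
have C0 : 0 < C.
  by rewrite invr_gt0 subr_gt0 -[ltRHS](powRr0 (2 : R)); apply: gt1_ltr_powR; lra.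
exists C => //; exists K => // h /= Kh.
have h0 : (0 < h)%N by exact: leq_trans Kh.
have c0 : (fun j => C * (h%:R * p h) + tl (2 ^ j * h)%N) @ \oo --> C * (h%:R * p h).
  rewrite -[X in _ --> X]addr0; apply: cvgD; first exact: cvg_cst.
  apply: (cvg_comp _ _ _ (tailmass_cvg0 weight_sum)).
  apply/cvgnyPge => A; near=> j; apply: (@leq_trans j).
    by near: j; exact: nbhs_infty_ge.
  by apply: leq_trans (ltnW (ltn_expl j (ltnSn 1))) _; rewrite leq_pmulr.
rewrite -(cvg_lim _ c0)//; apply: limr_ge; first by apply/cvg_ex; eexists; exact: c0.
apply: nearW => j; rewrite (@tailmass_split h (2 ^ j * h)) ?lerD2r.
  apply: le_trans (hK h j Kh); rewrite big_nat [leRHS]big_nat; apply: ler_sum => x /andP[hx _].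
  by rewrite weightE// (leq_trans h0).
by rewrite leq_pmull// expn_gt0.
Unshelve. all: by end_near. Qed.

(** The block from k + 1 to 2 k alone suffices. Together with [unseen_ge_tailmass] this bounds the
    unseen mass from below on every list with k distinct values. *)
Lemma tailmass_ge : exists2 c : R, 0 < c &
  \forall k \near \oo, c * (k%:R * p k) <= tl k.+1.
Proof.
have h := @rv_mulnat _ _ _ p_rv 2 isT.
set l := _ `^ _ in h; have l0 : 0 < l by rewrite powR_gt0.
have [N _ hN] := cvgr_gt _ h _ (ltac:(lra) : l / 2 < l).
exists (l / 2); first by lra.
exists N.+1 => // k Nk; have k0 : (0 < k)%N by exact: leq_trans Nk.
have {}hN := hN k (ltnW Nk).
rewrite (@tailmass_split k.+1 (2 * k).+1); last by rewrite ltnS leq_pmull.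
apply: (@le_trans _ _ (\sum_(k.+1 <= x < (2 * k).+1) p (2 * k)%N)).
  rewrite big_const_nat iter_addr_0 subSS mul2n -addnn addnK -[leRHS]mulr_natl.
  rewrite mulrCA ler_wpM2l// -ler_pdivlMr ?p_gt0//.
  by rewrite addnn -mul2n ltW.
apply: (@le_trans _ _ (\sum_(k.+1 <= x < (2 * k).+1) w x)).
  rewrite big_nat [leRHS]big_nat; apply: ler_sum => x /andP[kx]; rewrite ltnS => x2k.
  by rewrite weightE ?(leq_trans _ kx)//; apply: p_noninc => //; exact: leq_trans kx.
rewrite lerDl; exact: (tailmass_ge0 weight_ge0 weight_sum).
Qed.

Lemma half_cvg : (fun k : nat => k./2) @ \oo --> \oo.
Proof.
apply/cvgnyPge => A; near=> k; rewrite -(doubleK A); apply: half_leq.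
near: k; exact: nbhs_infty_ge.
Unshelve. all: by end_near. Qed.

Lemma tailmass_half_le : exists2 C : R, 0 < C &
  \forall k \near \oo, tl k./2 <= C * (k%:R * p k).
Proof.
have [C C0 hC] := tailmass_le.
have h := @rv_mulnat _ _ _ p_rv 3 isT.
set l := _ `^ _ in h; have l0 : 0 < l by rewrite powR_gt0.
have h3 := cvgr_gt _ h _ (ltac:(lra) : l / 2 < l).
exists (C * (2 / l)); first by rewrite !mulr_gt0// ?invr_gt0.
near=> k; apply: (@le_trans _ _ (C * (k./2%:R * p k./2))).
  near: k; exact: (half_cvg hC).
have k2 : (2 <= k)%N by near: k; exact: nbhs_infty_ge.
have hk : (0 < k./2)%N by rewrite half_gt0.
have h3k : l / 2 < p (3 * k./2)%N / p k./2 by near: k; exact: (half_cvg h3).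
(* Three halves rounded down exceed k from k = 2 on, so regular variation with factor 3 transfers
   the bound from [p k./2] to [p k]. *)
have k3 : (k <= 3 * k./2)%N by lia.
have kk : (k./2 <= k)%N by lia.
rewrite -mulrA ler_wpM2l ?(ltW C0)// mulrCA ler_pM ?(ltW (p_gt0 _))// ?ler_nat//.
have p3 : p (3 * k./2)%N <= p k by apply: p_noninc => //; exact: leq_trans k2.
apply: (@le_trans _ _ (2 / l * p (3 * k./2)%N)); last first.
  by rewrite ler_wpM2l// divr_ge0// ltW.
rewrite ltr_pdivlMr ?p_gt0// in h3k; apply: ltW.
by rewrite mulrAC ltr_pdivlMr// mulrC; move: h3k; set a := p _; set b := p _; lra.
Unshelve. all: by end_near. Qed.

(** The terms from k/2 to k are all at least p_k and belong to a vanishing tail. *)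
Lemma kp_cvg0 : k%:R * p k @[k --> \oo] --> (0 : R).
Proof.
apply: (@squeeze_cvgr _ _ _ _ (fun=> 0) (fun k => 2 * tl k./2.+1)).
- near=> k; have k1 : (1 <= k)%N by near: k; exact: nbhs_infty_ge.
  rewrite mulr_ge0 ?(ltW (p_gt0 _))//=.
  rewrite (@tailmass_split k./2.+1 k.+1); last by rewrite ltnS -{2}(odd_double_half k) -addnn addnA leq_addl.
  rewrite mulrDr; apply: (@le_trans _ _ (2 * \sum_(k./2.+1 <= x < k.+1) p k)); last first.
    apply: (@le_trans _ _ (2 * \sum_(k./2.+1 <= x < k.+1) w x)).
      rewrite ler_wpM2l// big_nat [leRHS]big_nat; apply: ler_sum => x /andP[kx].
      rewrite ltnS => xk; have x0 : (0 < x)%N by exact: leq_trans kx.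
      by rewrite weightE// p_noninc.
    rewrite lerDl mulr_ge0//; exact: (tailmass_ge0 weight_ge0 weight_sum).
  rewrite big_const_nat iter_addr_0 subSS -[X in _ <= 2 * X]mulr_natl mulrA.
  rewrite ler_wpM2r ?(ltW (p_gt0 _))// -natrM ler_nat; lia.
- exact: cvg_cst.
- rewrite -(mulr0 2); apply: cvgM; first exact: cvg_cst.
  have h := tailmass_cvg0 weight_sum; rewrite -cvg_shiftS in h.
  exact: (cvg_comp _ _ half_cvg h).
Unshelve. all: by end_near. Qed.

End Weights.

(** * Sums over symbols as integrals *)

Section StepIntegral.
Context {R : realType}.
Local Notation mu := (@lebesgue_measure R).
Local Notation pos := (`](0 : R), +oo[%classic).
Local Notation cl x := `|Num.ceil x|%N.

Variables (k : nat) (f : nat -> R).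
Hypothesis k_gt0 : (0 < k)%N.
Hypothesis f_ge0 : forall x, 0 <= f x.

Let F (n : nat) := `](n%:R / k%:R), (n.+1%:R / k%:R : R)]%classic.

Let kR : 0 < k%:R :> R. Proof. by rewrite ltr0n. Qed.

Let F_cl n v : F n v -> cl (k%:R * v) = n.+1.
Proof.
rewrite /F /= in_itv/= => /andP[h1 h2]; apply: cl_eq; apply/andP; split.
  by rewrite mulrC -ltr_pdivrMr.
by rewrite mulrC -ler_pdivlMr.
Qed.

Let posE : pos = \bigcup_n F n.
Proof.
apply/seteqP; split => v /=.
  rewrite in_itv/= andbT => v0.
  have kv0 : 0 < k%:R * v by rewrite mulr_gt0.
  have c0 := cl_gt0 kv0; exists (cl (k%:R * v)).-1 => //.
  have e : (cl (k%:R * v))%:R = (Num.ceil (k%:R * v))%:~R :> R.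
    by rewrite -[in RHS](gez0_abs (_ : 0 <= Num.ceil (k%:R * v)))// ceil_ge0; lra.
  rewrite /F /= in_itv/= prednK//; apply/andP; split.
    rewrite ltr_pdivrMr// [ltRHS]mulrC -subn1 natrB// e.
    by have := ceilB1_lt (k%:R * v); rewrite intrB.
  by rewrite ler_pdivlMr// [leLHS]mulrC e; exact: ceil_ge.
move=> [n _]; rewrite /F /= !in_itv/= andbT => /andP[h _]; apply: le_lt_trans h.
by rewrite divr_ge0.
Qed.

Let trivF : trivIset setT F.
Proof.
apply/trivIsetP => i j _ _ /eqP ij; apply/seteqP; split => // v [/F_cl vi /F_cl vj].
by apply: ij; apply: succn_inj; rewrite -vi -vj.
Qed.

Lemma measurable_step : measurable_fun pos (fun v => f (cl (k%:R * v))).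
Proof.
move=> _ Y mY; rewrite posE setI_bigcupl; apply: bigcup_measurable => n _.
rewrite (_ : _ `&` _ = if f n.+1 \in Y then F n else set0).
  by case: ifP => _; [exact: measurable_itv|exact: measurable0].
apply/seteqP; split => v /=.
  by move=> [Fv]; rewrite (F_cl Fv) => /mem_set ->.
by case: ifPn => // fY Fv; split=> //; rewrite (F_cl Fv); rewrite inE in fY.
Qed.

(** A series divided by k is the integral of a step function of v = x / k, which brings sums over
    symbols within reach of dominated convergence. The steps start at index 1, since the ceiling of
    a positive number is positive; hence the condition on [f 0]. *)
Lemma integral_step (s : R) : f 0%N = 0 -> series f @ \oo --> s ->
  (\int[mu]_(v in pos) (f (cl (k%:R * v)))%:E = (s / k%:R)%:E)%E.
Proof.
move=> f0 fs; rewrite posE ge0_integral_bigcup//=.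
- transitivity (\sum_(0 <= n <oo) (f n.+1 / k%:R)%:E)%E.
    apply: eq_eseriesr => n _.
    rewrite (eq_integral (cst (f n.+1)%:E)).
      rewrite integral_cst//; last exact: measurable_itv.
      rewrite [X in (_ * X)%E]lebesgue_measure_itv /= lte_fin ltr_pM2r ?invr_gt0// ltr_nat ltnSn.
      by rewrite -EFinB -mulrBl -natr1 addrAC subrr add0r div1r -EFinM.
    by move=> v; rewrite inE => Fv; rewrite (F_cl Fv).
  apply: nneseries_real.
  rewrite (_ : (fun n => _) = (fun n => series f n.+1 * k%:R^-1)).
    by apply: cvgMl; rewrite cvg_shiftS.
  by apply/funext => n; rewrite /series /= [in RHS]big_nat_recl// f0 add0r [RHS]mulr_suml.
- by move=> n; exact: measurable_itv.
- by rewrite -posE; apply/measurable_EFinP; exact: measurable_step.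
- by move=> v _; rewrite lee_fin.
Qed.

End StepIntegral.

Section DominatedSums.
Context {R : realType}.
Local Notation mu := (@lebesgue_measure R).
Local Notation pos := (`](0 : R), +oo[%classic).
Local Notation cl x := `|Num.ceil x|%N.

Lemma integral_powR_tail (b : R) : 1 < b ->
  (\int[mu]_(v in `[1%R, +oo[) (v `^ (- b))%:E = ((b - 1)^-1)%:E)%E.
Proof.
move=> b1.
have d (t : R) : 0 < t -> is_derive t (1 : R) (fun v : R => - (b - 1)^-1 * v `^ (1 - b)) (t `^ (- b)).
  move=> t0; have h := is_derive1_powR (1 - b) t0; apply: is_derive_eq.
  rewrite /GRing.scale/= (_ : 1 - b - 1 = - b); last by ring.
  by field; rewrite subr_eq0 gt_eqF.
have c (t : R) : 0 < t -> {for t, continuous (fun v : R => v `^ (- b))} by exact: continuous_powR.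
rewrite (@ge0_continuous_FTC2y _ _ (fun v => - (b - 1)^-1 * v `^ (1 - b)) 1 0)//.
- by rewrite powR1 mulr1 -EFinB sub0r opprK.
- by move=> v _; exact: powR_ge0.
- apply: continuous_in_subspaceT => t; rewrite inE/= in_itv/= andbT => t1.
  by apply: c; lra.
- rewrite -(mulr0 (- (b - 1)^-1)); apply: cvgM; first exact: cvg_cst.
  have -> : (fun x : R => x `^ (1 - b)) = (fun x => (x `^ (b - 1))^-1).
    by apply/funext => x; rewrite -powRN opprB.
  apply/gtr0_cvgV0.
    by near=> x; apply: powR_gt0; near: x; exact: nbhs_pinfty_gt.
  apply/cvgryPge => A; near=> x; apply: (le_trans (ler_norm A)).
  rewrite (_ : `|A| = (`|A| `^ (b - 1)^-1) `^ (b - 1)); last first.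
    by rewrite -powRrM mulVf ?powRr1// subr_eq0 gt_eqF.
  have x0 : 0 <= x by near: x; apply: nbhs_pinfty_ge; exact: num_real.
  have b0 : 0 <= b - 1 by lra.
  apply: (ge0_ler_powR b0); rewrite ?nnegrE ?powR_ge0//.
- by move=> x x1; have [] := d x (ltac:(lra)).
- apply: cvg_at_right_filter; apply: cvgM; first exact: cvg_cst.
  by apply: continuous_powR.
- move=> x; rewrite in_itv/= andbT => x1; rewrite derive1E.
  by have [_ ->] := d x (ltac:(lra)).
Unshelve. all: by end_near. Qed.

End DominatedSums.

Section KarlinSums.
Context {R : realType}.
Local Notation mu := (@lebesgue_measure R).
Local Notation pos := (`](0 : R), +oo[%classic).
Local Notation cl x := `|Num.ceil x|%N.
Variables (p : nat -> R) (gamma : R).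
Hypothesis gamma01 : 0 < gamma < 1.
Hypothesis p_gt0 : forall i, (1 <= i)%N -> 0 < p i.
Hypothesis p_noninc : forall i j, (1 <= i)%N -> (i <= j)%N -> p j <= p i.
Hypothesis p_sum : (\sum_(1 <= i <oo) (p i)%:E = 1)%E.
Hypothesis p_rv : regularly_varying p (- gamma^-1).
Local Notation w := (weight p).

(** A Riemann-sum limit along x = v k. The constant bound dominates for v < 1; for v >= 1 the bound
    linear in w_x / w_k becomes an integrable power of v by Potter's inequality. *)
Lemma dominated_sum (k : nat -> nat) (h : nat -> R -> R) (H : R -> R) (C I : R) (s : nat -> R) :
  k @ \oo --> \oo ->
  (forall n x, 0 <= h n (w x)) -> (forall n, h n 0 = 0) ->
  (\forall n \near \oo, forall x, (0 < x)%N -> h n (w x) <= C) ->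
  (\forall n \near \oo, forall x, (0 < x)%N -> h n (w x) <= C * (w x / w (k n))) ->
  (forall v, 0 < v -> h n (w (cl (v * (k n)%:R))) @[n --> \oo] --> H v) ->
  measurable_fun pos H ->
  (\int[mu]_(v in pos) (H v)%:E = I%:E)%E ->
  (forall n, series (fun x => h n (w x)) @ \oo --> s n) ->
  s n / (k n)%:R @[n --> \oo] --> I.
Proof.
move=> koo h0 h00 hC1 hC2 hH mH HI hs.
have b1 := potter_exp_gt1 gamma01; set b := potter_exp gamma in b1.
have [K K0 hK] := potter gamma01 p_gt0 p_noninc p_rv.
pose A : R := 2 `^ b.
pose g (v : R) := if v < 1 then C else C * A * v `^ (- b).
have C0 : 0 <= C.
  have [N _ hN] := hC1; exact: le_trans (h0 N 1%N) (hN N (leqnn N) 1%N isT).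
have A0 : 0 <= A by rewrite powR_ge0.
have g0 v : 0 <= g v.
  by rewrite /g; case: ifP => // _; rewrite !mulr_ge0// powR_ge0.
(* The domination holds only eventually but is required at every index, so the sequences are shifted
   by a common threshold [N]. *)
have [N [hN1 hN2 hN3]] : exists N, [/\ forall n, (N <= n)%N -> (K <= k n)%N,
    forall n, (N <= n)%N -> forall x, (0 < x)%N -> h n (w x) <= C &
    forall n, (N <= n)%N -> forall x, (0 < x)%N -> h n (w x) <= C * (w x / w (k n))].
  have /cvgnyPge/(_ K)[N1 _ h1] := koo; have [N2 _ h2] := hC1; have [N3 _ h3] := hC2.
  exists (maxn N1 (maxn N2 N3)); split => n; rewrite !geq_max => /and3P[n1 n2 n3].
  - exact: h1. - exact: h2. - exact: h3.
pose f_ n (v : R) : \bar R := (h (n + N)%N (w (cl ((k (n + N)%N)%:R * v))))%:E.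
have kpos n : (0 < k (n + N))%N by apply: leq_trans (hN1 _ (leq_addl _ _)).
have mf n : measurable_fun pos (f_ n).
  apply/measurable_EFinP; exact: (@measurable_step R _ (fun x => h (n + N)%N (w x)) (kpos n)).
have fE n : (\int[mu]_(v in pos) f_ n v = (s (n + N)%N / (k (n + N)%N)%:R)%:E)%E.
  by apply: (@integral_step R _ (fun x => h (n + N)%N (w x)) (kpos n)) => //=; rewrite ?h00.
have cA : pos = `](0 : R), 1[%classic `|` `[(1 : R), +oo[%classic.
  apply/seteqP; split => v /=; rewrite !in_itv/= !andbT.
    by move=> ->; have [v1|v1] := ltP v 1; [left|right].
  by move=> [/andP[]//|v1]; lra.
have mg1 : measurable_fun (`](0 : R), 1[%classic) (EFin \o g).
  apply: (eq_measurable_fun (cst C%:E)); last exact: measurable_cst.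
  by move=> v; rewrite inE/= in_itv/= => /andP[_ v1]; rewrite /g v1.
have mP : measurable_fun (`[(1 : R), +oo[%classic) (fun v : R => (v `^ (- b))%:E).
  apply/measurable_EFinP; apply: measurable_funTS; exact: measurable_powR.
have mg2 : measurable_fun (`[(1 : R), +oo[%classic) (EFin \o g).
  apply: (eq_measurable_fun (fun v : R => ((C * A)%:E * (v `^ (- b))%:E)%E)).
    by move=> v; rewrite inE/= in_itv/= andbT => v1; rewrite /g ltNge v1 /= EFinM.
  exact: measurable_funeM.
have mg : measurable_fun pos (EFin \o g).
  by rewrite cA; apply/measurable_funU.
have ig : mu.-integrable pos (EFin \o g).
  apply/integrableP; split => //.
  rewrite (_ : integral _ _ _ = \int[mu]_(v in pos) (g v)%:E)%E; last first.
    by apply: eq_integral => v _; rewrite gee0_abs// lee_fin.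
  rewrite cA ge0_integral_setU//=; last 3 first.
  - by rewrite -cA.
  - by move=> v _; rewrite lee_fin.
  - apply/disj_setPS => v /= []; rewrite !in_itv/= andbT => /andP[_ v1] v2; have := lt_le_trans v1 v2; by rewrite ltxx.
  rewrite [X in (X + _)%E](_ : _ = (\int[mu]_(v in `]0%R, 1%R[) (fun=> C%:E) v)%E); last first.
    by apply: eq_integral => v; rewrite inE/= in_itv/= => /andP[_ v1]; rewrite /g v1.
  rewrite [X in (_ + X)%E](_ : _ = \int[mu]_(v in `[1%R, +oo[) ((C * A)%:E * (v `^ (- b))%:E))%E; last first.
    apply: eq_integral => v; rewrite inE/= in_itv/= andbT => v1.
    by rewrite /g ltNge v1 /= EFinM.
  rewrite ge0_integralZl//; last 2 first.
  - by move=> v _; rewrite lee_fin powR_ge0.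
  - by rewrite lee_fin mulr_ge0.
  rewrite integral_powR_tail// integral_cst; last exact: measurable_itv.
  rewrite [X in (_ * X)%E]lebesgue_measure_itv /= lte_fin ltr01.
  by rewrite -EFinB -!EFinM -EFinD ltry.
have ff v : pos v -> f_ ^~ v @ \oo --> (H v)%:E.
  rewrite /= in_itv/= andbT => v0.
  apply: cvg_EFin; first exact: nearW.
  have := hH v v0; rewrite -(cvg_shiftn N); apply: cvg_trans; apply: near_eq_cvg.
  by apply: nearW => n /=; rewrite mulrC.
have fg v n : pos v -> (`|f_ n v| <= (EFin \o g) v)%E.
  rewrite /= in_itv/= andbT => v0; rewrite lee_fin ger0_norm ?h0// /g.
  have c0 : (0 < cl ((k (n + N)%N)%:R * v))%N.
    by apply: cl_gt0; rewrite mulr_gt0// ltr0n.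
  case: ifPn => [v1|]; first by apply: hN2 => //; exact: leq_addl.
  rewrite -leNgt => v1; apply: le_trans (hN3 _ (leq_addl _ _) _ c0) _.
  rewrite -mulrA ler_wpM2l// !weightE// ler_pdivrMr ?p_gt0//.
  exact: hK (hN1 _ (leq_addl _ _)) v1.
have := @dominated_convergence _ _ _ mu pos (measurable_itv _) f_ (fun v => (H v)%:E) (EFin \o g) mf.
case=> [||||_ _].
- exact/measurable_EFinP.
- by apply: aeW => v; exact: ff.
- exact: ig.
- by apply: aeW => v n; exact: fg.
rewrite HI; under eq_fun do rewrite fE; move=> /cvg_EFinP.
by rewrite (cvg_shiftn N (fun n => s n / (k n)%:R)).
Qed.

End KarlinSums.

Section ExpLimit.
Context {R : realType}.

Lemma powN_le_expR (q : R) m : 0 <= q <= 1 -> (1 - q) ^+ m <= expR (- (m%:R * q)).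
Proof.
move=> /andP[q0 q1]; rewrite -mulrN expRM_natl lerXn2r ?nnegrE ?expR_ge0//; first lra.
have := expR_ge1Dx (- q); lra.
Qed.

Lemma expR_le_powN (q : R) m : 0 <= q < 1 ->
  expR (- (m%:R * (q / (1 - q)))) <= (1 - q) ^+ m.
Proof.
move=> /andP[q0 q1]; rewrite -mulrN expRM_natl lerXn2r ?nnegrE ?expR_ge0//; first lra.
have q10 : 0 < 1 - q by lra.
rewrite expRN -[leRHS]invrK lef_pV2 ?posrE ?expR_gt0 ?invr_gt0//.
apply: le_trans (expR_ge1Dx _); rewrite le_eqVlt; apply/orP; left; apply/eqP.
by field; rewrite gt_eqF.
Qed.

(** The exponent may fall short of [m n] by a fixed [c], which disappears in the limit because q
    tends to 0. *)
Lemma powN_cvg_expR (m : nat -> nat) (q : nat -> R) (y : R) c :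
  (forall n, 0 <= q n <= 1) ->
  (m n)%:R * q n @[n --> \oo] --> y -> q @ \oo --> (0 : R) ->
  (1 - q n) ^+ (m n - c) @[n --> \oo] --> expR (- y).
Proof.
move=> q01 mq q0.
have mcq : (m n - c)%:R * q n @[n --> \oo] --> y.
  apply: (@squeeze_cvgr _ _ _ _ (fun n => (m n)%:R * q n - c%:R * q n) (fun n => (m n)%:R * q n)) => //.
  - apply: nearW => n; have /andP[q0n _] := q01 n; apply/andP; split.
      rewrite -mulrBl ler_wpM2r// lerBlDr -natrD ler_nat; lia.
    by rewrite ler_wpM2r// ler_nat leq_subr.
  - rewrite -[X in _ --> X]subr0 -[X in _ --> _ - X](mulr0 (c%:R : R)).
    by apply: cvgB => //; apply: cvgM => //; exact: cvg_cst.
have cexp (u : nat -> R) (l : R) : u @ \oo --> l -> expR (- u n) @[n --> \oo] --> expR (- l).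
  by move=> ul; exact: (cvg_comp _ _ ul (@continuous_expRN R l)).
apply: (@squeeze_cvgr _ _ _ _ (fun n => expR (- ((m n - c)%:R * (q n / (1 - q n)))))
   (fun n => expR (- ((m n - c)%:R * q n)))).
- near=> n; rewrite powN_le_expR// andbT expR_le_powN//.
  have /andP[-> _] := q01 n => /=; near: n; apply: (cvgr_lt 0 q0); exact: ltr01.
- apply: cexp; rewrite (_ : (fun n => _) = (fun n => (m n - c)%:R * q n * (1 - q n)^-1)).
    have -> : y = y * (1 - 0)^-1 by rewrite subr0 invr1 mulr1.
    apply: cvgM => //; apply: cvgV; first by rewrite subr0 oner_eq0.
    by apply: cvgB => //; exact: cvg_cst.
  by apply/funext => n; rewrite mulrA.
- exact: cexp.
Unshelve. all: by end_near. Qed.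

End ExpLimit.

Section KarlinLimits.
Context {R : realType}.
Local Notation mu := (@lebesgue_measure R).
Local Notation pos := (`](0 : R), +oo[%classic).
Local Notation cl x := `|Num.ceil x|%N.
Variables (p : nat -> R) (gamma : R).
Hypothesis gamma01 : 0 < gamma < 1.
Hypothesis p_gt0 : forall i, (1 <= i)%N -> 0 < p i.
Hypothesis p_noninc : forall i j, (1 <= i)%N -> (i <= j)%N -> p j <= p i.
Hypothesis p_sum : (\sum_(1 <= i <oo) (p i)%:E = 1)%E.
Hypothesis p_rv : regularly_varying p (- gamma^-1).
Local Notation w := (weight p).
Let w_ge0 := weight_ge0 p_gt0.
Let w_sum := weight_sum p_gt0 p_sum.

Variables (k m : nat -> nat) (a : R).
Hypothesis k_cvg : k @ \oo --> \oo.
Hypothesis a_gt0 : 0 < a.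
Hypothesis mp_cvg : (m n)%:R * p (k n) @[n --> \oo] --> a.

Let w01 x : 0 <= w x <= 1.
Proof. by rewrite w_ge0 (w_le1 w_ge0 w_sum). Qed.

Let ratio_cvg (v : R) : 0 < v ->
  w (cl (v * (k n)%:R)) / p (k n) @[n --> \oo] --> v `^ (- gamma^-1).
Proof.
move=> v0; have := rv_seq p_rv k_cvg v0; apply: cvg_trans; apply: near_eq_cvg; near=> n.
have k0 : (0 < k n)%N by near: n; move/cvgnyPge: k_cvg; apply.
by rewrite weightE// cl_gt0// mulr_gt0// ltr0n.
Unshelve. all: by end_near. Qed.

Let pk_cvg0 : p (k n) @[n --> \oo] --> (0 : R).
Proof. exact: (cvg_comp _ _ k_cvg (weight_pos_cvg p_gt0 p_sum)). Qed.

Let pk_gt0 : \forall n \near \oo, 0 < p (k n).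
Proof.
near=> n; apply: p_gt0; near: n; move/cvgnyPge: k_cvg; apply.
Unshelve. all: by end_near. Qed.

Let q_cvg0 (v : R) : 0 < v -> w (cl (v * (k n)%:R)) @[n --> \oo] --> (0 : R).
Proof.
move=> v0; have h : (fun n => w (cl (v * (k n)%:R)) / p (k n) * p (k n)) @ \oo --> (0 : R).
  by rewrite -(mulr0 (v `^ (- gamma^-1))); apply: cvgM => //; exact: ratio_cvg.
apply: cvg_trans h; apply: near_eq_cvg; near=> n; rewrite /= divfK// gt_eqF//; near: n; exact: pk_gt0.
Unshelve. all: by end_near. Qed.

Let mq_cvg (v : R) : 0 < v ->
  (m n)%:R * w (cl (v * (k n)%:R)) @[n --> \oo] --> a * v `^ (- gamma^-1).
Proof.
move=> v0; have h : (fun n => (m n)%:R * p (k n) * (w (cl (v * (k n)%:R)) / p (k n))) @ \oo -->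
    a * v `^ (- gamma^-1).
  by apply: cvgM => //; exact: ratio_cvg.
apply: cvg_trans h; apply: near_eq_cvg; near=> n => /=.
have pn : 0 < p (k n) by near: n; exact: pk_gt0.
by field; rewrite gt_eqF.
Unshelve. all: by end_near. Qed.

Let mp_le : \forall n \near \oo, (m n)%:R * p (k n) <= a + 1.
Proof. by apply: (cvgr_le _ mp_cvg); lra. Qed.

Let mw_le (C : R) : 0 <= C -> \forall n \near \oo, forall x,
  C * ((m n)%:R * w x) <= C * (a + 1) * (w x / w (k n)).
Proof.
move=> C0; near=> n => x.
have k0 : (0 < k n)%N by near: n; move/cvgnyPge: k_cvg; apply.
have pn : 0 < p (k n) by exact: p_gt0.
rewrite -mulrA ler_wpM2l// (weightE _ k0) mulrA ler_pdivlMr// mulrAC ler_wpM2r//.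
by near: n; exact: mp_le.
Unshelve. all: by end_near. Qed.

(** At x = v k the probability of having been visited tends to 1 - exp(-a v^(-1/gamma)), whose
    integral is known. Bernoulli's inequality supplies the domination linear in w_x. *)
Lemma karlin_occupied :
  Ex w (m n) (fun s => (distinct s)%:R) / (k n)%:R @[n --> \oo] -->
  a `^ gamma * Gamma (1 - gamma).
Proof.
apply: (@dominated_sum R p gamma gamma01 p_gt0 p_noninc p_rv k
  (fun n q => 1 - (1 - q) ^+ (m n)) (fun v => 1 - expR (- (a * v `^ (- gamma^-1))))
  (1 + (a + 1))) => //.
- by move=> n x; have /andP[x0 x1] := w01 x; rewrite subr_ge0 exprn_ile1//; lra.
- by move=> n; rewrite subr0 expr1n subrr.
- apply: nearW => n x _ /=; have /andP[x0 x1] := w01 x.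
  have : 0 <= (1 - w x) ^+ m n by rewrite exprn_ge0//; lra.
  by move: a_gt0; set P := _ ^+ _ => a0 P0; lra.
- near=> n => x x0 /=.
  have bern : 1 - (1 - w x) ^+ m n <= (m n)%:R * w x.
    have /andP[h0 h1] := w01 x; elim: (m n) => [|j IH]; first by rewrite expr0 subrr mul0r.
    rewrite exprS -natr1.
    have : 0 <= (1 - w x) ^+ j <= 1 by rewrite exprn_ge0 ?exprn_ile1//; lra.
    by move: IH; set u := _ ^+ j => IH /andP[u0 u1]; nra.
  have : 1 * ((m n)%:R * w x) <= 1 * (a + 1) * (w x / w (k n)).
    by move: x {x0 bern}; near: n; exact: (mw_le ler01).
  rewrite !mul1r => h2; apply: le_trans bern (le_trans h2 _).
  by rewrite ler_wpM2r ?divr_ge0//; lra.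
- move=> v v0; apply: cvgB; first exact: cvg_cst.
  under eq_fun do rewrite -[X in _ ^+ X]subn0.
  by apply: powN_cvg_expR => //; [exact: mq_cvg|exact: q_cvg0].
- apply: continuous_halfline_measurable => v v0; apply: cvgB; first exact: cvg_cst.
  apply: (@continuous_comp _ _ _ (fun v => a * v `^ (- gamma^-1)) (fun y => expR (- y))).
    by apply: cvgM; [exact: cvg_cst|exact: continuous_powR].
  exact: continuous_expRN.
- exact: integral_occupied.
- by move=> n; exact: Ex_distinct_cvg.
Unshelve. all: by end_near. Qed.

(** One statement for all the Poisson-like sums: l = 1 yields the mean unseen mass, l = 3 with c = 1
    its variance, and larger shifts [c] the counts of symbols with separated visits. *)
Lemma karlin_pois (l c : nat) (s : nat -> R) : (0 < l)%N ->
  (forall n, series (fun x => ((m n)%:R * w x) ^+ l * (1 - w x) ^+ (m n - c)) @ \oo --> s n) ->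
  s n / (k n)%:R @[n --> \oo] --> a `^ gamma * (gamma * Gamma (l%:R - gamma)).
Proof.
move=> l0 hs.
(* As w_x <= 1, dropping [c] factors costs at most e^c; then y^j e^(-y) <= j! with y = m w_x. *)
have bound n x j : ((m n)%:R * w x) ^+ j * (1 - w x) ^+ (m n - c) <= expR c%:R * j`!%:R.
  have /andP[x0 x1] := w01 x.
  have y0 : 0 <= (m n)%:R * w x by rewrite mulr_ge0.
  apply: le_trans (_ : _ <= ((m n)%:R * w x) ^+ j * (expR c%:R * expR (- ((m n)%:R * w x)))) _.
    rewrite ler_wpM2l ?exprn_ge0//; apply: le_trans (powN_le_expR _ (w01 x)) _.
    rewrite -expRD ler_expR.
    have : (m n)%:R <= c%:R + (m n - c)%:R :> R by rewrite -natrD ler_nat; lia.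
    have := ler0n R c; set cc := c%:R; set A := (m n)%:R; set B := (m n - c)%:R; nra.
  by rewrite mulrCA ler_wpM2l ?expR_ge0// exp_ge_pow'.
pose C := expR c%:R * l`!%:R * (1 + (a + 1)) : R.
have C1 : 0 <= expR c%:R * l`!%:R :> R by rewrite mulr_ge0// expR_ge0.
apply: (@dominated_sum R p gamma gamma01 p_gt0 p_noninc p_rv k
  (fun n q => ((m n)%:R * q) ^+ l * (1 - q) ^+ (m n - c))
  (fun v => pois l (a * v `^ (- gamma^-1))) C) => //.
- move=> n x; have /andP[x0 x1] := w01 x.
  by rewrite mulr_ge0 ?exprn_ge0 ?mulr_ge0// subr_ge0.
- by move=> n; rewrite mulr0 expr0n (gtn_eqF l0) mul0r.
- apply: nearW => n x _ /=; apply: le_trans (bound n x l) _.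
  by rewrite /C ler_peMr//; have := a_gt0; lra.
- near=> n => x x0 /=.
  have h2 : expR c%:R * l`!%:R * ((m n)%:R * w x) <=
      expR c%:R * l`!%:R * (a + 1) * (w x / w (k n)).
    by move: x {x0}; near: n; exact: (mw_le C1).
  apply: le_trans (_ : _ <= expR c%:R * l`!%:R * ((m n)%:R * w x)) _.
    (* One factor m w_x is set aside before the uniform bound is applied, which makes the result
       linear in w_x. *)
    rewrite -{1}(prednK l0) exprS -mulrA [leLHS]mulrC.
    rewrite ler_wpM2r ?mulr_ge0//; apply: le_trans (bound n x l.-1) _.
    by rewrite ler_wpM2l ?expR_ge0// ler_nat -[in leqRHS](prednK l0) factS leq_pmull.
  apply: le_trans h2 _; rewrite /C ler_wpM2r ?divr_ge0// ler_wpM2l//; lra.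
- move=> v v0; rewrite /pois; apply: cvgM.
    exact: (cvg_comp _ _ (mq_cvg v0) (@exprn_continuous _ l _)).
  by apply: powN_cvg_expR => //; [exact: mq_cvg|exact: q_cvg0].
- apply: continuous_halfline_measurable => v v0.
  apply: (@continuous_comp _ _ _ (fun v => a * v `^ (- gamma^-1)) (pois l)).
    by apply: cvgM; [exact: cvg_cst|exact: continuous_powR].
  exact: pois_continuous.
- exact: integral_pois.
Unshelve. all: by end_near. Qed.

End KarlinLimits.

(** * Hitting times of the range *)

Section HittingTimes.
Context {R : realType}.
Local Notation cl x := `|Num.ceil x|%N.

Lemma cl_lt (x : R) : 0 <= x -> (cl x)%:R < x + 1.
Proof.
move=> x0; have h : 0 <= Num.ceil x by rewrite ceil_ge0; lra.
have e : (cl x)%:R = (Num.ceil x)%:~R :> R by rewrite -[in RHS](gez0_abs h).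
by rewrite e; have := ceilB1_lt x; rewrite intrB; lra.
Qed.

Lemma le_cl (x : R) : 0 <= x -> x <= (cl x)%:R.
Proof.
move=> x0; have h : 0 <= Num.ceil x by rewrite ceil_ge0; lra.
have -> : (cl x)%:R = (Num.ceil x)%:~R :> R by rewrite -[in RHS](gez0_abs h).
exact: ceil_ge.
Qed.

(* The two real-power increments compared in the summation by parts below. *)
Lemma powR_increments (kappa : R) (m : nat) : 0 < kappa < 2 -> (0 < m)%N ->
  (m%:R `^ (- kappa) - m.+1%:R `^ (- kappa)) * m%:R ^+ 2 <=
  2 * kappa / (2 - kappa) * (m.+1%:R `^ (2 - kappa) - m%:R `^ (2 - kappa)) :> R.
Proof.
move=> /andP[k0 k2] m0; have mR : 0 < m%:R :> R by rewrite ltr0n.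
set u := (m%:R)^-1 : R; have u0 : 0 < u by rewrite invr_gt0.
have u1 : u <= 1 by rewrite invf_le1// ler1n.
have mu_ : m%:R * u = 1 by rewrite mulfV// gt_eqF.
have mS : m.+1%:R = m%:R * (1 + u) by rewrite -natr1 mulrDr mulr1 mu_.
have u10 : 0 < 1 + u by lra.
rewrite mS !powRM ?(ltW mR) ?(ltW u10)//.
have e2 : m%:R `^ (2 - kappa) = m%:R `^ (- kappa) * m%:R ^+ 2 :> R.
  rewrite -powR_mulrn ?(ltW mR)// -powRD ?(gt_eqF mR) ?implybT//.
  by congr (_ `^ _); ring.
rewrite e2; set A := m%:R `^ (- kappa); set B := m%:R ^+ 2.
have AB : 0 <= A * B by rewrite mulr_ge0 ?powR_ge0 ?exprn_ge0.
have l0 : 0 <= ln (1 + u) by apply: ln_ge0; lra.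
have lu : ln (1 + u) <= u.
  by have := le_ln1Dx (ltac:(lra) : -1 < u).
have lu2 : u / 2 <= ln (1 + u).
  have := expR_ge1Dx (- ln (1 + u)); rewrite expRN lnK ?posrE// => h.
  have : (1 + u)^-1 * (1 + u) = 1 by rewrite mulVf// gt_eqF.
  by set v := (1 + u)^-1 in h *; nra.
have h1 : 1 - kappa * u <= (1 + u) `^ (- kappa).
  rewrite /powR gt_eqF//; have := expR_ge1Dx (- kappa * ln (1 + u)); nra.
have h2 : 1 + (2 - kappa) * (u / 2) <= (1 + u) `^ (2 - kappa).
  rewrite /powR gt_eqF//; have := expR_ge1Dx ((2 - kappa) * ln (1 + u)); nra.
set X := _ `^ (- kappa) in h1 *; set Y := _ `^ (2 - kappa) in h2 *.
rewrite [leLHS](_ : _ = A * B * (1 - X)); last by ring.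
rewrite [leRHS](_ : _ = A * B * (2 * kappa / (2 - kappa) * (Y - 1))); last by ring.
rewrite ler_wpM2l//; apply: (@le_trans _ _ (kappa * u)); first by lra.
rewrite mulrAC ler_pdivlMr; last by lra.
rewrite [leLHS](_ : _ = 2 * kappa * ((2 - kappa) * (u / 2))); last by field.
by rewrite ler_wpM2l//; lra.
Qed.

(** [G k m] stands for the probability that a level is reached by time m; it will be P(R_m >= k) for
    the tails and P(R_m >= k + 1), on the same scale p_k, for the masses. [phi] decays like
    m^(-kappa), and the quadratic domination of [G] is what forces kappa < 2. *)
Variables (p : nat -> R) (G : nat -> nat -> R) (astar C : R).
Hypothesis p_gt0 : forall k, (0 < k)%N -> 0 < p k.
Hypothesis p_cvg0 : p @ \oo --> (0 : R).
Hypothesis astar_gt0 : 0 < astar.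
Hypothesis G01 : forall k m, 0 <= G k m <= 1.
Hypothesis G_mono : forall k m, G k m <= G k m.+1.
Hypothesis C_ge0 : 0 <= C.
Hypothesis G_dom : \forall k \near \oo, forall m, G k m <= C * (m%:R * p k) ^+ 2.
Hypothesis G_sub : forall a, 0 < a < astar -> G k (cl (a / p k)) @[k --> \oo] --> (0 : R).
Hypothesis G_sup : forall a, astar < a -> G k (cl (a / p k)) @[k --> \oo] --> (1 : R).

Variables (phi : nat -> R) (kappa c0 : R).
Hypothesis kappa02 : 0 < kappa < 2.
Hypothesis phi_ge0 : forall m, 0 <= phi m.
Hypothesis phi_noninc : forall m n, (0 < m)%N -> (m <= n)%N -> phi n <= phi m.
Hypothesis phi_cvg : m%:R `^ kappa * phi m @[m --> \oo] --> c0.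

Lemma scale_cvg a : 0 < a -> (cl (a / p k))%:R * p k @[k --> \oo] --> a.
Proof.
move=> a0; apply: (@squeeze_cvgr _ _ _ _ (fun=> a) (fun k => a + p k)).
- near=> k; have pk : 0 < p k by apply: p_gt0; near: k; exact: nbhs_infty_gt.
  have ap : 0 <= a / p k by rewrite divr_ge0// ltW.
  rewrite -ler_pdivrMr// le_cl//= -ler_pdivlMr// mulrDl mulfV ?gt_eqF//.
  exact/ltW/cl_lt.
- exact: cvg_cst.
- by rewrite -[X in _ --> X]addr0; apply: cvgD => //; exact: cvg_cst.
Unshelve. all: by end_near. Qed.

Lemma scale_cvgy a : 0 < a -> cl (a / p k) @[k --> \oo] --> \oo.
Proof.
move=> a0; apply/cvgnyPge => A; near=> k.
have pk : 0 < p k by apply: p_gt0; near: k; exact: nbhs_infty_gt.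
apply: cl_ge; rewrite ler_pdivlMr//; apply: (@le_trans _ _ (A.+1%:R * p k)).
  by rewrite ler_wpM2r ?(ltW pk)// ler_nat.
rewrite mulrC -ler_pdivlMr ?ltr0n//; near: k; apply: (cvgr_le _ p_cvg0).
by rewrite divr_gt0// ltr0n.
Unshelve. all: by end_near. Qed.

Let phi_bound : exists2 K : R, 0 <= K & forall m, (0 < m)%N -> phi m <= K * m%:R `^ (- kappa).
Proof.
have [M [_ hM]] := cvg_seq_bounded (cvgP _ phi_cvg).
exists (`|M| + 1); first by rewrite addr_ge0.
move=> m m0; have mR : 0 < m%:R :> R by rewrite ltr0n.
rewrite powRN ler_pdivlMr ?powR_gt0// mulrC.
apply: le_trans (ler_norm _) _; apply: (hM (`|M| + 1)) => //.
by rewrite (le_lt_trans (ler_norm M))// ltrDl.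
Qed.

Let inc k m : 0 <= G k m.+1 - G k m.
Proof. by rewrite subr_ge0. Qed.

Let G00 : \forall k \near \oo, G k 0 = 0.
Proof.
near=> k; apply/eqP; rewrite eq_le; have /andP[-> _] := G01 k 0; rewrite andbT.
have dom m : G k m <= C * (m%:R * p k) ^+ 2 by move: m; near: k; exact: G_dom.
by apply: le_trans (dom 0%N) _; rewrite mul0r expr0n mulr0.
Unshelve. all: by end_near. Qed.

(** Summation by parts against G <= C (m p_k)^2. At M = a / p_k the bound is of order a^(2 - kappa)
    p_k^kappa, small relative to p_k^kappa when a is small. *)
Lemma hitting_small : exists2 K : R, 0 <= K &
  \forall k \near \oo, forall M,
    \sum_(0 <= m < M) phi m.+1 * (G k m.+1 - G k m) <= K * p k ^+ 2 * M%:R `^ (2 - kappa).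
Proof.
have [K0 K00 hK] := phi_bound; case/andP: (kappa02) => k0 k2.
pose D : R := 2 * kappa / (2 - kappa).
have D0 : 0 <= D by rewrite divr_ge0//; lra.
pose H m : R := m%:R `^ (- kappa).
exists (K0 * (C + D * C)); first by rewrite mulr_ge0// addr_ge0// mulr_ge0.
near=> k => M.
have dom m : G k m <= C * (m%:R * p k) ^+ 2 by move: m; near: k; exact: G_dom.
have Gk0 : G k 0 = 0 by near: k; exact: G00.
(* The boundary term of the summation by parts is carried through the induction; [powR_increments]
   absorbs each new step. *)
have key N : \sum_(0 <= m < N) H m.+1 * (G k m.+1 - G k m) <=
    H N * G k N + D * C * p k ^+ 2 * N%:R `^ (2 - kappa).
  elim: N => [|N IH].
    rewrite big_geq//; have /andP[g0 _] := G01 k 0; apply: addr_ge0.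
      by rewrite mulr_ge0// powR_ge0.
    exact: (mulr_ge0 (mulr_ge0 (mulr_ge0 D0 C_ge0) (sqr_ge0 _)) (powR_ge0 _ _)).
  rewrite big_nat_recr//=; case: N IH => [|N] IH.
    rewrite big_geq// add0r Gk0 subr0 lerDl.
    exact: (mulr_ge0 (mulr_ge0 (mulr_ge0 D0 C_ge0) (sqr_ge0 _)) (powR_ge0 _ _)).
  have h := @powR_increments kappa N.+1 kappa02 isT.
  have h2 : (H N.+1 - H N.+2) * G k N.+1 <= C * p k ^+ 2 *
      (D * (N.+2%:R `^ (2 - kappa) - N.+1%:R `^ (2 - kappa))).
    apply: (@le_trans _ _ ((H N.+1 - H N.+2) * (C * (N.+1%:R * p k) ^+ 2))).
      rewrite ler_wpM2l// subr_ge0 /H !powRN lef_pV2 ?posrE ?powR_gt0 ?ltr0n//.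
      by apply: ge0_ler_powR; rewrite ?nnegrE ?ler0n ?ler_nat ?(ltW k0).
    rewrite [leLHS](_ : _ = C * p k ^+ 2 * ((H N.+1 - H N.+2) * N.+1%:R ^+ 2)); last by ring.
    by rewrite ler_wpM2l// mulr_ge0 ?sqr_ge0.
  rewrite [leRHS](_ : _ = H N.+1 * G k N.+1 + D * C * p k ^+ 2 * N.+1%:R `^ (2 - kappa) +
    (H N.+2 * G k N.+2 - H N.+1 * G k N.+1 + C * p k ^+ 2 *
      (D * (N.+2%:R `^ (2 - kappa) - N.+1%:R `^ (2 - kappa))))); last by ring.
  apply: lerD => //; rewrite -subr_ge0.
  rewrite [leRHS](_ : _ = C * p k ^+ 2 * (D * (N.+2%:R `^ (2 - kappa) - N.+1%:R `^ (2 - kappa))) -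
     (H N.+1 - H N.+2) * G k N.+1); last by ring.
  by rewrite subr_ge0.
apply: (@le_trans _ _ (K0 * \sum_(0 <= m < M) H m.+1 * (G k m.+1 - G k m))).
  rewrite mulr_sumr; apply: ler_sum => m _; rewrite mulrA ler_wpM2r// hK//.
rewrite [leRHS](_ : _ = K0 * (C * (p k ^+ 2 * M%:R `^ (2 - kappa)) +
   D * C * p k ^+ 2 * M%:R `^ (2 - kappa))); last by ring.
rewrite ler_wpM2l//; apply: le_trans (key M) _.
rewrite lerD2r; case: M => [|M].
  rewrite Gk0 mulr0; exact: (mulr_ge0 C_ge0 (mulr_ge0 (sqr_ge0 _) (powR_ge0 _ _))).
have MR : 0 < M.+1%:R :> R by rewrite ltr0n.
have -> : M.+1%:R `^ (2 - kappa) = H M.+1 * M.+1%:R ^+ 2 :> R.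
  rewrite /H -powR_mulrn ?(ltW MR)// -powRD ?(gt_eqF MR) ?implybT//.
  by congr (_ `^ _); ring.
rewrite [leRHS](_ : _ = H M.+1 * (C * (M.+1%:R * p k) ^+ 2)); last by ring.
by rewrite ler_wpM2l ?powR_ge0.
Unshelve. all: by end_near. Qed.

End HittingTimes.

Section HittingLimits.
Context {R : realType}.
Local Notation cl x := `|Num.ceil x|%N.
Variables (p : nat -> R) (G : nat -> nat -> R) (astar C : R).
Hypothesis p_gt0 : forall k, (0 < k)%N -> 0 < p k.
Hypothesis p_cvg0 : p @ \oo --> (0 : R).
Hypothesis astar_gt0 : 0 < astar.
Hypothesis G01 : forall k m, 0 <= G k m <= 1.
Hypothesis G_mono : forall k m, G k m <= G k m.+1.
Hypothesis C_ge0 : 0 <= C.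
Hypothesis G_dom : \forall k \near \oo, forall m, G k m <= C * (m%:R * p k) ^+ 2.
Hypothesis G_sub : forall a, 0 < a < astar -> G k (cl (a / p k)) @[k --> \oo] --> (0 : R).
Hypothesis G_sup : forall a, astar < a -> G k (cl (a / p k)) @[k --> \oo] --> (1 : R).

Variables (phi : nat -> R) (kappa c0 : R).
Hypothesis kappa02 : 0 < kappa < 2.
Hypothesis phi_ge0 : forall m, 0 <= phi m.
Hypothesis phi_noninc : forall m n, (0 < m)%N -> (m <= n)%N -> phi n <= phi m.
Hypothesis phi_cvg : m%:R `^ kappa * phi m @[m --> \oo] --> c0.

Let cl_le (x y : R) : 0 <= x -> x <= y -> (cl x <= cl y)%N.
Proof.
move=> x0 xy; have h := cl_lt x0; have h' := le_cl (le_trans x0 xy).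
by rewrite -ltnS -(ltr_nat R) -natr1; lra.
Qed.

Let small := hitting_small G01 G_mono C_ge0 G_dom kappa02 phi_cvg.

Let pow_cvg (u : nat -> R) (a z : R) : 0 < a -> u @ \oo --> a -> u k `^ z @[k --> \oo] --> a `^ z.
Proof. by move=> a0 ua; have c := @continuous_powR R z a a0; exact: (cvg_comp _ _ ua c). Qed.

Let p_pos : \forall k \near \oo, 0 < p k.
Proof. near=> k; apply: p_gt0; near: k; exact: nbhs_infty_gt. Unshelve. all: by end_near. Qed.

Let t_pos (a : R) : 0 < a -> \forall k \near \oo, (0 < cl (a / p k))%N.
Proof.
move=> a0; near=> k; apply: cl_gt0; rewrite divr_gt0//; near: k; exact: p_pos.
Unshelve. all: by end_near. Qed.

Let phi_scale (a : R) : 0 < a ->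
  phi (cl (a / p k)) * p k `^ (- kappa) @[k --> \oo] --> c0 * a `^ (- kappa).
Proof.
move=> a0.
have h : (fun k => ((cl (a / p k))%:R `^ kappa * phi (cl (a / p k))) *
   (((cl (a / p k))%:R * p k) `^ (- kappa))) @ \oo --> c0 * a `^ (- kappa).
  apply: cvgM.
    exact: (cvg_comp _ _ (scale_cvgy p_gt0 p_cvg0 a0) phi_cvg).
  by apply: pow_cvg => //; exact: scale_cvg.
apply: cvg_trans h; apply: near_eq_cvg; near=> k.
have pk : 0 < p k by near: k; exact: p_pos.
have tk : (0 < cl (a / p k))%N by near: k; exact: t_pos.
have tR : 0 < (cl (a / p k))%:R :> R by rewrite ltr0n.
rewrite powRM ?(ltW pk)// mulrACA [X in X * _ = _](_ : _ = 1) ?mul1r//.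
by rewrite powRN mulfV// gt_eqF// powR_gt0.
Unshelve. all: by end_near. Qed.

Let small_scale (a K : R) : 0 < a ->
  K * p k ^+ 2 * (cl (a / p k))%:R `^ (2 - kappa) * p k `^ (- kappa) @[k --> \oo] -->
    K * a `^ (2 - kappa).
Proof.
move=> a0.
have h : (fun k => K * ((cl (a / p k))%:R * p k) `^ (2 - kappa)) @ \oo --> K * a `^ (2 - kappa).
  by apply: cvgM; [exact: cvg_cst|apply: pow_cvg => //; exact: scale_cvg].
apply: cvg_trans h; apply: near_eq_cvg; near=> k.
have pk : 0 < p k by near: k; exact: p_pos.
rewrite powRM ?(ltW pk)// [X in _ = X](_ : _ =
   K * ((cl (a / p k))%:R `^ (2 - kappa) * (p k ^+ 2 * p k `^ (- kappa)))); last by ring.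
by rewrite -powR_mulrn ?(ltW pk)// -powRD// (gt_eqF pk) implybT.
Unshelve. all: by end_near. Qed.

Let dG k m : 0 <= G k m.+1 - G k m.
Proof. by rewrite subr_ge0. Qed.

Let tail_le (d : nat -> R) (m0 M : nat) : (0 < m0)%N -> (forall m, 0 <= d m) ->
  \sum_(m0 <= m < M) phi m.+1 * d m <= phi m0 * \sum_(m0 <= m < M) d m.
Proof.
move=> m00 d0; rewrite mulr_sumr big_nat [leRHS]big_nat; apply: ler_sum => m /andP[h _].
by rewrite ler_wpM2r// phi_noninc// leqW.
Qed.

Let sum_le_split (d : nat -> R) (m0 M : nat) : (0 < m0)%N -> (forall m, 0 <= d m) ->
  \sum_(0 <= m < M) phi m.+1 * d m <=
  \sum_(0 <= m < m0) phi m.+1 * d m + phi m0 * \sum_(m0 <= m < M) d m.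
Proof.
move=> m00 d0; have nn m n : 0 <= \sum_(m <= i < n) phi i.+1 * d i.
  by apply: sumr_ge0 => i _; rewrite mulr_ge0.
have [Mm|/ltnW mM] := leqP M m0.
  rewrite (big_cat_nat (n := M) (p := m0))//= -addrA lerDl addr_ge0// mulr_ge0//.
  by apply: sumr_ge0.
by rewrite (@big_cat_nat _ _ _ m0 0 M)//= lerD2l tail_le.
Qed.

Let p_pow_gt0 k : 0 < p k -> 0 < p k `^ (- kappa).
Proof. exact: powR_gt0. Qed.

(** [d] is a part of the increments with vanishing total. Before a / p_k it is bounded by the
    increments themselves, where [hitting_small] applies; afterwards the weight is of order
    p_k^kappa and multiplies a vanishing total. *)
Lemma hitting_negligible (d : nat -> nat -> R) (eta : nat -> R) (e : R) :
  (forall k m, 0 <= d k m <= G k m.+1 - G k m) ->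
  (\forall k \near \oo, forall M, \sum_(0 <= m < M) d k m <= eta k) ->
  eta @ \oo --> (0 : R) -> 0 < e ->
  \forall k \near \oo, forall M, \sum_(0 <= m < M) phi m.+1 * d k m <= e * p k `^ kappa.
Proof.
move=> d01 dsum eta0 e0; have [K K0 hK] := small.
case/andP: (kappa02) => kp0 kp2.
have [a a0 Ka] : exists2 a : R, 0 < a & K * a `^ (2 - kappa) < e / 2.
  have h : K * a `^ (2 - kappa) @[a --> 0^'+] --> (0 : R).
    rewrite -[X in _ --> X](mulr0 K); apply: cvgM; first exact: cvg_cst.
    by apply: powR_cvg0; lra.
  near ((0 : R)^'+) => a; exists a; first by near: a; exact: nbhs_right_gt.
  by near: a; apply: (cvgr_lt _ h); rewrite divr_gt0.
have h1 := @small_scale a K a0.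
have h2 : (fun k => phi (cl (a / p k)) * p k `^ (- kappa) * eta k) @ \oo --> (0 : R).
  by rewrite -(mulr0 (c0 * a `^ (- kappa))); apply: cvgM => //; exact: phi_scale.
near=> k => M.
have pk : 0 < p k by near: k; exact: p_pos.
have tk : (0 < cl (a / p k))%N by near: k; exact: t_pos.
have pz : 0 < p k `^ (- kappa) by exact: p_pow_gt0.
rewrite -[p k `^ kappa]invrK -powRN ler_pdivlMr//.
set m0 := cl (a / p k) in tk *.
have s1 : \sum_(0 <= m < m0) phi m.+1 * (G k m.+1 - G k m) <= K * p k ^+ 2 * m0%:R `^ (2 - kappa).
  by move: m0 {tk}; near: k; exact: hK.
have s2 : \sum_(m0 <= m < M) d k m <= eta k.
  apply: (@le_trans _ _ (\sum_(0 <= m < maxn m0 M) d k m)); last first.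
    by move: (maxn m0 M); near: k; exact: dsum.
  have [Mm|/ltnW mM] := leqP M m0.
    by rewrite big_geq//; apply: sumr_ge0 => m _; have /andP[] := d01 k m.
  rewrite (@big_cat_nat _ _ _ m0 0 M)//= lerDr; apply: sumr_ge0 => m _.
  by have /andP[] := d01 k m.
have s3 : K * p k ^+ 2 * m0%:R `^ (2 - kappa) * p k `^ (- kappa) < e / 2.
  by rewrite /m0; near: k; apply: (cvgr_lt _ h1).
have s4 : phi m0 * p k `^ (- kappa) * eta k < e / 2.
  by rewrite /m0; near: k; apply: (cvgr_lt _ h2); rewrite divr_gt0.
apply: (@le_trans _ _ ((K * p k ^+ 2 * m0%:R `^ (2 - kappa) + phi m0 * eta k) * p k `^ (- kappa))).
  rewrite ler_wpM2r ?(ltW pz)//.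
  apply: (le_trans (@sum_le_split (d k) m0 M tk _)).
    by move=> m; have /andP[] := d01 k m.
  apply: lerD; last by rewrite ler_wpM2l.
  apply: le_trans s1; apply: ler_sum => m _; rewrite ler_wpM2l//.
  by have /andP[] := d01 k m.
by rewrite mulrDl [X in _ + X]mulrAC; apply: ltW; lra.
Unshelve. all: by end_near. Qed.

Let G00 : \forall k \near \oo, G k 0 = 0.
Proof.
near=> k; apply/eqP; rewrite eq_le; have /andP[-> _] := G01 k 0; rewrite andbT.
have dom m : G k m <= C * (m%:R * p k) ^+ 2 by move: m; near: k; exact: G_dom.
by apply: le_trans (dom 0%N) _; rewrite mul0r expr0n mulr0.
Unshelve. all: by end_near. Qed.

Let G_le k m n : (m <= n)%N -> G k m <= G k n.
Proof. by apply: (homo_leq lexx le_trans) => i; exact: G_mono. Qed.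

Let telG k m n : (m <= n)%N -> \sum_(m <= i < n) (G k i.+1 - G k i) = G k n - G k m.
Proof. by move=> mn; rewrite telescope_sumr. Qed.

Let L := c0 * astar `^ (- kappa).

Let c0_ge0 : 0 <= c0.
Proof.
rewrite -(cvg_lim _ phi_cvg)//; apply: limr_ge; first by apply/cvg_ex; eexists; exact: phi_cvg.
by apply: nearW => m; rewrite mulr_ge0 ?powR_ge0.
Qed.

Let cont_L : {for astar, continuous (fun a => c0 * a `^ (- kappa))}.
Proof. by apply: cvgM; [exact: cvg_cst|exact: continuous_powR]. Qed.

(** Take a < a1 < astar < a2. Up to a / p_k, [hitting_small] applies; from a to a1 almost no
    increment falls; beyond a1 the weight is at most its value there. Conversely, almost all
    increments occur before a2, at a weight no smaller than the one at a2. *)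
Lemma hitting_cvg (V : nat -> R) :
  (forall k, (fun M => \sum_(0 <= m < M) phi m.+1 * (G k m.+1 - G k m)) @ \oo --> V k) ->
  V k * p k `^ (- kappa) @[k --> \oo] --> c0 * astar `^ (- kappa).
Proof.
move=> hV; have [K K0 hK] := small; case/andP: (kappa02) => kp0 kp2.
apply/cvgrPdist_le => e e0.
have e3 : 0 < e / 3 by rewrite divr_gt0.
have [a1 /andP[a10 a1s] ha1] : exists2 a1, 0 < a1 < astar & c0 * a1 `^ (- kappa) < L + e / 3.
  have h := cvg_at_left_filter cont_L.
  near (astar^'-) => a1; exists a1.
    apply/andP; split; first by near: a1; exact: nbhs_left_gt.
    by near: a1; exact: nbhs_left_lt.
  by near: a1; apply: (cvgr_lt _ h); rewrite /L ltrDl.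
have [a2 a2s ha2] : exists2 a2, astar < a2 & L - e / 3 < c0 * a2 `^ (- kappa).
  have h := cvg_at_right_filter cont_L.
  near (astar^'+) => a2; exists a2; first by near: a2; exact: nbhs_right_gt.
  by near: a2; apply: (cvgr_gt _ h); rewrite /L gtrBl.
have [a /andP[a0 aa1] Ka] : exists2 a : R, 0 < a < a1 & K * a `^ (2 - kappa) < e / 3.
  have h : K * a `^ (2 - kappa) @[a --> 0^'+] --> (0 : R).
    rewrite -[X in _ --> X](mulr0 K); apply: cvgM; first exact: cvg_cst.
    by apply: powR_cvg0; lra.
  near ((0 : R)^'+) => a; exists a.
    apply/andP; split; first by near: a; exact: nbhs_right_gt.
    by near: a; exact: nbhs_right_lt.
  by near: a; apply: (cvgr_lt _ h).
have a20 : 0 < a2 by exact: lt_trans a2s.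
have h1 := @small_scale a K a0.
have h2 : (fun k => phi (cl (a / p k)) * p k `^ (- kappa) * G k (cl (a1 / p k))) @ \oo --> (0 : R).
  rewrite -(mulr0 (c0 * a `^ (- kappa))); apply: cvgM; first exact: phi_scale.
  by apply: G_sub; rewrite a10.
have h3 := phi_scale a10.
have h4 : (fun k => phi (cl (a2 / p k)) * p k `^ (- kappa) * G k (cl (a2 / p k))) @ \oo -->
    c0 * a2 `^ (- kappa).
  rewrite -[X in _ --> X]mulr1; apply: cvgM; first exact: phi_scale.
  exact: G_sup.
near=> k.
have pk : 0 < p k by near: k; exact: p_pos.
have pz : 0 < p k `^ (- kappa) by exact: p_pow_gt0.
have Gk0 : G k 0 = 0 by near: k; exact: G00.
have tk : (0 < cl (a / p k))%N by near: k; exact: t_pos.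
have tk1 : (0 < cl (a1 / p k))%N by near: k; exact: t_pos.
have tk2 : (0 < cl (a2 / p k))%N by near: k; exact: t_pos.
have s1 : \sum_(0 <= m < cl (a / p k)) phi m.+1 * (G k m.+1 - G k m) <=
    K * p k ^+ 2 * (cl (a / p k))%:R `^ (2 - kappa).
  by move: (cl (a / p k)) {tk}; near: k; exact: hK.
have m01 : (cl (a / p k) <= cl (a1 / p k))%N.
  by apply: cl_le; rewrite ?divr_ge0 ?ler_wpM2r ?invr_ge0 ?(ltW a0) ?(ltW aa1) ?(ltW pk).
have upper : V k <= K * p k ^+ 2 * (cl (a / p k))%:R `^ (2 - kappa) +
    phi (cl (a / p k)) * G k (cl (a1 / p k)) + phi (cl (a1 / p k)).
  rewrite -(cvg_lim _ (hV k))//; apply: limr_le; first by apply/cvg_ex; eexists; exact: hV.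
  apply: nearW => M; set m0 := cl (a / p k) in tk s1 m01 *; set m1 := cl (a1 / p k) in tk1 m01 *.
  apply: (le_trans (sum_le_split M tk1 (dG k))); apply: lerD; last first.
    rewrite -[leRHS]mulr1 ler_wpM2l//; have [Mm|/ltnW mM] := leqP M m1.
      by rewrite big_geq.
    rewrite telG//; have /andP[g0 _] := G01 k m1; have /andP[_ g1] := G01 k M; lra.
  rewrite (@big_cat_nat _ _ _ m0 0 m1)//=; apply: lerD => //.
  apply: le_trans (tail_le _ tk (dG k)) _; rewrite ler_wpM2l// telG//.
  by rewrite gerBl; have /andP[] := G01 k m0.
have lower : phi (cl (a2 / p k)) * G k (cl (a2 / p k)) <= V k.
  rewrite -(cvg_lim _ (hV k))//; apply: limr_ge; first by apply/cvg_ex; eexists; exact: hV.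
  exists (cl (a2 / p k)) => // M /= m2M; set m2 := cl (a2 / p k) in tk2 m2M *.
  rewrite (@big_cat_nat _ _ _ m2 0 M)//= (_ : G k m2 = \sum_(0 <= m < m2) (G k m.+1 - G k m)); last first.
    by rewrite telG// Gk0 subr0.
  rewrite mulr_sumr; apply: (@le_trans _ _ (\sum_(0 <= m < m2) phi m.+1 * (G k m.+1 - G k m))).
    rewrite big_nat [leRHS]big_nat; apply: ler_sum => m /andP[_ mm].
    by rewrite ler_wpM2r// phi_noninc.
  by rewrite lerDl; apply: sumr_ge0 => m _; rewrite mulr_ge0.
have b1 : K * p k ^+ 2 * (cl (a / p k))%:R `^ (2 - kappa) * p k `^ (- kappa) < e / 3.
  by near: k; apply: (cvgr_lt _ h1).
have b2 : phi (cl (a / p k)) * p k `^ (- kappa) * G k (cl (a1 / p k)) < e / 3.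
  by near: k; apply: (cvgr_lt _ h2).
have b3 : phi (cl (a1 / p k)) * p k `^ (- kappa) < L + e / 3.
  by near: k; apply: (cvgr_lt _ h3).
have b4 : L - e / 3 < phi (cl (a2 / p k)) * p k `^ (- kappa) * G k (cl (a2 / p k)).
  by near: k; apply: (cvgr_gt _ h4).
have u2 := ler_wpM2r (ltW pz) upper; have l2 := ler_wpM2r (ltW pz) lower.
rewrite !mulrDl in u2; rewrite -/L; set VV := V k * _ in u2 l2 *.
rewrite mulrAC in b2; rewrite mulrAC in b4.
by rewrite ler_norml; apply/andP; split; lra.
Unshelve. all: by end_near. Qed.

End HittingLimits.

(** * Hitting times of the number of distinct values *)

Section RangeTails.
Context {R : realType}.
Local Notation cl x := `|Num.ceil x|%N.
Variables (p : nat -> R) (gamma : R).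
Hypothesis gamma01 : 0 < gamma < 1.
Hypothesis p_gt0 : forall i, (1 <= i)%N -> 0 < p i.
Hypothesis p_noninc : forall i j, (1 <= i)%N -> (i <= j)%N -> p j <= p i.
Hypothesis p_sum : (\sum_(1 <= i <oo) (p i)%:E = 1)%E.
Hypothesis p_rv : regularly_varying p (- gamma^-1).
Local Notation w := (weight p).
Let w_ge0 := weight_ge0 p_gt0.
Let w_sum := weight_sum p_gt0 p_sum.
Let p_cvg0 := weight_pos_cvg p_gt0 p_sum.
Local Notation Ex := (Ex w).

Definition rangeF k m : R := Ex m (fun s => (k <= distinct s)%:R).
Definition rangeQ k m : R := Ex m (fun s => (distinct s == k)%:R).
Definition astar : R := Gamma (1 - gamma) `^ (- gamma^-1).

Lemma GammaC_gt0 : 0 < Gamma (1 - gamma).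
Proof. by apply: Gamma_gt0; case/andP: gamma01 => g0 g1; lra. Qed.

Lemma astar_gt0 : 0 < astar.
Proof. by rewrite powR_gt0// GammaC_gt0. Qed.

Lemma astar_powR : astar `^ gamma = (Gamma (1 - gamma))^-1.
Proof.
case/andP: gamma01 => g0 _; rewrite /astar -powRrM mulNr mulVf ?gt_eqF//.
by rewrite powR_inv1// ltW// GammaC_gt0.
Qed.

Lemma rangeF01 k m : 0 <= rangeF k m <= 1.
Proof.
apply/andP; split.
  by apply: Ex_ge0 => //; exact: bnds_bool.
rewrite -[leRHS](Ex_cst w_ge0 w_sum m); apply: Ex_le => //.
- exact: bnds_bool.
- exact: bnds_cst.
- by move=> s _; case: (_ <= _)%N.
Qed.

Lemma rangeF_mono k m : rangeF k m <= rangeF k m.+1.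
Proof.
rewrite /rangeF -(@Ex_take _ _ w_ge0 w_sum m m.+1)//; apply: Ex_le => //.
- exact: bnds_bool.
- exact: bnds_bool.
- move=> s sm; rewrite ler_nat; case: (leqP k (distinct (take m s))) => // h.
  rewrite (leq_trans h)//.
  have := @distinct_take m m.+1 s (leqnSn _); rewrite [take m.+1 s]take_oversize ?sm//.
Qed.

Lemma rangeF_S k m : rangeF k.+1 m <= rangeF k m.
Proof.
apply: Ex_le => //; [exact: bnds_bool|exact: bnds_bool|move=> s _].
by rewrite ler_nat; case: (ltnP k (distinct s)) => // /ltnW ->.
Qed.

Lemma rangeQE k m : rangeQ k m = rangeF k m - rangeF k.+1 m.
Proof.
rewrite /rangeF -(ExB w_ge0 w_sum); [|exact: bnds_bool..].
by apply: eq_Ex => s _; case: ltngtP => //; rewrite ?subrr ?subr0.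
Qed.

Lemma rangeF_m0 k : (0 < k)%N -> rangeF k 0 = 0.
Proof. by case: k. Qed.

(** The tail bound for the range is taken at h = k/2, where the tail mass is still of order k p_k;
    the powers of k cancel and (m p_k)^2 remains. *)
Lemma rangeF_dom : exists2 C : R, 0 <= C &
  \forall k \near \oo, forall m, rangeF k m <= C * (m%:R * p k) ^+ 2.
Proof.
have [C C0 hC] := tailmass_half_le gamma01 p_gt0 p_noninc p_sum p_rv.
exists (8 * C ^+ 2); first by rewrite mulr_ge0// sqr_ge0.
near=> k => m; have k4 : (4 <= k)%N by near: k; exact: nbhs_infty_ge.
have tk : tailmass w k./2 <= C * (k%:R * p k) by near: k; exact: hC.
have kR : 0 < k%:R :> R by rewrite ltr0n; lia.
have hk : (k./2.+1 < k)%N by lia.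
apply: (le_trans (@distinct_ge_le _ _ w_ge0 w_sum m k k./2 hk)).
set N := ((k - k./2) * (k - k./2).-1)%N.
(* Eight is 2 times 4: k is at most twice k - h and, from k = 4 on, at most four times k - h - 1. *)
have N8 : k%:R ^+ 2 <= 8 * N%:R :> R.
  rewrite -natrX -natrM ler_nat /N; set h := k./2 in hk *.
  have h1 : (k <= 2 * (k - h))%N by lia.
  have h2 : (k <= 4 * (k - h).-1)%N by lia.
  rewrite -mulnn; apply: leq_trans (leq_mul h1 h2) _; lia.
have N0 : 0 < N%:R :> R by have := exprn_gt0 2 kR; lra.
rewrite ler_pdivrMr//; apply: (@le_trans _ _ (m%:R ^+ 2 * (C * (k%:R * p k)) ^+ 2)).
  rewrite ler_wpM2l ?sqr_ge0// lerXn2r ?nnegrE//; last by apply: le_trans tk; exact: tailmass_ge0.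
  exact: tailmass_ge0.
rewrite [leLHS](_ : _ = C ^+ 2 * (m%:R * p k) ^+ 2 * k%:R ^+ 2); last by ring.
rewrite [leRHS](_ : _ = C ^+ 2 * (m%:R * p k) ^+ 2 * (8 * N%:R)); last by ring.
by rewrite ler_wpM2l// mulr_ge0// sqr_ge0.
Unshelve. all: by end_near. Qed.

Let k_cvgy : (fun k : nat => k) @ \oo --> \oo. Proof. exact: cvg_id. Qed.

Lemma mean_distinct_cvg (a : R) : 0 < a ->
  Ex (cl (a / p k)) (fun s => (distinct s)%:R) / k%:R @[k --> \oo] -->
    a `^ gamma * Gamma (1 - gamma).
Proof.
move=> a0; apply: (karlin_occupied gamma01 p_gt0 p_noninc p_sum p_rv k_cvgy a0).
exact: scale_cvg.
Qed.

(** The variance is at most the mean, which is of order k, so a deviation of e k has probability of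
    order 1 / k. *)
Let chebyshev_D (a e : R) : 0 < a -> 0 < e ->
  Ex (cl (a / p k)) (fun s => (e * k%:R <= `|(distinct s)%:R -
    Ex (cl (a / p k)) (fun s => (distinct s)%:R)|)%R%:R) @[k --> \oo] --> (0 : R).
Proof.
move=> a0 e0; apply: (@squeeze_cvgr _ _ _ _ (fun=> 0) (fun k =>
   (Ex (cl (a / p k)) (fun s => (distinct s)%:R) / k%:R) * ((e ^+ 2)^-1 * k%:R^-1))).
- near=> k; have k0 : 0 < k%:R :> R by rewrite ltr0n; near: k; exact: nbhs_infty_gt.
  apply/andP; split; first by apply: Ex_ge0 => //; exact: bnds_bool.
  apply: le_trans (Chebyshev w_ge0 w_sum (bnds_distinct _) (mulr_gt0 e0 k0)) _.
  rewrite exprMn [leRHS](_ : _ = Ex (cl (a / p k)) (fun s => (distinct s)%:R) / (e ^+ 2 * k%:R ^+ 2)).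
    rewrite ler_wpM2r ?invr_ge0 ?mulr_ge0 ?sqr_ge0 ?(ltW e0)//; exact: (Var_distinct w_ge0 w_sum).
  by field; rewrite !gt_eqF.
- exact: cvg_cst.
- rewrite -[X in _ --> X](mulr0 (a `^ gamma * Gamma (1 - gamma))).
  apply: cvgM; first exact: mean_distinct_cvg.
  rewrite -[X in _ --> X](mulr0 (e ^+ 2)^-1); apply: cvgM; first exact: cvg_cst.
  by rewrite -cvg_shiftS; exact: cvg_harmonic.
Unshelve. all: by end_near. Qed.

Let crit_sub (a : R) : 0 < a < astar -> a `^ gamma * Gamma (1 - gamma) < 1.
Proof.
move=> /andP[a0 aa]; rewrite -ltr_pdivlMr ?GammaC_gt0// div1r -astar_powR.
by apply: gt0_ltr_powR; rewrite ?nnegrE ?(ltW a0) ?(ltW astar_gt0)//; case/andP: gamma01.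
Qed.

Let crit_sup (a : R) : astar < a -> 1 < a `^ gamma * Gamma (1 - gamma).
Proof.
move=> aa; rewrite -ltr_pdivrMr ?GammaC_gt0// div1r -astar_powR.
have a0 := lt_trans astar_gt0 aa.
by apply: gt0_ltr_powR; rewrite ?nnegrE ?(ltW a0) ?(ltW astar_gt0)//; case/andP: gamma01.
Qed.

Lemma rangeF_sub (a : R) : 0 < a < astar -> rangeF k (cl (a / p k)) @[k --> \oo] --> (0 : R).
Proof.
move=> /[dup] /crit_sub; set c := _ * Gamma _ => c1 /andP[a0 _].
pose e := (1 - c) / 2; have e0 : 0 < e by rewrite /e; lra.
apply: (@squeeze_cvgr _ _ _ _ (fun=> 0) _ _ _ _ _ (chebyshev_D a0 e0)); last exact: cvg_cst.
have h := mean_distinct_cvg a0; rewrite -/c in h.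
near=> k; have /andP[-> _] /= := rangeF01 k (cl (a / p k)).
have k0 : 0 < k%:R :> R by rewrite ltr0n; near: k; exact: nbhs_infty_gt.
have : Ex (cl (a / p k)) (fun s => (distinct s)%:R) / k%:R <= (c + 1) / 2.
  by near: k; apply: (cvgr_le _ h); lra.
rewrite ler_pdivrMr//; set E := Ex _ _ => hE.
apply: Ex_le => //; [exact: bnds_bool|exact: bnds_bool|move=> s _].
rewrite ler_nat; case: (leqP k (distinct s)) => // kd.
rewrite (_ : _ <= _)%R// (le_trans _ (ler_norm _))//.
have : k%:R <= (distinct s)%:R :> R by rewrite ler_nat.
by rewrite /e; lra.
Unshelve. all: by end_near. Qed.

(** Proved for the level [k.+1] at the scale of [p k], the form used for the masses; the level [k]
    follows by monotonicity. *)
Lemma rangeF_sup (a : R) : astar < a -> rangeF k.+1 (cl (a / p k)) @[k --> \oo] --> (1 : R).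
Proof.
move=> aa; have := crit_sup aa; have a0 := lt_trans astar_gt0 aa.
set c := _ * Gamma _ => c1.
pose e := (c - 1) / 2; have e0 : 0 < e by rewrite /e; lra.
have h0 := chebyshev_D a0 e0.
have h := mean_distinct_cvg a0; rewrite -/c in h.
apply: (@squeeze_cvgr _ _ _ _ (fun k => 1 - Ex (cl (a / p k)) (fun s => (e * k%:R <= `|(distinct s)%:R -
    Ex (cl (a / p k)) (fun s => (distinct s)%:R)|)%R%:R)) (fun=> 1)); last 2 first.
- by rewrite -[X in _ --> X]subr0; apply: cvgB => //; exact: cvg_cst.
- exact: cvg_cst.
near=> k; have /andP[_ ->] := rangeF01 k.+1 (cl (a / p k)); rewrite andbT.
have k0 : 0 < k%:R :> R by rewrite ltr0n; near: k; exact: nbhs_infty_gt.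
have : (c + 1) / 2 <= Ex (cl (a / p k)) (fun s => (distinct s)%:R) / k%:R.
  by near: k; apply: (cvgr_ge _ h); lra.
rewrite ler_pdivlMr//; set E := Ex _ (fun s => (distinct s)%:R) => hE.
rewrite -[X in X - _](Ex_cst w_ge0 w_sum (cl (a / p k))) -(ExB w_ge0 w_sum); last 2 first.
- exact: bnds_cst.
- exact: bnds_bool.
apply: Ex_le => //; [by apply: bndsB; [exact: bnds_cst|exact: bnds_bool]|exact: bnds_bool|move=> s _].
case: (ltnP k (distinct s)) => kd /=; first by rewrite gerBl.
have le1 : e * k%:R <= `|(distinct s)%:R - E|.
  rewrite -normrN (le_trans _ (ler_norm _))//.
  have : (distinct s)%:R <= k%:R :> R by rewrite ler_nat.
  by rewrite /e; lra.
by rewrite le1 subrr.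
Unshelve. all: by end_near. Qed.

Lemma rangeF_dom' : exists2 C : R, 0 <= C &
  \forall k \near \oo, forall m, rangeF k.+1 m <= C * (m%:R * p k) ^+ 2.
Proof.
have [C C0 hC] := rangeF_dom; exists C => //; near=> k => m.
by apply: le_trans (rangeF_S k m) _; move: m; near: k; exact: hC.
Unshelve. all: by end_near. Qed.

Lemma rangeF_sub' (a : R) : 0 < a < astar -> rangeF k.+1 (cl (a / p k)) @[k --> \oo] --> (0 : R).
Proof.
move=> /rangeF_sub h; apply: (@squeeze_cvgr _ _ _ _ (fun=> 0) _ _ _ _ _ h); last exact: cvg_cst.
apply: nearW => k; rewrite rangeF_S andbT.
by have /andP[] := rangeF01 k.+1 (cl (a / p k)).
Qed.

Lemma rangeF_sup' (a : R) : astar < a -> rangeF k (cl (a / p k)) @[k --> \oo] --> (1 : R).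
Proof.
move=> /rangeF_sup h; apply: (@squeeze_cvgr _ _ _ _ _ (fun=> 1) _ _ _ h); last exact: cvg_cst.
apply: nearW => k; rewrite rangeF_S /=.
by have /andP[] := rangeF01 k (cl (a / p k)).
Qed.

End RangeTails.

(** * Tails and masses *)

Section TailAsymptotics.
Context {R : realType}.
Local Notation cl x := `|Num.ceil x|%N.
Variables (p : nat -> R) (gamma : R).
Hypothesis gamma01 : 0 < gamma < 1.
Hypothesis p_gt0 : forall i, (1 <= i)%N -> 0 < p i.
Hypothesis p_noninc : forall i j, (1 <= i)%N -> (i <= j)%N -> p j <= p i.
Hypothesis p_sum : (\sum_(1 <= i <oo) (p i)%:E = 1)%E.
Hypothesis p_rv : regularly_varying p (- gamma^-1).
Local Notation w := (weight p).
Let w_ge0 := weight_ge0 p_gt0.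
Let w_sum := weight_sum p_gt0 p_sum.
Let p_cvg0 := weight_pos_cvg p_gt0 p_sum.
Local Notation Ex := (Ex w).
Local Notation F := (rangeF p).
Local Notation Q := (rangeQ p).
Local Notation astar := (astar gamma).

Lemma weighted_increments_cvg (G : nat -> nat -> R) (phi : nat -> R) k :
  (forall k m, 0 <= G k m <= 1) -> (forall k m, G k m <= G k m.+1) ->
  (forall m, 0 <= phi m) -> (forall m n, (0 < m)%N -> (m <= n)%N -> phi n <= phi m) ->
  cvgn (fun M => \sum_(0 <= m < M) phi m.+1 * (G k m.+1 - G k m)).
Proof.
move=> G01 Gm phi0 phin; apply: nondecreasing_is_cvgn.
  apply/nondecreasing_seqP => M; rewrite big_nat_recr//= lerDl mulr_ge0//.
  by rewrite subr_ge0.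
exists (phi 1%N) => _ [M _ <-].
apply: (@le_trans _ _ (\sum_(0 <= m < M) phi 1%N * (G k m.+1 - G k m))).
  by apply: ler_sum => m _; rewrite ler_wpM2r ?subr_ge0// phin.
rewrite -mulr_sumr telescope_sumr// -[leRHS]mulr1 ler_wpM2l//.
by have /andP[g0 _] := G01 k 0; have /andP[_ g1] := G01 k M; lra.
Qed.

(** The expectation of phi(tau_k), where tau_k is the first time at which k distinct values have
    been seen: the increment of [F k] from m to m + 1 is the probability of tau_k = m + 1. *)
Definition stieltjes (phi : nat -> R) k : R :=
  limn (fun M => \sum_(0 <= m < M) phi m.+1 * (F k m.+1 - F k m)).

Section Weighted.
Variables (phi : nat -> R) (kappa c0 : R).
Hypothesis kappa02 : 0 < kappa < 2.
Hypothesis phi_ge0 : forall m, 0 <= phi m.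
Hypothesis phi_noninc : forall m n, (0 < m)%N -> (m <= n)%N -> phi n <= phi m.
Hypothesis phi_cvg : m%:R `^ kappa * phi m @[m --> \oo] --> c0.

Lemma stieltjes_lim k :
  (fun M => \sum_(0 <= m < M) phi m.+1 * (F k m.+1 - F k m)) @ \oo --> stieltjes phi k.
Proof.
apply: (@weighted_increments_cvg F) => //.
- exact: rangeF01.
- exact: rangeF_mono.
Qed.

Lemma stieltjes_cvg : stieltjes phi k * p k `^ (- kappa) @[k --> \oo] --> c0 * astar `^ (- kappa).
Proof.
have [C C0 hC] := rangeF_dom gamma01 p_gt0 p_noninc p_sum p_rv.
apply: (hitting_cvg (phi := phi) p_gt0 p_cvg0 (astar_gt0 gamma01) (rangeF01 p_gt0 p_sum) _ C0 hC _ _ kappa02) => //.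
- exact: rangeF_mono.
- exact: rangeF_sub.
- exact: rangeF_sup'.
- exact: stieltjes_lim.
Qed.

Lemma stieltjes_cvg' : stieltjes phi k.+1 * p k `^ (- kappa) @[k --> \oo] --> c0 * astar `^ (- kappa).
Proof.
have [C C0 hC] := rangeF_dom' gamma01 p_gt0 p_noninc p_sum p_rv.
apply: (hitting_cvg (phi := phi) (G := fun k => F k.+1) p_gt0 p_cvg0 (astar_gt0 gamma01) _ _ C0 hC _ _ kappa02) => //.
- by move=> k m; exact: rangeF01.
- by move=> k m; exact: rangeF_mono.
- exact: rangeF_sub'.
- exact: rangeF_sup.
- by move=> k; exact: stieltjes_lim.
Qed.

End Weighted.

Local Notation sib := (sib gamma).
Local Notation r := (sibuya gamma).

Lemma half_ratio_cvg : (fun m => m%:R / (uphalf m)%:R : R) @ \oo --> (2 : R).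
Proof.
have hu : (fun m => uphalf m) @ \oo --> \oo.
  by apply/cvgnyPge => A; exists A.*2 => // m /= h; lia.
apply: (@squeeze_cvgr _ _ _ _ (fun m => 2 - ((uphalf m)%:R)^-1) (fun=> 2)).
- near=> m; have m0 : (0 < m)%N by near: m; exact: nbhs_infty_gt.
  have u0 : (0 < uphalf m)%N by lia.
  rewrite ler_pdivlMr ?ltr0n// ler_pdivrMr ?ltr0n// mulrBl mulVf ?pnatr_eq0 -?lt0n//.
  rewrite -natrM lerBlDr natr1 !ler_nat; apply/andP; split; lia.
- rewrite -[X in _ --> X]subr0; apply: cvgB; first exact: cvg_cst.
  have h : (fun n : nat => (n%:R : R)^-1) @ \oo --> (0 : R) by rewrite -cvg_shiftS; exact: cvg_harmonic.
  exact: (cvg_comp _ _ hu h).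
- exact: cvg_cst.
Unshelve. all: by end_near. Qed.

(** The weight attached to time m when only even times are summed. Since m / uphalf m tends to 2,
    the halved argument changes the constant by 2^gamma; this is the source of that factor in the
    undirected statements. *)
Lemma sib_half_cvg : m%:R `^ gamma * sib (uphalf m) @[m --> \oo] -->
  2 `^ gamma * (Gamma (1 - gamma))^-1.
Proof.
have hu : (fun m => uphalf m) @ \oo --> \oo.
  by apply/cvgnyPge => A; exists A.*2 => // m /= h; lia.
have h1 := cvg_comp _ _ hu (sib_asymp gamma01).
have h2 : (fun m => (m%:R / (uphalf m)%:R : R) `^ gamma) @ \oo --> (2 : R) `^ gamma.
  have c2 := @continuous_powR R gamma 2 (ltr0Sn _ _).
  exact: (cvg_comp _ _ half_ratio_cvg c2).
apply: cvg_trans (cvgM h2 h1); apply: near_eq_cvg; near=> m => /=.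
have m0 : (0 < m)%N by near: m; exact: nbhs_infty_gt.
have u0 : (0 < uphalf m)%N by lia.
rewrite mulrA -powRM ?divr_ge0// divfK// pnatr_eq0 -lt0n//.
Unshelve. all: by end_near. Qed.

Lemma abel_sib (u : nat -> R) M : u 0%N = 0 ->
  \sum_(1 <= l < M.+1) r l * u l =
  \sum_(0 <= m < M) sib m.+1 * (u m.+1 - u m) - sib M.+1 * u M.
Proof.
move=> u0; elim: M => [|M IH]; first by rewrite !big_geq// u0; ring.
by rewrite big_nat_recr// IH big_nat_recr//= (sibuya_diff gamma01)//; ring.
Qed.

Lemma sib_u_cvg0 (u : nat -> R) : (forall m, 0 <= u m <= 1) ->
  (fun M => sib M.+1 * u M) @ \oo --> (0 : R).
Proof.
move=> u01; have h := sib_cvg0 gamma01; rewrite -cvg_shiftS in h.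
apply: (@squeeze_cvgr _ _ _ _ (fun=> 0) _ _ _ _ _ h); last exact: cvg_cst.
apply: nearW => M; have /andP[u0 u1] := u01 M.
by rewrite mulr_ge0 ?(ltW (sib_gt0 gamma01 _))//= ler_piMr// ltW// sib_gt0.
Qed.

Lemma out_tail_series k : (0 < k)%N ->
  (fun M => \sum_(1 <= l < M) r l * F k l) @ \oo --> stieltjes sib k.
Proof.
move=> k0; rewrite -[stieltjes _ _]subr0 -cvg_shiftS (_ : (fun n => _) =
  (fun M => \sum_(0 <= m < M) sib m.+1 * (F k m.+1 - F k m) - sib M.+1 * F k M)); last first.
  by apply/funext => M; rewrite /= abel_sib ?rangeF_m0.
apply: cvgB.
  apply: stieltjes_lim => [m|m n m0]; [exact/ltW/sib_gt0|exact: sib_noninc].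
by apply: sib_u_cvg0 => m; exact: rangeF01.
Qed.

(** Times 2 l - 1 and 2 l have the same [uphalf], so summation by parts over even times is a
    Stieltjes sum over all times, with a weight constant on these pairs. *)
Lemma tail_series k : (0 < k)%N ->
  (fun M => \sum_(1 <= l < M) r l * F k (2 * l)%N) @ \oo --> stieltjes (fun m => sib (uphalf m)) k.
Proof.
move=> k0; rewrite -[stieltjes _ _]subr0 -cvg_shiftS (_ : (fun n => _) = (fun M => \sum_(0 <= m < M)
   sib m.+1 * (F k (2 * m.+1)%N - F k (2 * m)%N) - sib M.+1 * F k (2 * M)%N)); last first.
  by apply/funext => M; rewrite /= (@abel_sib (fun l => F k (2 * l)%N)) ?muln0 ?rangeF_m0.
apply: cvgB; last first.
  by apply: sib_u_cvg0 => m; exact: rangeF01.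
have h := @stieltjes_lim (fun m => sib (uphalf m)) _ _ k.
have {}h : (fun M => \sum_(0 <= m < M) sib (uphalf m.+1) * (F k m.+1 - F k m)) @ \oo -->
    stieltjes (fun m => sib (uphalf m)) k.
  apply: h => [m|m n m0 mn]; first exact/ltW/sib_gt0.
  by apply: sib_noninc => //; exact: uphalf_leq.
have h2 : (fun M => 2 * M)%N @ \oo --> \oo.
  by apply/cvgnyPge => A; exists A => // M /= h'; lia.
apply: cvg_trans (cvg_comp _ _ h2 h); apply: near_eq_cvg; apply: nearW => M /=.
elim: M => [|M IH]; first by rewrite !big_geq.
rewrite (_ : 2 * M.+1 = (2 * M).+2)%N; last by lia.
rewrite !big_nat_recr//= IH (_ : (2 * M)./2 = M); last by lia.
rewrite (_ : uphalf (2 * M) = M); last by lia.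
by rewrite (_ : 2 * M.+1 = (2 * M).+2)%N; [ring|lia].
Qed.

Let astarN : astar `^ (- gamma) = Gamma (1 - gamma).
Proof. by rewrite powRN astar_powR// invrK. Qed.

Lemma out_tail_asymp : stieltjes sib k / p k `^ gamma @[k --> \oo] --> (1 : R).
Proof.
have h := @stieltjes_cvg sib gamma (Gamma (1 - gamma))^-1.
have e : (Gamma (1 - gamma))^-1 * astar `^ (- gamma) = 1.
  by rewrite astarN mulVf// gt_eqF// GammaC_gt0.
rewrite -e; under eq_fun do rewrite -powRN; apply: h.
- by case/andP: gamma01 => g0 g1; apply/andP; split; lra.
- by move=> m; exact/ltW/sib_gt0.
- by move=> m n _; exact: sib_noninc.
- exact: sib_asymp.
Qed.

Lemma tail_asymp :
  stieltjes (fun m => sib (uphalf m)) k / (2 `^ gamma * p k `^ gamma) @[k --> \oo] --> (1 : R).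
Proof.
have h := @stieltjes_cvg (fun m => sib (uphalf m)) gamma (2 `^ gamma * (Gamma (1 - gamma))^-1).
have h2 : stieltjes (fun m => sib (uphalf m)) k * p k `^ (- gamma) @[k --> \oo] --> (2 : R) `^ gamma.
  have <- : 2 `^ gamma * (Gamma (1 - gamma))^-1 * astar `^ (- gamma) = 2 `^ gamma.
    by rewrite astarN divfK// gt_eqF// GammaC_gt0.
  apply: h.
  - by case/andP: gamma01 => g0 g1; apply/andP; split; lra.
  - by move=> m; exact/ltW/sib_gt0.
  - by move=> m n _ mn; apply: sib_noninc => //; exact: uphalf_leq.
  - exact: sib_half_cvg.
have e2 : (2 : R) `^ gamma != 0 by rewrite gt_eqF// powR_gt0.
have h3 : (fun k => (2 `^ gamma)^-1 * (stieltjes (fun m => sib (uphalf m)) k * p k `^ (- gamma))) @ \oo -->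
    ((2 : R) `^ gamma)^-1 * 2 `^ gamma by apply: cvgM h2; exact: cvg_cst.
rewrite mulVf// in h3; apply: cvg_trans h3; apply: near_eq_cvg; apply: nearW => k /=.
by rewrite invfM mulrCA -[(p _ `^ _)^-1]powRN.
Qed.

End TailAsymptotics.

(** * Unseen mass and the local limit *)

Section LocalLimit.
Context {R : realType}.
Local Notation cl x := `|Num.ceil x|%N.
Variables (p : nat -> R) (gamma : R).
Hypothesis gamma01 : 0 < gamma < 1.
Hypothesis p_gt0 : forall i, (1 <= i)%N -> 0 < p i.
Hypothesis p_noninc : forall i j, (1 <= i)%N -> (i <= j)%N -> p j <= p i.
Hypothesis p_sum : (\sum_(1 <= i <oo) (p i)%:E = 1)%E.
Hypothesis p_rv : regularly_varying p (- gamma^-1).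
Local Notation w := (weight p).
Let w_ge0 := weight_ge0 p_gt0.
Let w_sum := weight_sum p_gt0 p_sum.
Let p_cvg0 := weight_pos_cvg p_gt0 p_sum.
Local Notation Ex := (Ex w).
Local Notation F := (rangeF p).
Local Notation Q := (rangeQ p).
Local Notation astar := (astar gamma).
Local Notation U := (unseen w).

Let k_cvgy : (fun k : nat => k) @ \oo --> \oo. Proof. exact: cvg_id. Qed.

(** The limit of the mean unseen mass divided by k p_k after a / p_k samples. It decreases in a and
    equals gamma / astar at the critical value. *)
Definition unseen_rate (a : R) : R := a `^ (gamma - 1) * (gamma * Gamma (1 - gamma)).
Local Notation v := unseen_rate.

Let w01 x : 0 <= w x <= 1. Proof. by rewrite w_ge0 (w_le1 w_ge0 w_sum). Qed.

Let pk_gt0 : \forall k \near \oo, 0 < p k.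
Proof. near=> k; apply: p_gt0; near: k; exact: nbhs_infty_gt. Unshelve. all: by end_near. Qed.

Let m_gt0 (a : R) : 0 < a -> \forall k \near \oo, (0 < cl (a / p k))%N.
Proof.
move=> a0; near=> k; apply: cl_gt0; rewrite divr_gt0//; near: k; exact: pk_gt0.
Unshelve. all: by end_near. Qed.

Lemma mean_unseen_cvg (a : R) : 0 < a ->
  Ex (cl (a / p k)) U / (k%:R * p k) @[k --> \oo] --> v a.
Proof.
move=> a0; have mp := scale_cvg p_gt0 p_cvg0 a0.
have h : (fun k => (cl (a / p k))%:R * Ex (cl (a / p k)) U / k%:R) @ \oo --> a `^ gamma * (gamma * Gamma (1%:R - gamma)).
  apply: (karlin_pois gamma01 p_gt0 p_noninc p_sum p_rv k_cvgy a0 mp (l := 1) (c := 0)) => // n.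
  rewrite (_ : series _ = (fun M => (cl (a / p n))%:R * series (fun x => w x * (1 - w x) ^+ cl (a / p n)) M)).
    by apply: cvgM; [exact: cvg_cst|exact: Ex_unseen_cvg].
  apply/funext => M; rewrite /series /= mulr_sumr; apply: eq_bigr => x _.
  by rewrite subn0 expr1 mulrA.
have h2 : (fun k => (cl (a / p k))%:R * Ex (cl (a / p k)) U / k%:R * ((cl (a / p k))%:R * p k)^-1) @ \oo -->
    a `^ gamma * (gamma * Gamma (1%:R - gamma)) / a.
  by apply: (cvgM h); apply: cvgV mp; rewrite gt_eqF.
rewrite (_ : v a = a `^ gamma * (gamma * Gamma (1%:R - gamma)) / a); last first.
  rewrite /v powRD; last by apply/implyP => _; rewrite gt_eqF.
  by rewrite powRN powRr1 ?(ltW a0)//; ring.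
apply: cvg_trans h2; apply: near_eq_cvg; near=> k => /=.
have pk : 0 < p k by near: k; exact: pk_gt0.
have mk : (0 < cl (a / p k))%N by near: k; exact: m_gt0.
have kk : (0 < k)%N by near: k; exact: nbhs_infty_gt.
by field; rewrite !gt_eqF ?ltr0n.
Unshelve. all: by end_near. Qed.

(** By the Efron-Stein bound the variance is m^(-2) times a Poisson-like sum with l = 3, hence of
    order k / m^2, that is k p_k^2. Relative to (k p_k)^2 this is of order 1 / k. *)
Lemma Var_unseen_cvg (a : R) : 0 < a ->
  Var w (cl (a / p k)) U / (k%:R * p k) ^+ 2 @[k --> \oo] --> (0 : R).
Proof.
move=> a0; have mp := scale_cvg p_gt0 p_cvg0 a0.
pose f n x := (w x * ((cl (a / p n))%:R ^+ 3 * w x ^+ 2 * (1 - w x) ^+ (cl (a / p n) - 1))) : R.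
have fc n : cvgn (series (f n)).
  apply: (avg_cvg w_ge0 w_sum); exists ((cl (a / p n))%:R ^+ 3) => x.
  have /andP[x0 x1] := w01 x.
  rewrite ger0_norm ?mulr_ge0 ?exprn_ge0 ?subr_ge0// -mulrA ler_piMr ?exprn_ge0//.
  by rewrite mulr_ile1 ?exprn_ge0 ?exprn_ile1 ?subr_ge0// gerBl.
pose s n := limn (series (f n)).
have hs : s n / n%:R @[n --> \oo] --> a `^ gamma * (gamma * Gamma (3%:R - gamma)).
  apply: (karlin_pois gamma01 p_gt0 p_noninc p_sum p_rv k_cvgy a0 mp (l := 3) (c := 1)) => // n.
  suff -> : (fun x => ((cl (a / p n))%:R * w x) ^+ 3 * (1 - w x) ^+ (cl (a / p n) - 1)) = f n by exact: fc.
  by apply/funext => x; rewrite /f; ring.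
have h : (fun k => (s k / k%:R) * ((k%:R)^-1 * (((cl (a / p k))%:R * p k)^-1 ^+ 2))) @ \oo --> (0 : R).
  rewrite -[X in _ --> X](mulr0 (a `^ gamma * (gamma * Gamma (3%:R - gamma)))).
  apply: cvgM => //; rewrite -[X in _ --> X](mul0r (a^-1 ^+ 2)); apply: cvgM.
    by rewrite -cvg_shiftS; exact: cvg_harmonic.
  have c : (fun k => ((cl (a / p k))%:R * p k)^-1) @ \oo --> a^-1 by apply: cvgV mp; rewrite gt_eqF.
  rewrite expr2 (_ : (fun k => _) = (fun k => ((cl (a / p k))%:R * p k)^-1 * ((cl (a / p k))%:R * p k)^-1)).
    exact: (cvgM c c).
  by apply/funext => k; rewrite expr2.
apply: (@squeeze_cvgr _ _ _ _ (fun=> 0) _ _ _ _ _ h); last exact: cvg_cst.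
near=> k.
have pk : 0 < p k by near: k; exact: pk_gt0.
have mk : (0 < cl (a / p k))%N by near: k; exact: m_gt0.
have kk : (0 < k)%N by near: k; exact: nbhs_infty_gt.
apply/andP; split.
  rewrite divr_ge0 ?sqr_ge0//; apply: (Var_ge0 w_ge0 w_sum); exact: bnds_unseen.
rewrite [leRHS](_ : _ = (s k / (cl (a / p k))%:R ^+ 2) / (k%:R * p k) ^+ 2); last first.
  by field; rewrite !gt_eqF ?ltr0n.
rewrite ler_wpM2r ?invr_ge0 ?sqr_ge0//.
apply: (Var_unseen w_ge0 w_sum) => M.
rewrite ler_pdivlMr ?exprn_gt0 ?ltr0n//.
apply: le_trans (_ : _ <= series (f k) M) _.
  rewrite mulr_suml; apply: ler_sum => x _; rewrite /f subn1.
  by rewrite le_eqVlt; apply/orP; left; apply/eqP; ring.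
apply: nondecreasing_cvgn_le => //; apply/nondecreasing_seqP => i.
rewrite /series /= big_nat_recr//= lerDl /f; have /andP[x0 x1] := w01 i.
by rewrite !mulr_ge0 ?exprn_ge0 ?subr_ge0.
Unshelve. all: by end_near. Qed.

Let unseen_dev (a e : R) : 0 < a -> 0 < e ->
  Ex (cl (a / p k)) (fun s => (e * (k%:R * p k) <= `|U s - Ex (cl (a / p k)) U|)%R%:R)
    @[k --> \oo] --> (0 : R).
Proof.
move=> a0 e0.
have h : (fun k => Var w (cl (a / p k)) U / (k%:R * p k) ^+ 2 * (e ^+ 2)^-1) @ \oo --> 0 * (e ^+ 2)^-1.
  by apply: (cvgM (Var_unseen_cvg a0)); exact: cvg_cst.
rewrite mul0r in h.
apply: (@squeeze_cvgr _ _ _ _ (fun=> 0) _ _ _ _ _ h); last exact: cvg_cst.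
near=> k.
have pk : 0 < p k by near: k; exact: pk_gt0.
have kk : (0 < k)%N by near: k; exact: nbhs_infty_gt.
have kp : 0 < k%:R * p k by rewrite mulr_gt0 ?ltr0n.
apply/andP; split; first by apply: Ex_ge0 => //; exact: bnds_bool.
apply: le_trans (Chebyshev w_ge0 w_sum (bnds_unseen w_ge0 w_sum _) (mulr_gt0 e0 kp)) _.
by rewrite [leRHS](_ : _ = Var w (cl (a / p k)) U / (e * (k%:R * p k)) ^+ 2)//; field; rewrite !gt_eqF ?ltr0n.
Unshelve. all: by end_near. Qed.

Lemma unseen_upper (a c : R) : 0 < a -> v a < c ->
  Ex (cl (a / p k)) (fun s => (c * (k%:R * p k) <= U s)%R%:R) @[k --> \oo] --> (0 : R).
Proof.
move=> a0 vc; pose e := (c - v a) / 2; have e0 : 0 < e by rewrite /e; lra.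
apply: (@squeeze_cvgr _ _ _ _ (fun=> 0) _ _ _ _ _ (unseen_dev a0 e0)); last exact: cvg_cst.
have h := mean_unseen_cvg a0; near=> k.
have pk : 0 < p k by near: k; exact: pk_gt0.
have kk : (0 < k)%N by near: k; exact: nbhs_infty_gt.
have kp : 0 < k%:R * p k by rewrite mulr_gt0 ?ltr0n.
have : Ex (cl (a / p k)) U / (k%:R * p k) <= v a + e by near: k; apply: (cvgr_le _ h); lra.
rewrite ler_pdivrMr//; set E := Ex _ U => hE.
apply/andP; split; first by apply: Ex_ge0 => //; exact: bnds_bool.
apply: Ex_le => //; [exact: bnds_bool|exact: bnds_bool|move=> s _].
case: (leP (c * _) _) => // hc; rewrite (_ : _ <= _)%R// (le_trans _ (ler_norm _))//.
move: hE hc; rewrite /e; set y := k%:R * p k; nra.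
Unshelve. all: by end_near. Qed.

Lemma unseen_lower (a c : R) : 0 < a -> c < v a ->
  Ex (cl (a / p k)) (fun s => (U s <= c * (k%:R * p k))%R%:R) @[k --> \oo] --> (0 : R).
Proof.
move=> a0 vc; pose e := (v a - c) / 2; have e0 : 0 < e by rewrite /e; lra.
apply: (@squeeze_cvgr _ _ _ _ (fun=> 0) _ _ _ _ _ (unseen_dev a0 e0)); last exact: cvg_cst.
have h := mean_unseen_cvg a0; near=> k.
have pk : 0 < p k by near: k; exact: pk_gt0.
have kk : (0 < k)%N by near: k; exact: nbhs_infty_gt.
have kp : 0 < k%:R * p k by rewrite mulr_gt0 ?ltr0n.
have : v a - e <= Ex (cl (a / p k)) U / (k%:R * p k) by near: k; apply: (cvgr_ge _ h); lra.
rewrite ler_pdivlMr//; set E := Ex _ U => hE.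
apply/andP; split; first by apply: Ex_ge0 => //; exact: bnds_bool.
apply: Ex_le => //; [exact: bnds_bool|exact: bnds_bool|move=> s _].
case: (leP (U s) _) => // hc; rewrite (_ : _ <= _)%R// -normrN (le_trans _ (ler_norm _))//.
move: hE hc; rewrite /e; set y := k%:R * p k; nra.
Unshelve. all: by end_near. Qed.

Lemma rangeF_increment k m : F k.+1 m.+1 - F k.+1 m = Ex m (fun s => U s * (distinct s == k)%:R).
Proof.
transitivity (Ex m (fun s => U s * ((distinct s == k) && predT s)%:R)); last first.
  by apply: eq_Ex => s _; rewrite andbT.
rewrite -(Ex_new w_ge0 w_sum) {2}/rangeF -(@Ex_take _ _ w_ge0 w_sum m m.+1)// -(ExB w_ge0 w_sum); [|exact: bnds_bool..].
apply: eq_Ex => s sm.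
case: (lastP s) sm => // s' x; rewrite size_rcons => -[<-].
rewrite -cats1 take_size_cat// cats1 distinct_rcons andbT.
case: (x \in s') => /=; rewrite ?add0n.
  by rewrite subrr; case: eqP => //= ->; rewrite eqn_leq ltnn andbF.
rewrite add1n eqSS andbb !ltnS; case: (ltngtP k (distinct s')) => h /=; rewrite ?subrr ?subr0//.
Qed.

End LocalLimit.

Section LocalLimit.
Context {R : realType}.
Local Notation cl x := `|Num.ceil x|%N.
Variables (p : nat -> R) (gamma : R).
Hypothesis gamma01 : 0 < gamma < 1.
Hypothesis p_gt0 : forall i, (1 <= i)%N -> 0 < p i.
Hypothesis p_noninc : forall i j, (1 <= i)%N -> (i <= j)%N -> p j <= p i.
Hypothesis p_sum : (\sum_(1 <= i <oo) (p i)%:E = 1)%E.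
Hypothesis p_rv : regularly_varying p (- gamma^-1).
Local Notation w := (weight p).
Let w_ge0 := weight_ge0 p_gt0.
Let w_sum := weight_sum p_gt0 p_sum.
Let p_cvg0 := weight_pos_cvg p_gt0 p_sum.
Local Notation Ex := (Ex w).
Local Notation F := (rangeF p).
Local Notation Q := (rangeQ p).
Local Notation astar := (astar gamma).
Local Notation U := (unseen w).
Local Notation v := (unseen_rate gamma).

Let U_ge0 s : 0 <= U s.
Proof. exact: unseen_ge0. Qed.

Let rate_astar : v astar = gamma / astar.
Proof.
rewrite /v powRD; last by apply/implyP => _; rewrite gt_eqF ?astar_gt0.
rewrite astar_powR// powRN powRr1 ?ltW ?astar_gt0//.
by field; rewrite !gt_eqF ?astar_gt0 ?GammaC_gt0.
Qed.

Let rate_cont : {for astar, continuous v}.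
Proof.
rewrite /v; apply: continuousM; last exact: cvg_cst.
exact/continuous_powR/astar_gt0.
Qed.

Definition atypical (c1 c2 : R) k : pred (seq nat) :=
  fun s => (U s <= c1 * (k%:R * p k)) || (c2 * (k%:R * p k) <= U s).

(** The part of the increment of [F k.+1] at step m contributed by lists whose unseen mass lies
    outside the window. *)
Definition atypical_increment c1 c2 k m : R :=
  Ex m (fun s => U s * ((distinct s == k) && atypical c1 c2 k s)%:R).
Local Notation d := atypical_increment.

Let bnds_U m : bnds m U.
Proof. exact: bnds_unseen. Qed.

Lemma atypical_increment01 c1 c2 k m : 0 <= d c1 c2 k m <= F k.+1 m.+1 - F k.+1 m.
Proof.
rewrite rangeF_increment//; apply/andP; split.
  by apply: Ex_ge0 => // [|s _]; [apply: bndsM => //; exact: bnds_bool|rewrite mulr_ge0].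
apply: Ex_le => //; [by apply: bndsM => //; exact: bnds_bool..|move=> s _].
by rewrite ler_wpM2l// ler_nat; case: (_ == _) => //=; case: atypical.
Qed.

(** The level is left at most once, at some random step m, so the sum is a probability. If the
    unseen mass is then too large, either m >= m1 and it was already too large at m1, or the level
    was left by time m1. If it is too small, either m <= m2 and it is still too small at m2, or the
    level is not yet left at m2. Fixed times thus control the random one. *)
Lemma sum_atypical c1 c2 k m1 m2 M :
  \sum_(0 <= m < M) d c1 c2 k m <=
    Ex m1 (fun s => (c2 * (k%:R * p k) <= U s)%R%:R) + F k.+1 m1 +
    (Ex m2 (fun s => (U s <= c1 * (k%:R * p k))%R%:R) + (1 - F k.+1 m2)).
Proof.
set N := maxn M (maxn m1 m2).
have NM : (M <= N)%N by exact: leq_maxl.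
have N1 : (m1 <= N)%N by rewrite /N !leq_max leqnn orbT.
have N2 : (m2 <= N)%N by rewrite /N !leq_max leqnn !orbT.
(* The event that the range passes from k to k + 1 between times m and m + 1, with atypical unseen
   mass at time m. *)
pose g m s := [&& distinct (take m s) == k, distinct (take m.+1 s) == k.+1 & atypical c1 c2 k (take m s)].
rewrite -(@Ex_take _ _ w_ge0 w_sum m1 N)// {1}/rangeF -(@Ex_take _ _ w_ge0 w_sum m1 N _ N1).
rewrite -(@Ex_take _ _ w_ge0 w_sum m2 N)// /rangeF -(@Ex_take _ _ w_ge0 w_sum m2 N _ N2).
rewrite [leRHS](_ : _ = Ex N (fun s => (c2 * (k%:R * p k) <= U (take m1 s))%R%:R + (k < distinct (take m1 s))%:R +
  ((U (take m2 s) <= c1 * (k%:R * p k))%R%:R + (1 - (k < distinct (take m2 s))%:R)))); last first.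
  rewrite !(ExD w_ge0 w_sum) ?(ExN w_ge0 w_sum) ?(Ex_cst w_ge0 w_sum)//.
  all: do ?[apply: bndsN|apply: bndsD|exact: bnds_bool|exact: bnds_cst].
rewrite [leLHS](_ : _ = Ex N (fun s => \sum_(0 <= m < M) (g m s)%:R)); last first.
  rewrite (Ex_sum w_ge0 w_sum); last by move=> m; exact: bnds_bool.
  apply: eq_big_nat => m mM; rewrite /d -(Ex_new w_ge0 w_sum).
  rewrite -(@Ex_take _ _ w_ge0 w_sum m.+1 N); last by lia.
  by apply: eq_Ex => s _; rewrite /g take_takel//.
apply: Ex_le => //.
- by apply: bnds_sum => m; exact: bnds_bool.
- by do ?[apply: bndsN|apply: bndsD|exact: bnds_bool|exact: bnds_cst].
move=> s _.
have nn (b : bool) : 0 <= 1 - b%:R :> R by case: b; rewrite ?subrr ?subr0.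
have [/hasP[m /=]|/hasPn h] := boolP (has (g^~ s) (iota 0 M)); last first.
  rewrite big1_seq => [|m /andP[_ hm]]; last first.
    by rewrite (negbTE (h m _))//; move: hm; rewrite /index_iota subn0.
  by do ?[exact: nn|exact: ler0n|apply: addr_ge0].
rewrite mem_iota add0n => /andP[_ mM] gm.
have uniqm m' : g m' s -> m' = m.
  move: gm => /and3P[/eqP a1 /eqP a2 _] /and3P[/eqP b1 /eqP b2 _].
  have := @distinct_take m.+1 m' s; have := @distinct_take m'.+1 m s.
  by rewrite a1 a2 b1 b2; lia.
have -> : \sum_(0 <= m < M) (g m s)%:R = 1 :> R.
  rewrite (bigD1_seq m) ?mem_index_iota ?iota_uniq//= gm big1 ?addr0// => m' m'm.
  by case: (boolP (g m' s)) => // /uniqm e; rewrite e eqxx in m'm.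
case/and3P: gm => /eqP a1 /eqP a2.
case/orP => hU.
  case: (leqP m m2) => mm2.
    have hb : U (take m2 s) <= c1 * (k%:R * p k) by apply: le_trans hU; exact: unseen_take.
    by rewrite hb addrCA lerDl; do ?[exact: nn|exact: ler0n|apply: addr_ge0].
  have : (distinct (take m2 s) <= k)%N by rewrite -a1; apply: distinct_take; exact: ltnW.
  by rewrite leqNgt => /negbTE ->; rewrite subr0 [leRHS]addrA lerDr; do ?[exact: nn|exact: ler0n|apply: addr_ge0].
case: (leqP m1 m) => mm1.
  have hb : c2 * (k%:R * p k) <= U (take m1 s) by apply: le_trans hU _; exact: unseen_take.
  by rewrite hb -addrA lerDl; do ?[exact: nn|exact: ler0n|apply: addr_ge0].
have : (k < distinct (take m1 s))%N by rewrite -a2; exact: distinct_take.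
by move=> ->; rewrite addrAC lerDr; do ?[exact: nn|exact: ler0n|apply: addr_ge0].
Qed.

Variables (b : nat -> R) (beta : R).
Hypothesis b_ge0 : forall m, 0 <= b m.
Hypothesis b_noninc : forall m n, (m <= n)%N -> b n <= b m.
Hypothesis b_cvg : m%:R `^ (1 + gamma) * b m @[m --> \oo] --> beta.

(** The masses weigh the state at time m by [b m], whereas a Stieltjes sum weighs the step from m to
    m + 1 by [phi m.+1]; the shift reconciles the two conventions. *)
Let phi m := b m.-1.
Let kappa02 : 0 < 1 + gamma < 2.
Proof. by case/andP: gamma01 => g0 g1; apply/andP; split; lra. Qed.

Let phi_ge0 m : 0 <= phi m.
Proof. exact: b_ge0. Qed.

Let phi_noninc m n : (0 < m)%N -> (m <= n)%N -> phi n <= phi m.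
Proof. by move=> m0 mn; apply: b_noninc; lia. Qed.

Let phi_cvg : m%:R `^ (1 + gamma) * phi m @[m --> \oo] --> beta.
Proof.
rewrite -[beta]mul1r -cvg_shiftS.
have h : (fun n => ((n.+1%:R / n%:R : R) `^ (1 + gamma)) * (n%:R `^ (1 + gamma) * b n)) @ \oo --> 1 * beta.
  apply: cvgM => //.
  have c := @continuous_powR R (1 + gamma) 1 ltr01.
  suff u : (fun n => n.+1%:R / n%:R : R) @ \oo --> (1 : R) by have := cvg_comp _ _ u c; rewrite powR1.
  have h0 : (fun n : nat => 1 + (n%:R : R)^-1) @ \oo --> (1 + 0 : R).
    apply: cvgD; first exact: cvg_cst.
    by rewrite -cvg_shiftS; exact: cvg_harmonic.
  rewrite addr0 in h0; apply: cvg_trans h0; apply: near_eq_cvg; near=> n.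
  have n0 : (0 < n)%N by near: n; exact: nbhs_infty_gt.
  by rewrite -natr1 mulrDl mul1r mulfV// pnatr_eq0 -lt0n.
apply: cvg_trans h; apply: near_eq_cvg; near=> n.
have n0 : (0 < n)%N by near: n; exact: nbhs_infty_gt.
by rewrite mulrA -powRM ?divr_ge0// divfK// pnatr_eq0 -lt0n.
Unshelve. all: by end_near. Qed.

(** By continuity of the rate there are a1 < astar < a2 with rates still inside the window on the
    relevant side. At these two times each of the four probabilities in [sum_atypical] vanishes. *)
Lemma atypical_negligible (c1 c2 e : R) : c1 < gamma / astar < c2 -> 0 < e ->
  \forall k \near \oo, forall M,
    \sum_(0 <= m < M) b m * d c1 c2 k m <= e * p k `^ (1 + gamma).
Proof.
move=> /andP[h1 h2] e0.
have [C C0 hC] := rangeF_dom' gamma01 p_gt0 p_noninc p_sum p_rv.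
have as0 := astar_gt0 gamma01.
have [a1 /andP[a10 a1s] va1] : exists2 a1, 0 < a1 < astar & v a1 < c2.
  have h := cvg_at_left_filter rate_cont; rewrite rate_astar in h.
  near (astar^'-) => a1; exists a1.
    apply/andP; split; first by near: a1; exact: nbhs_left_gt.
    by near: a1; exact: nbhs_left_lt.
  by near: a1; exact: (cvgr_lt _ h).
have [a2 a2s va2] : exists2 a2, astar < a2 & c1 < v a2.
  have h := cvg_at_right_filter rate_cont; rewrite rate_astar in h.
  near (astar^'+) => a2; exists a2; first by near: a2; exact: nbhs_right_gt.
  by near: a2; exact: (cvgr_gt _ h).
have := @hitting_negligible _ p (fun k => F k.+1) C p_gt0 p_cvg0 _ _ C0 hC phi (1 + gamma) beta kappa02 _ phi_noninc phi_cvg (d c1 c2)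
 (fun k => Ex (cl (a1 / p k)) (fun s => (c2 * (k%:R * p k) <= U s)%R%:R) + F k.+1 (cl (a1 / p k)) +
    (Ex (cl (a2 / p k)) (fun s => (U s <= c1 * (k%:R * p k))%R%:R) + (1 - F k.+1 (cl (a2 / p k))))) e.
apply => //.
- by move=> k m; exact: rangeF01.
- by move=> k m; exact: rangeF_mono.
- by move=> k m; exact: atypical_increment01.
- by apply: nearW => k M; exact: sum_atypical.
rewrite -[X in _ --> X](_ : 0 + 0 + (0 + (1 - 1)) = 0); last by ring.
apply: cvgD; apply: cvgD.
- exact: (unseen_upper gamma01).
- by apply: (rangeF_sub' gamma01) => //; rewrite a10.
- by apply: (unseen_lower gamma01) => //; exact: (lt_trans as0 a2s).
- by apply: cvgB; [exact: cvg_cst|exact: (rangeF_sup gamma01)].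
Unshelve. all: by end_near. Qed.

Section Sandwich.
Variables (c1 c2 c3 : R) (k : nat).
Hypothesis c1_gt0 : 0 < c1.
Hypothesis c2_gt0 : 0 < c2.
Hypothesis c3_gt0 : 0 < c3.
Hypothesis kp_gt0 : 0 < k%:R * p k.
Hypothesis tail_ge : c3 * (k%:R * p k) <= tailmass w k.+1.
Local Notation A M := (\sum_(0 <= m < M) b m * (F k.+1 m.+1 - F k.+1 m)).
Local Notation B M := (\sum_(0 <= m < M) b m * d c1 c2 k m).
Local Notation S M := (\sum_(0 <= m < M) b m * Q k m).

(** On {R_m = k}, k p_k is at most U / c1 for typical lists. For atypical ones the deterministic
    bound still gives U / c3, so that their contribution is controlled by the atypical
    increments. *)
Lemma local_sum_le M : S M * (k%:R * p k) <= A M / c1 + B M / c3.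
Proof.
rewrite !mulr_suml -big_split /=; apply: ler_sum => m _.
rewrite -!mulrA -mulrDr ler_wpM2l// rangeF_increment// /d /rangeQ.
rewrite mulrC [X in _ <= X + _]mulrC [X in _ <= _ + X]mulrC.
have bd : bnds m (fun s => U s * (distinct s == k)%:R) by apply: bndsM => //; exact: bnds_bool.
have bd' : bnds m (fun s => U s * ((distinct s == k) && atypical c1 c2 k s)%:R).
  by apply: bndsM => //; exact: bnds_bool.
rewrite -!(ExZ w_ge0 w_sum)//; last exact: bnds_bool.
rewrite -(ExD w_ge0 w_sum); [|by apply: bndsM => //; exact: bnds_cst..].
apply: Ex_le => //; [by apply: bndsM; [exact: bnds_cst|exact: bnds_bool]|
  by apply: bndsD; apply: bndsM => //; exact: bnds_cst|move=> s _].
case: eqP => [Ds|_] /=; last by rewrite !mulr0 addr0.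
rewrite !mulr1; have [/= _|] := boolP (atypical c1 c2 k s).
  rewrite !mulr1; apply: (@le_trans _ _ (c3^-1 * U s)).
    rewrite [leRHS]mulrC ler_pdivlMr// mulrC (le_trans tail_ge)// -Ds.
    by apply: unseen_ge_tailmass => //; exact: weight_noninc.
  by rewrite lerDr mulr_ge0// invr_ge0 ltW.
rewrite negb_or -!ltNge => /andP[h _] /=.
by rewrite !mulr0 addr0 [leRHS]mulrC ler_pdivlMr// mulrC ltW.
Qed.

(** Removing the atypical part leaves lists with U < c2 k p_k, on which the increment is at most c2
    k p_k times the probability of R_m = k. *)
Lemma local_sum_ge M : A M - B M <= S M * (c2 * (k%:R * p k)).
Proof.
rewrite mulr_suml -sumrB; apply: ler_sum => m _.
rewrite -mulrBr -mulrA ler_wpM2l// rangeF_increment// /d /rangeQ [leRHS]mulrC.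
have bd : bnds m (fun s => U s * (distinct s == k)%:R) by apply: bndsM => //; exact: bnds_bool.
have bd' : bnds m (fun s => U s * ((distinct s == k) && atypical c1 c2 k s)%:R).
  by apply: bndsM => //; exact: bnds_bool.
rewrite -(ExB w_ge0 w_sum)// -(ExZ w_ge0 w_sum); last exact: bnds_bool.
apply: Ex_le => //; [exact: bndsB|by apply: bndsM; [exact: bnds_cst|exact: bnds_bool]|move=> s _].
case: eqP => [Ds|_] /=; last by rewrite !mulr0 subr0.
rewrite !mulr1; have [/= _|] := boolP (atypical c1 c2 k s).
  by rewrite mulr1 subrr mulr_ge0// ltW.
rewrite negb_or -!ltNge => /andP[_ h] /=.
by rewrite mulr0 subr0 ltW.
Qed.

End Sandwich.

(** The Stieltjes sum of index 1 + gamma at level k + 1 divided by the unseen mass v0 k p_k. The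
    window of typical values shrinks to v0 from below for the upper bound and from above for the
    lower one. *)
Lemma local_limit (L : nat -> R) :
  (forall k, (0 < k)%N -> (fun M => \sum_(0 <= m < M) b m * Q k m) @ \oo --> L k) ->
  L k / (p k `^ gamma / k%:R) @[k --> \oo] --> beta / gamma * Gamma (1 - gamma).
Proof.
move=> hL; have as0 := astar_gt0 gamma01.
case/andP: (gamma01) => g0 g1.
set al := beta * astar `^ (- (1 + gamma)).
set v0 := gamma / astar; have v00 : 0 < v0 by rewrite divr_gt0.
have -> : beta / gamma * Gamma (1 - gamma) = al / v0.
  rewrite /al /v0 -[Gamma _]invrK -astar_powR// powRN powRD; last by apply/implyP => _; rewrite gt_eqF.
  rewrite powRr1 ?(ltW as0)//; field; rewrite !gt_eqF//.
  by rewrite powR_gt0.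
pose A k := stieltjes p phi k.+1.
have hA k : (fun M => \sum_(0 <= m < M) b m * (F k.+1 m.+1 - F k.+1 m)) @ \oo --> A k.
  exact: (stieltjes_lim p_gt0 p_sum phi_ge0 phi_noninc).
have cA : A k * p k `^ (- (1 + gamma)) @[k --> \oo] --> al.
  exact: (stieltjes_cvg' gamma01 p_gt0 p_noninc p_sum p_rv kappa02 phi_ge0 phi_noninc phi_cvg).
have [c3 c30 hc3] := tailmass_ge p_gt0 p_noninc p_sum p_rv.
have scaleE k : (0 < k)%N -> 0 < p k ->
    L k / (p k `^ gamma / k%:R) = (L k * (k%:R * p k)) * p k `^ (- (1 + gamma)).
  move=> k0 pk; rewrite powRN powRD; last by apply/implyP => _; rewrite gt_eqF.
  by rewrite powRr1 ?(ltW pk)//; field; rewrite !gt_eqF ?powR_gt0 ?ltr0n.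
have powpE k : 0 < p k -> p k `^ (1 + gamma) * p k `^ (- (1 + gamma)) = 1.
  by move=> pk; rewrite powRN mulfV// gt_eqF// powR_gt0.
have upper y : al / v0 < y -> \forall k \near \oo, L k / (p k `^ gamma / k%:R) <= y.
  move=> hy; have [c1 /andP[c10 c1v] hc1] : exists2 c1, 0 < c1 < v0 & al / c1 < (al / v0 + y) / 2.
    have h : al / c @[c --> v0^'-] --> al / v0.
      apply: cvg_at_left_filter; apply: cvgM; [exact: cvg_cst|apply: cvgV; [by rewrite gt_eqF|exact: cvg_id]].
    near (v0^'-) => c1; exists c1.
      apply/andP; split; first by near: c1; exact: nbhs_left_gt.
      by near: c1; exact: nbhs_left_lt.
    by near: c1; apply: (cvgr_lt _ h); lra.
  set z := (al / v0 + y) / 2 in hc1; have zy : z < y by rewrite /z; lra.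
  (* After division by [c3] the atypical part uses half of the gap between z and y. *)
  pose e := (y - z) / 2 * c3; have e0 : 0 < e by rewrite mulr_gt0// divr_gt0// subr_gt0.
  (* Only the lower edge of the window enters the upper bound, so any upper edge above v0 will
     do. *)
  have c1v2 : c1 < v0 < v0 + 1 by rewrite c1v ltrDl ltr01.
  have hB := atypical_negligible c1v2 e0.
  have hA1 : (fun k => A k * p k `^ (- (1 + gamma)) / c1) @ \oo --> al / c1.
    by apply: (cvgM cA); exact: cvg_cst.
  near=> k.
  have pk : 0 < p k by apply: p_gt0; near: k; exact: nbhs_infty_gt.
  have k0 : (0 < k)%N by near: k; exact: nbhs_infty_gt.
  have kp : 0 < k%:R * p k by rewrite mulr_gt0 ?ltr0n.
  have tk : c3 * (k%:R * p k) <= tailmass w k.+1 by near: k; exact: hc3.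
  have Bk M : \sum_(0 <= m < M) b m * d c1 (v0 + 1) k m <= e * p k `^ (1 + gamma).
    by move: M; near: k; exact: hB.
  have h : L k * (k%:R * p k) <= A k / c1 + e * p k `^ (1 + gamma) / c3.
    apply: (@ler_cvg_to _ \oo _ _ (fun M => (\sum_(0 <= m < M) b m * Q k m) * (k%:R * p k))
       (fun M => (\sum_(0 <= m < M) b m * (F k.+1 m.+1 - F k.+1 m)) / c1 + e * p k `^ (1 + gamma) / c3)).
    - by apply: (cvgM (hL _ k0)); exact: cvg_cst.
    - by apply: cvgD; [apply: cvgM; [exact: hA|exact: cvg_cst]|exact: cvg_cst].
    - apply: nearW => M.
      apply: le_trans (local_sum_le (v0 + 1) c10 c30 tk M) _.
      by rewrite lerD2l ler_wpM2r// invr_ge0 ltW.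
  rewrite scaleE//; apply: (@le_trans _ _ (A k * p k `^ (- (1 + gamma)) / c1 + e / c3)).
    rewrite [leRHS](_ : _ = (A k / c1 + e * p k `^ (1 + gamma) / c3) * p k `^ (- (1 + gamma))).
      by rewrite ler_wpM2r// powR_ge0.
    rewrite mulrDl [X in _ = _ + X](_ : _ = e / c3 * (p k `^ (1 + gamma) * p k `^ (- (1 + gamma)))).
      by rewrite powpE// mulr1 mulrAC.
    by ring.
  have : A k * p k `^ (- (1 + gamma)) / c1 <= z by near: k; exact: (cvgr_le _ hA1).
  by rewrite (_ : e / c3 = (y - z) / 2) ?mulfK ?gt_eqF//; lra.
have lower y : y < al / v0 -> \forall k \near \oo, y <= L k / (p k `^ gamma / k%:R).
  move=> hy; have [c2 c2v hc2] : exists2 c2, v0 < c2 & (al / v0 + y) / 2 < al / c2.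
    have h : al / c @[c --> v0^'+] --> al / v0.
      apply: cvg_at_right_filter; apply: cvgM; [exact: cvg_cst|apply: cvgV; [by rewrite gt_eqF|exact: cvg_id]].
    near (v0^'+) => c2; exists c2; first by near: c2; exact: nbhs_right_gt.
    by near: c2; apply: (cvgr_gt _ h); lra.
  have c20 : 0 < c2 by exact: (lt_trans v00 c2v).
  set z := (al / v0 + y) / 2 in hc2; have zy : y < z by rewrite /z; lra.
  pose e := (z - y) / 2 * c2; have e0 : 0 < e by rewrite mulr_gt0// divr_gt0// subr_gt0.
  have c1v2 : v0 / 2 < v0 < c2 by rewrite c2v andbT; lra.
  have c10 : 0 < v0 / 2 by rewrite divr_gt0.
  have hB := atypical_negligible c1v2 e0.
  have hA1 : (fun k => A k * p k `^ (- (1 + gamma)) / c2) @ \oo --> al / c2.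
    by apply: (cvgM cA); exact: cvg_cst.
  near=> k.
  have pk : 0 < p k by apply: p_gt0; near: k; exact: nbhs_infty_gt.
  have k0 : (0 < k)%N by near: k; exact: nbhs_infty_gt.
  have kp : 0 < k%:R * p k by rewrite mulr_gt0 ?ltr0n.
  have Bk M : \sum_(0 <= m < M) b m * d (v0 / 2) c2 k m <= e * p k `^ (1 + gamma).
    by move: M; near: k; exact: hB.
  have h : A k - e * p k `^ (1 + gamma) <= L k * (c2 * (k%:R * p k)).
    apply: (@ler_cvg_to _ \oo _ _
       (fun M => (\sum_(0 <= m < M) b m * (F k.+1 m.+1 - F k.+1 m)) - e * p k `^ (1 + gamma))
       (fun M => (\sum_(0 <= m < M) b m * Q k m) * (c2 * (k%:R * p k)))).
    - by apply: cvgB; [exact: hA|exact: cvg_cst].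
    - by apply: (cvgM (hL _ k0)); exact: cvg_cst.
    - apply: nearW => M; apply: le_trans (local_sum_ge (v0 / 2) c20 kp M).
      by rewrite lerD2l lerN2.
  rewrite scaleE//; apply: (@le_trans _ _ (A k * p k `^ (- (1 + gamma)) / c2 - e / c2)).
    have : z <= A k * p k `^ (- (1 + gamma)) / c2 by near: k; exact: (cvgr_ge _ hA1).
    by rewrite (_ : e / c2 = (z - y) / 2) ?mulfK ?gt_eqF//; lra.
  rewrite [leLHS](_ : _ = (A k - e * p k `^ (1 + gamma)) / c2 * p k `^ (- (1 + gamma))).
    rewrite ler_wpM2r ?powR_ge0// ler_pdivrMr// (le_trans h)// le_eqVlt.
    by apply/orP; left; apply/eqP; ring.
  rewrite !mulrBl [X in _ = _ - X](_ : _ = e / c2 * (p k `^ (1 + gamma) * p k `^ (- (1 + gamma)))).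
    by rewrite powpE// mulr1 mulrAC.
  by ring.
apply/cvgrPdist_le => e e0; near=> k; rewrite ler_norml.
have : L k / (p k `^ gamma / k%:R) <= al / v0 + e by near: k; apply: upper; lra.
have : al / v0 - e <= L k / (p k `^ gamma / k%:R) by near: k; apply: lower; lra.
by set x := L k / _; lra.
Unshelve. all: by end_near. Qed.

End LocalLimit.

(** * Asymptotics of the degree masses *)

Section MassAsymptotics.
Context {R : realType}.
Variables (p : nat -> R) (gamma : R).
Hypothesis gamma01 : 0 < gamma < 1.
Hypothesis p_gt0 : forall i, (1 <= i)%N -> 0 < p i.
Hypothesis p_noninc : forall i j, (1 <= i)%N -> (i <= j)%N -> p j <= p i.
Hypothesis p_sum : (\sum_(1 <= i <oo) (p i)%:E = 1)%E.
Hypothesis p_rv : regularly_varying p (- gamma^-1).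
Local Notation w := (weight p).
Let w_ge0 := weight_ge0 p_gt0.
Let w_sum := weight_sum p_gt0 p_sum.
Local Notation Ex := (Ex w).
Local Notation F := (rangeF p).
Local Notation Q := (rangeQ p).
Local Notation sib := (sib gamma).
Local Notation r := (sibuya gamma).

Let G0 : 0 < Gamma (1 - gamma). Proof. exact: GammaC_gt0. Qed.

Lemma sibuya_noninc m n : (0 < m)%N -> (m <= n)%N -> r n <= r m.
Proof.
case/andP: (gamma01) => g0 g1 m0 mn; have n0 : (0 < n)%N by lia.
rewrite !(sibuyaE gamma01)// ler_pM ?divr_ge0 ?(ltW g0) ?(ltW (sib_gt0 gamma01 _))//; last exact: sib_noninc.
by rewrite ler_wpM2l ?(ltW g0)// lef_pV2 ?posrE ?ltr0n// ler_nat.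
Qed.

Let rearrange (g x u y s : R) : g * (x / u * (y * s)) = x * y * (g / u * s).
Proof. by ring. Qed.

(** [maxn 1] keeps the weights positive and nonincreasing at index 0, where the Sibuya formula would
    evaluate Gamma outside its range. The extra factor 2 relative to the tails comes from the 1 / l
    in r_l. *)
Lemma sibuya_half_cvg : m%:R `^ (1 + gamma) * r (maxn 1 (uphalf m)) @[m --> \oo] -->
  gamma * (2 * (2 `^ gamma * (Gamma (1 - gamma))^-1)).
Proof.
case/andP: (gamma01) => g0 g1.
have h : (fun m => gamma * ((m%:R / (uphalf m)%:R) * (m%:R `^ gamma * sib (uphalf m)))) @ \oo -->
    gamma * (2 * (2 `^ gamma * (Gamma (1 - gamma))^-1)).
  apply: cvgM; first exact: cvg_cst.
  exact: (cvgM (half_ratio_cvg gamma01) (sib_half_cvg gamma01)).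
apply: cvg_trans h; apply: near_eq_cvg; near=> m.
have m0 : (0 < m)%N by near: m; exact: nbhs_infty_gt.
have u0 : (0 < uphalf m)%N by lia.
rewrite (maxn_idPr u0) sibuyaE// powRD; last by apply/implyP => _; rewrite pnatr_eq0 -lt0n.
by rewrite powRr1// rearrange.
Unshelve. all: by end_near. Qed.

Lemma sibuya_asymp : m%:R `^ (1 + gamma) * r (maxn 1 m) @[m --> \oo] -->
  gamma * (Gamma (1 - gamma))^-1.
Proof.
case/andP: (gamma01) => g0 g1.
have h : (fun m => gamma * (m%:R `^ gamma * sib m)) @ \oo --> gamma * (Gamma (1 - gamma))^-1.
  by apply: cvgM (sib_asymp gamma01); exact: cvg_cst.
apply: cvg_trans h; apply: near_eq_cvg; near=> m.
have m0 : (0 < m)%N by near: m; exact: nbhs_infty_gt.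
rewrite (maxn_idPr m0) sibuyaE// powRD; last by apply/implyP => _; rewrite pnatr_eq0 -lt0n.
by rewrite powRr1// -rearrange divff ?mul1r// pnatr_eq0 -lt0n.
Unshelve. all: by end_near. Qed.

Let Q0 k : (0 < k)%N -> Q k 0 = 0.
Proof. by case: k. Qed.

Lemma out_mass_asymp (L : nat -> R) :
  (forall k, (0 < k)%N -> (fun M => \sum_(1 <= l < M) r l * Q k l) @ \oo --> L k) ->
  L k / (p k `^ gamma / k%:R) @[k --> \oo] --> (1 : R).
Proof.
case/andP: (gamma01) => g0 g1 hL.
have := @local_limit _ p gamma gamma01 p_gt0 p_noninc p_sum p_rv (fun m => r (maxn 1 m))
  (gamma * (Gamma (1 - gamma))^-1) _ _ sibuya_asymp L.
rewrite (_ : _ / gamma * _ = 1); last by field; rewrite !gt_eqF.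
apply.
- by move=> m; apply/ltW/sibuya_gt0 => //; rewrite leq_max.
- by move=> m n mn; apply: sibuya_noninc; lia.
move=> k k0; have h := hL k k0; rewrite -cvg_shiftS in h; rewrite -cvg_shiftS.
apply: cvg_trans h; apply: near_eq_cvg; apply: nearW => M.
rewrite [RHS]big_ltn// Q0// mulr0 add0r; apply: eq_big_nat => l l1.
by rewrite (maxn_idPr _)//; lia.
Qed.

Let b m := r (maxn 1 (uphalf m)).
Let b_ge0 m : 0 <= b m.
Proof. by apply/ltW/sibuya_gt0 => //; rewrite leq_max. Qed.
Let b_noninc m n : (m <= n)%N -> b n <= b m.
Proof. by move=> mn; apply: sibuya_noninc; lia. Qed.

Let St := stieltjes p b.

Let kappa02 : 0 < 1 + gamma < 2.
Proof. by case/andP: gamma01 => g0 g1; apply/andP; split; lra. Qed.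

(** The weights at 2 l - 1 and 2 l are both r_l, so the difference of the two sums involves only Q
    at consecutive times. This is bounded by the increments at levels k and k + 1. *)
Let double_sum k M : (0 < k)%N ->
  `|\sum_(0 <= m < (2 * M).+1) b m * Q k m - 2 * \sum_(1 <= l < M.+1) r l * Q k (2 * l)%N| <=
  \sum_(0 <= m < 2 * M) b m.+1 * (F k m.+1 - F k m) +
  \sum_(0 <= m < 2 * M) b m.+1 * (F k.+1 m.+1 - F k.+1 m).
Proof.
move=> k0; elim: M => [|M IH].
  by rewrite muln0 big_nat1 Q0// !big_geq// !mulr0 subrr normr0 addr0.
rewrite (_ : 2 * M.+1 = (2 * M).+2)%N; last by lia.
rewrite [X in `|X - _|]big_nat_recr//= [X in `|X + _ - _|]big_nat_recr//=.
rewrite [X in `|_ - 2 * X|]big_nat_recr//= [X in _ <= X + _]big_nat_recr//= [X in _ <= X + _ + _]big_nat_recr//=.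
rewrite [X in _ <= _ + X]big_nat_recr//= [X in _ <= _ + (X + _)]big_nat_recr//=.
have bE : b (2 * M).+1 = r M.+1 /\ b (2 * M).+2 = r M.+1.
  by rewrite /b (_ : uphalf (2 * M).+1 = M.+1); [rewrite (_ : uphalf (2 * M).+2 = M.+1); [rewrite (maxn_idPr _)|lia]|lia].
case: bE => -> ->; rewrite (_ : 2 * M.+1 = (2 * M).+2)%N; last by lia.
move: IH; set S := \sum_(0 <= m < _) _ * Q k m; set T := \sum_(1 <= l < _) _.
set A := \sum_(0 <= m < _) _ * _; set B := \sum_(0 <= m < _) _ * _ => IH.
have i1 : `|Q k (2 * M).+1 - Q k (2 * M).+2| <=
    F k (2 * M).+2 - F k (2 * M).+1 + (F k.+1 (2 * M).+2 - F k.+1 (2 * M).+1).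
  have := @rangeF_mono _ _ p_gt0 p_sum k (2 * M).+1; have := @rangeF_mono _ _ p_gt0 p_sum k.+1 (2 * M).+1.
  rewrite !(rangeQE p_gt0 p_sum); set x1 := F k _; set x2 := F k _; set x3 := F _ _; set x4 := F _ _.
  by move=> h1 h2; rewrite ler_norml; apply/andP; split; lra.
have r0 : 0 <= r M.+1 by exact/ltW/sibuya_gt0.
have i2 : 0 <= r M.+1 * (F k (2 * M).+1 - F k (2 * M)%N) by rewrite mulr_ge0// subr_ge0 rangeF_mono.
have i3 : 0 <= r M.+1 * (F k.+1 (2 * M).+1 - F k.+1 (2 * M)%N) by rewrite mulr_ge0// subr_ge0 rangeF_mono.
rewrite [X in `|X|](_ : _ = (S - 2 * T) + r M.+1 * (Q k (2 * M).+1 - Q k (2 * M).+2)); last by ring.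
apply: le_trans (ler_normD _ _) _; rewrite normrM (ger0_norm r0).
apply: le_trans (lerD IH (ler_wpM2l r0 i1)) _.
rewrite mulrDr; lra.
Qed.

(** The sum over all times with weights [b] has the limiting constant 2 times 2^gamma and is nearly
    twice the sum over even times. The gap is a Stieltjes sum of order p_k^(1 + gamma), smaller than
    p_k^gamma / k by the factor k p_k, which tends to 0. *)
Lemma mass_asymp (L : nat -> R) :
  (forall k, (0 < k)%N -> (fun M => \sum_(1 <= l < M) r l * Q k (2 * l)%N) @ \oo --> L k) ->
  L k / (2 `^ gamma * p k `^ gamma / k%:R) @[k --> \oo] --> (1 : R).
Proof.
case/andP: (gamma01) => g0 g1 hL.
have bn m n : (0 < m)%N -> (m <= n)%N -> b n <= b m by move=> _; exact: b_noninc.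
have St_cvg k : (fun M => \sum_(0 <= m < 2 * M) b m.+1 * (F k m.+1 - F k m)) @ \oo --> St k.
  have h := stieltjes_lim p_gt0 p_sum b_ge0 bn (k := k).
  have h2 : (fun M => 2 * M)%N @ \oo --> \oo.
    by apply/cvgnyPge => A; exists A => // M /= h'; lia.
  exact: (cvg_comp _ _ h2 h).
have St_le k M : \sum_(0 <= m < 2 * M) b m.+1 * (F k m.+1 - F k m) <= St k.
  have := nondecreasing_cvgn_le _ (cvgP _ (St_cvg k)) M; rewrite (cvg_lim _ (St_cvg k))//; apply.
  apply/nondecreasing_seqP => n; rewrite (_ : 2 * n.+1 = (2 * n).+2)%N; last by lia.
  rewrite [leRHS]big_nat_recr//= [X in _ <= X + _]big_nat_recr//= -addrA lerDl.
  by rewrite addr_ge0// mulr_ge0// subr_ge0 rangeF_mono.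
pose S k M := \sum_(0 <= m < M) b m * Q k m.
pose T k M := \sum_(1 <= l < M.+1) r l * Q k (2 * l)%N.
have dd k M : (0 < k)%N -> `|S k (2 * M).+1 - 2 * T k M| <= St k + St k.+1.
  by move=> k0; apply: le_trans (double_sum M k0) _; exact: lerD.
have Q01 k m : 0 <= Q k m by apply: Ex_ge0 => //; exact: bnds_bool.
have T_cvg k : (0 < k)%N -> T k @ \oo --> L k.
  by move=> k0; have := hL k k0; rewrite -cvg_shiftS.
have T_le k M : (0 < k)%N -> T k M <= L k.
  move=> k0; have := nondecreasing_cvgn_le _ (cvgP _ (T_cvg k k0)) M; rewrite (cvg_lim _ (T_cvg k k0))//; apply.
  apply/nondecreasing_seqP => n; rewrite /T [leRHS]big_nat_recr//= lerDl mulr_ge0//.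
  exact/ltW/sibuya_gt0.
have S_nd k : {homo S k : m n / (m <= n)%N >-> m <= n}.
  by apply/nondecreasing_seqP => n; rewrite /S [leRHS]big_nat_recr//= lerDl mulr_ge0.
have S_cvg k : (0 < k)%N -> S k @ \oo --> limn (S k).
  (* Boundedness comes from the even-time sum: the two stay within the Stieltjes gap of each
     other. *)
  move=> k0; apply: nondecreasing_is_cvgn => //; exists (2 * L k + (St k + St k.+1)) => _ [M _ <-].
  apply: (@le_trans _ _ (S k (2 * M).+1)); first by apply: S_nd; lia.
  have := dd k M k0; rewrite ler_norml => /andP[_]; have := T_le k M k0.
  by set x := S k _; set y := T k M; lra.
have LL k : (0 < k)%N -> `|limn (S k) - 2 * L k| <= St k + St k.+1.
  move=> k0; have h2 : (fun M => (2 * M).+1)%N @ \oo --> \oo.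
    by apply/cvgnyPge => A; exists A => // M /= h'; lia.
  have h : (fun M => `|S k (2 * M).+1 - 2 * T k M|) @ \oo --> `|limn (S k) - 2 * L k|.
    apply: cvg_norm; apply: cvgB; first exact: (cvg_comp _ _ h2 (S_cvg k k0)).
    by apply: cvgM; [exact: cvg_cst|exact: T_cvg].
  apply: (@ler_cvg_to _ \oo _ _ _ (fun=> St k + St k.+1) _ _ h); first exact: cvg_cst.
  by apply: nearW => M; exact: dd.
have main := @local_limit _ p gamma gamma01 p_gt0 p_noninc p_sum p_rv b _ b_ge0 b_noninc sibuya_half_cvg
  (fun k => limn (S k)) S_cvg.
rewrite (_ : _ / gamma * _ = 2 * 2 `^ gamma) in main; last by field; rewrite !gt_eqF.
have bp : m%:R `^ (1 + gamma) * b m @[m --> \oo] --> gamma * (2 * (2 `^ gamma * (Gamma (1 - gamma))^-1)).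
  exact: sibuya_half_cvg.
have s1 := stieltjes_cvg gamma01 p_gt0 p_noninc p_sum p_rv kappa02 b_ge0 bn bp.
have s2 := stieltjes_cvg' gamma01 p_gt0 p_noninc p_sum p_rv kappa02 b_ge0 bn bp.
set c := gamma * _ * _ in s1 s2.
have kp : k%:R * p k @[k --> \oo] --> (0 : R) by exact: (kp_cvg0 gamma01 p_gt0 p_noninc p_sum).
have err : (fun k => (k%:R * p k) * (St k * p k `^ (- (1 + gamma)) + St k.+1 * p k `^ (- (1 + gamma)))) @ \oo --> (0 : R).
  by rewrite -[X in _ --> X](mul0r (c + c)); apply: cvgM => //; exact: cvgD.
have h2g : 0 < (2 : R) `^ gamma by exact: powR_gt0.
have dist : (fun k => limn (S k) / (p k `^ gamma / k%:R) - 2 * (L k / (p k `^ gamma / k%:R))) @ \oo --> (0 : R).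
  apply/cvgr0Pnorm_le => e e0; near=> k.
  have pk : 0 < p k by apply: p_gt0; near: k; exact: nbhs_infty_gt.
  have k0 : (0 < k)%N by near: k; exact: nbhs_infty_gt.
  apply: (@le_trans _ _ ((k%:R * p k) * (St k * p k `^ (- (1 + gamma)) + St k.+1 * p k `^ (- (1 + gamma))))); last first.
    by near: k; exact: (cvgr_le _ err).
  rewrite [X in `|X|](_ : _ = (limn (S k) - 2 * L k) * (k%:R * p k * p k `^ (- (1 + gamma)))); last first.
    rewrite powRN powRD; last by apply/implyP => _; rewrite gt_eqF.
    by rewrite powRr1 ?(ltW pk)//; field; rewrite !gt_eqF ?powR_gt0 ?ltr0n.
  rewrite normrM [X in _ * X]ger0_norm ?mulr_ge0 ?powR_ge0 ?(ltW pk)//.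
  rewrite -mulrDl [leRHS]mulrCA ler_wpM2r ?mulr_ge0 ?powR_ge0 ?(ltW pk)//.
  exact: LL.
have fin : (fun k => (2 * 2 `^ gamma)^-1 * (limn (S k) / (p k `^ gamma / k%:R) -
    (limn (S k) / (p k `^ gamma / k%:R) - 2 * (L k / (p k `^ gamma / k%:R))))) @ \oo -->
    (2 * 2 `^ gamma)^-1 * (2 * 2 `^ gamma - 0).
  by apply: cvgM (cvgB main dist); exact: cvg_cst.
rewrite subr0 mulVf ?gt_eqF ?mulr_gt0// in fin.
apply: cvg_trans fin; apply: near_eq_cvg; near=> k.
have pk : 0 < p k by apply: p_gt0; near: k; exact: nbhs_infty_gt.
have k0 : (0 < k)%N by near: k; exact: nbhs_infty_gt.
have pg : 0 < p k `^ gamma by exact: powR_gt0.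
by rewrite subKr; field; rewrite !gt_eqF ?ltr0n.
Unshelve. all: by end_near. Qed.

End MassAsymptotics.

(** * Variance of degree counts *)

Section EdgeLists.
Variable c : bool.
Implicit Types (E : seq (nat * nat)) (s : seq nat) (x y k i : nat).

Definition edges s := zip s (behead s).

(* [c] selects undirected ([true]) or out- ([false]) neighbours. *)
Definition adj E x y := (y != x) && (((x, y) \in E) || c && ((y, x) \in E)).

Definition vertices E := undup (unzip1 E ++ unzip2 E).

Definition deg E x := count (adj E x) (vertices E).

Definition high k E := [seq x <- vertices E | k <= deg E x]%N.

Lemma adj_vertices E x y : adj E x y -> (x \in vertices E) && (y \in vertices E).
Proof.
case/andP => _ /orP[|/andP[_]] h; rewrite !mem_undup !mem_cat;
  by have := map_f fst h; have := map_f snd h => /= -> ->; rewrite !orbT.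
Qed.

Lemma degE E x : deg E x = size [seq y <- vertices E | adj E x y].
Proof. by rewrite size_filter. Qed.

Lemma deg_ge E x t : uniq t -> all (adj E x) t -> (size t <= deg E x)%N.
Proof.
move=> ut /allP h; rewrite degE; apply: uniq_leq_size => // y yt.
by rewrite mem_filter h//=; case/andP: (adj_vertices (h _ yt)).
Qed.

Lemma deg_sub E E' x : {in E, forall e, e \in E' \/ (x != e.1) && (x != e.2)} ->
  (deg E x <= deg E' x)%N.
Proof.
move=> h; rewrite degE; apply: deg_ge; first by rewrite filter_uniq// undup_uniq.
apply/allP => y; rewrite mem_filter => /andP[/andP[xy a] _]; rewrite /adj xy /=.
case/orP: a => [/h[->//|/=]|/andP[-> /h[->|/=]]]; rewrite ?eqxx ?orbT// ?andbF//.
Qed.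

Lemma high_sub k E E' : {subset E <= E'} -> (0 < k)%N -> (size (high k E) <= size (high k E'))%N.
Proof.
move=> EE k0; apply: uniq_leq_size; first by rewrite filter_uniq// undup_uniq.
move=> x; rewrite !mem_filter => /andP[h _].
have hE : (k <= deg E' x)%N by rewrite (leq_trans h)// deg_sub// => e /EE; left.
rewrite hE /=; have : (0 < deg E' x)%N by lia.
by rewrite -has_count => /hasP[y _ /adj_vertices /andP[]].
Qed.

Lemma size_high_le k E E' : (0 < k)%N ->
  (size (high k E) <= size (high k E') + count (fun x => deg E' x < k)%N (high k E))%N.
Proof.
move=> k0; rewrite -[size (high k E)](count_predC (fun x => deg E' x < k)%N) addnC leq_add2r.
rewrite -size_filter.
apply: uniq_leq_size; first by rewrite !filter_uniq// undup_uniq.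
move=> x; rewrite mem_filter /= -leqNgt => /andP[h _]; rewrite mem_filter h /=.
have : (0 < deg E' x)%N by lia.
by rewrite -has_count => /hasP[y _ /adj_vertices /andP[]].
Qed.

Lemma edgesP s e :
  reflect (exists2 j, (j.+1 < size s)%N & e = (nth 0%N s j, nth 0%N s j.+1)) (e \in edges s).
Proof.
have sz : size (edges s) = (size s).-1 by rewrite size_zip size_behead; lia.
have nz j : (j.+1 < size s)%N -> nth (0%N, 0%N) (edges s) j = (nth 0%N s j, nth 0%N s j.+1).
  move=> js; rewrite nth_zip_cond -/(edges s) sz ifT /= ?nth_behead//; lia.
apply: (iffP (nthP (0%N, 0%N))) => [[j js <-]|[j js ->]]; exists j; rewrite ?nz ?sz//.
all: by rewrite ?sz in js; lia.
Qed.

Lemma edges_rcons s x : {subset edges s <= edges (rcons s x)}.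
Proof.
move=> e /edgesP[j js ->]; apply/edgesP; exists j; first by rewrite size_rcons ltnW.
by rewrite !nth_rcons js (ltnW js).
Qed.

(** Deletion cuts the trajectory into two pieces that are not glued together. No new edge appears,
    so degrees can only decrease, and the result does not depend on sample i, as Efron-Stein
    requires. *)
Definition del_edges i s := edges (take i s) ++ edges (drop i.+1 s).

Lemma del_edges_sub i s : {subset del_edges i s <= edges s}.
Proof.
move=> e; rewrite mem_cat => /orP[/edgesP[j js ->]|/edgesP[j js ->]].
  have /andP[ji js'] : (j.+1 < i)%N && (j.+1 < size s)%N by move: js; rewrite size_take; case: (ltnP i (size s)); lia.
  by rewrite !nth_take; [apply/edgesP; exists j|lia..].
rewrite size_drop in js; rewrite !nth_drop addnS.
by apply/edgesP; exists (i.+1 + j)%N => //; lia.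
Qed.

Lemma mem_del_edges i s j : (j.+1 < size s)%N -> i != j -> i != j.+1 ->
  (nth 0%N s j, nth 0%N s j.+1) \in del_edges i s.
Proof.
move=> js ij ij1; rewrite mem_cat; apply/orP; have [ji|ij2] := ltnP j i.
  left; apply/edgesP; exists j; last by rewrite !nth_take; [|by lia..].
  by rewrite size_take; case: (ltnP i (size s)); lia.
right; apply/edgesP; exists (j - i.+1)%N; first by rewrite size_drop; lia.
by rewrite !nth_drop; congr (nth _ _ _, nth _ _ _); lia.
Qed.

(** The lost edges join sample i to its two neighbours in time, so only these three symbols can lose
    degree. For [i = 0] the predecessor repeats the sample itself. *)
Lemma count_dropped_le3 i k s :
  (count (fun x => deg (del_edges i s) x < k)%N (high k (edges s)) <= 3)%N.
Proof.
rewrite -size_filter (_ : 3%N = size [:: nth 0%N s i.-1; nth 0%N s i; nth 0%N s i.+1])//.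
apply: uniq_leq_size; first by rewrite !filter_uniq// undup_uniq.
move=> x; rewrite !mem_filter => /and3P[h1 h2 _]; apply: contraLR h1 => xT.
rewrite -leqNgt (leq_trans h2)//; apply: deg_sub => e /edgesP[j js ->] /=.
move: xT; rewrite !inE !negb_or => /and3P[x1 x2 x3].
have [e1|ij] := eqVneq i j; first by right; rewrite -e1 x2 x3.
have [e1|ij1] := eqVneq i j.+1; first by right; rewrite e1 /= in x1; rewrite -e1 x2 x1.
by left; exact: mem_del_edges.
Qed.

(** One edge position j is chosen for each neighbour; it survives unless sample j or j + 1 is
    deleted. Hence at most two critical positions per neighbour. *)
Lemma certificate x s t : all (adj (edges s) x) t ->
  exists2 js : seq nat, size js = size t &
    forall i, i \notin js ++ map S js -> all (adj (del_edges i s) x) t.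
Proof.
elim: t => [|y t IH] /=; first by exists [::].
case/andP => /andP[xy a] /IH[js sjs hjs].
have [j hj] : exists j, forall i, i != j -> i != j.+1 -> adj (del_edges i s) x y.
  case/orP: a => [/edgesP[j h e]|/andP[cc /edgesP[j h e]]]; exists j => i i1 i2; rewrite /adj xy /= e mem_del_edges//.
  by rewrite cc orbT.
exists (j :: js) => [|i]; first by rewrite /= sjs.
rewrite /= inE negb_or mem_cat negb_or /= inE negb_or => /and3P[i1 i2 /andP[i3 i4]].
by rewrite hj// hjs// mem_cat negb_or i2.
Qed.

Lemma count_critical k s n x : (k <= deg (edges s) x)%N ->
  (count (fun i => deg (del_edges i s) x < k)%N (iota 0 n) <= 2 * k)%N.
Proof.
move=> kd; set t := take k [seq y <- vertices (edges s) | adj (edges s) x y].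
have st : size t = k by apply: size_takel; rewrite -degE.
have ut : uniq t by rewrite take_uniq// filter_uniq// undup_uniq.
have : all (adj (edges s) x) t by apply/allP => y /mem_take; rewrite mem_filter => /andP[].
case/certificate => js sjs hjs; rewrite -size_filter.
apply: leq_trans (_ : _ <= size (js ++ map S js))%N _; last by rewrite size_cat size_map; lia.
apply: uniq_leq_size; first by rewrite filter_uniq// iota_uniq.
move=> i; rewrite mem_filter => /andP[h _]; apply: contraLR h => /hjs h.
by rewrite -leqNgt -st; exact: deg_ge.
Qed.

Lemma size_high_distinct k s : (size (high k (edges s)) <= distinct s)%N.
Proof.
apply: uniq_leq_size; first by rewrite filter_uniq// undup_uniq.
move=> x; rewrite mem_filter => /andP[_]; rewrite !mem_undup mem_cat.
by case/orP => /mapP[e /edgesP[j js ->] ->] /=; rewrite mem_nth//; exact: ltnW.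
Qed.

Lemma sum_critical k s n :
  (\sum_(0 <= i < n) count (fun x => deg (del_edges i s) x < k)%N (high k (edges s)) <=
   2 * k * distinct s)%N.
Proof.
rewrite (eq_bigr (fun i => \sum_(x <- high k (edges s)) (deg (del_edges i s) x < k)))%N; last first.
  by move=> i _; rewrite -sum1_count big_mkcond.
rewrite exchange_big /=.
apply: leq_trans (_ : _ <= \sum_(x <- high k (edges s)) 2 * k)%N _.
  rewrite big_seq [leqRHS]big_seq; apply: leq_sum => x; rewrite mem_filter => /andP[h _].
  apply: leq_trans (count_critical n h); rewrite -sum1_count [leqRHS]big_mkcond /=.
  by rewrite /index_iota subn0.
by rewrite big_const_seq count_predT iter_addn addn0 leq_mul2l size_high_distinct orbT.
Qed.

End EdgeLists.

Section DegreeVariance.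
Context {R : realType}.
Variables (w : nat -> R) (w_ge0 : forall x, 0 <= w x).
Hypothesis w_sum : series w @ \oo --> (1 : R).
Variables (c : bool) (k : nat).
Hypothesis k_gt0 : (0 < k)%N.

Definition high_count (s : seq nat) : nat := size (high c k (edges s)).

Lemma bnds_high n : bnds n (fun s => (high_count s)%:R : R).
Proof.
apply: (@bnds_nat _ _ _ n) => s <-.
by apply: leq_trans (size_high_distinct _ _ _) _; exact: distinct_size.
Qed.

(** A deletion drops D <= 3 symbols below the threshold, so D^2 <= 3 D; the sum of D over all
    positions is at most 2 k times the range, whence 6 k. *)
Lemma Var_high n : Var w n (fun s => (high_count s)%:R) <=
  6 * k%:R * Ex w n (fun s => (distinct s)%:R).
Proof.
pose G (s1 s2 : seq nat) : R := (size (high c k (edges s1 ++ edges s2)))%:R.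
have bG i : bnds n (fun s => G (take i s) (drop i.+1 s)).
  apply: (@bnds_nat _ _ _ n) => s <-.
  apply: leq_trans (_ : _ <= high_count s)%N _.
    by apply: high_sub => //; exact: del_edges_sub.
  by apply: leq_trans (size_high_distinct _ _ _) _; exact: distinct_size.
apply: le_trans (Efron_Stein w_ge0 w_sum (bnds_high n) (fun i _ => bG i)) _.
rewrite -(ExZ w_ge0 w_sum); last exact: bnds_distinct.
rewrite -(Ex_sum w_ge0 w_sum); last first.
  by move=> i; apply: bndsX; apply: bndsB => //; exact: bnds_high.
have b2 : bnds n (fun s => 6 * k%:R * (distinct s)%:R : R).
  by apply: bndsM; [exact: bnds_cst|exact: bnds_distinct].
apply: Ex_le => //.
  by apply: bnds_sum => i; apply: bndsX; apply: bndsB => //; exact: bnds_high.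
move=> s sn.
apply: (@le_trans _ _ (\sum_(i < n) 3 * (count (fun x => deg c (del_edges i s) x < k)%N (high c k (edges s)))%:R)).
  apply: ler_sum => i _; set D := count _ _.
  have D3 : (D <= 3)%N by exact: count_dropped_le3.
  have h1 : (size (high c k (del_edges i s)) <= high_count s)%N.
    by apply: high_sub => //; exact: del_edges_sub.
  have h2 : (high_count s <= size (high c k (del_edges i s)) + D)%N by exact: size_high_le.
  rewrite /G -/(del_edges i s) -natrB// -natrX -natrM ler_nat.
  by rewrite -mulnn leq_mul//; lia.
rewrite -mulr_sumr -natr_sum -(big_mkord predT (fun i => count (fun x => deg c (del_edges i s) x < k)%N (high c k (edges s)))).
have := sum_critical c k s n; rewrite -(ler_nat R) !natrM; lra.
Qed.

End DegreeVariance.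

(** * Mean of degree counts *)

Section Blocks.
Implicit Types (s t : seq nat) (x y k l : nat).

(* [flanks x s] collects the neighbours [b, c] of all visits [b x c] to [x] in
   [s], provided that these blocks [b x c] do not overlap. *)
Fixpoint flanks x s : option (seq nat) :=
  if s is b :: s1 then
    if b == x then None else
    if s1 is a :: s2 then
      if a == x then
        if s2 is c :: s3 then
          if c == x then None else omap (fun t => [:: b, c & t]) (flanks x s3)
        else None
      else flanks x s1
    else Some [::]
  else Some [::].

(** Applied to the flanks of [x], this keeps the successors, which are the out-neighbours. *)
Fixpoint seconds s : seq nat := if s is _ :: c :: t then c :: seconds t else [::].

Lemma flanks_in x s t : flanks x s = Some t -> (x \in s) = (t != [::]).
Proof.
have [n] := ubnP (size s); elim: n s t => // n IH [|b s1] t /=; first by move=> _ [<-].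
rewrite ltnS => sn; case: (eqVneq b x) => // bx.
case: s1 sn => [|a s2] sn; first by case=> <-; rewrite inE eq_sym (negbTE bx).
case: (eqVneq a x) => [ax|ax]; last first.
  by move=> /(IH (a :: s2)) h; rewrite inE eq_sym (negbTE bx) h.
case: s2 sn => // c s3 sn; case: (eqVneq c x) => // cx.
by case: (flanks x s3) => // u [<-] /=; rewrite !inE ax eqxx !orbT.
Qed.

Let edges_cons a b s : edges [:: a, b & s] = (a, b) :: edges (b :: s).
Proof. by []. Qed.

(** Every edge at [x] lies inside one block, because the symbols on both sides of a block boundary
    differ from [x]. *)
Lemma flanks_adj cc x y s t : flanks x s = Some t ->
  adj cc (edges s) x y = (y \in if cc then t else seconds t).
Proof.
have [n] := ubnP (size s); elim: n s t => // n IH [|b s1] t /=.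
  by move=> _ [<-]; rewrite /adj !in_nil !andbF; case: (cc).
rewrite ltnS => sn; case: (eqVneq b x) => // bx.
case: s1 sn => [|a s2] sn.
  by case=> <-; rewrite /adj !in_nil !andbF; case: (cc).
rewrite /adj edges_cons !inE !xpair_eqE.
case: (eqVneq a x) => [ax|ax].
  case: s2 sn => // c s3 sn; case: (eqVneq c x) => // cx.
  case h : (flanks x s3) => [u|//] [<-].
  have hu : adj cc (edges s3) x y = (y \in if cc then u else seconds u) by apply: IH h; move: sn => /=; lia.
  rewrite {}ax {sn}.
  (* The edge from the end of this block to what follows joins two symbols different from [x], so it
     does not affect adjacency to [x]. *)
  have e3 : (y != x) && (((x, y) \in edges (c :: s3)) || cc && ((y, x) \in edges (c :: s3))) = adj cc (edges s3) x y.
    case: s3 h {hu} => [|e s4] h; first by [].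
    rewrite /adj edges_cons !inE !xpair_eqE (eq_sym x c) (negbTE cx) /=.
    have ex : (x == e) = false by move: h => /=; case: eqVneq => // _; rewrite eq_sym.
    by rewrite ex andbF.
  rewrite edges_cons !inE !xpair_eqE eqxx (eq_sym x b) (negbTE bx) /= (eq_sym x c) (negbTE cx) andbF andbT.
  rewrite !orbA; move: e3; set A := (x, y) \in _; set B := (y, x) \in _ => e3.
  transitivity ((y != x) && ((y == c) || cc && (y == b)) || adj cc (edges s3) x y).
    rewrite -e3; move: (A) (B) (y == b) (y == c) (y != x) (cc) => a1 a2 a3 a4 a5 a6.
    by case: a1; case: a2; case: a3; case: a4; case: a5; case: a6.
  rewrite hu; case: (cc) => /=; rewrite ?inE ?andbF ?orbF.
    case: (eqVneq y x) => [->|_] /=; last by case: (y == b); case: (y == c).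
    by rewrite eq_sym (negbTE bx) eq_sym (negbTE cx).
  case: (eqVneq y x) => [->|_] //=.
  by rewrite eq_sym (negbTE cx).
move=> /(IH (a :: s2)) <- //; rewrite /adj.
by rewrite (eq_sym x b) (negbTE bx) /= andbF.
Qed.

Lemma flanks_deg cc x s t : flanks x s = Some t ->
  deg cc (edges s) x = distinct (if cc then t else seconds t).
Proof.
move=> h; rewrite degE; apply/perm_size/uniq_perm; rewrite ?filter_uniq ?undup_uniq//.
move=> y; rewrite mem_filter mem_undup (flanks_adj _ _ h); case: (boolP (y \in if cc then t else seconds t)) => //= yt.
by have := flanks_adj cc y h; rewrite yt => /adj_vertices /andP[].
Qed.

End Blocks.

Section BlockExpectation.
Context {R : realType}.
Variables (w : nat -> R) (w_ge0 : forall x, 0 <= w x).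
Hypothesis w_sum : series w @ \oo --> (1 : R).
Local Notation avg := (avg w).
Local Notation Ex := (Ex w).
Variable x : nat.

(** The visits to [x] are separated, there are exactly [l] of them, and their flanks satisfy [h];
    lists with overlapping blocks are discarded. *)
Definition flanked (l : nat) (h : pred (seq nat)) (s : seq nat) : bool :=
  if flanks x s is Some t then (size t == 2 * l)%N && h t else false.

(** A leading symbol other than [x] either stays outside the blocks or opens one. The two cases
    exclude each other: in the second, [s] begins with [x] and is itself not flanked. *)
Lemma flanked_cons l h b s : (flanked l h (b :: s))%:R =
  (b != x)%:R * (flanked l h s)%:R +
  (b != x)%:R * (if s is a :: c :: s3 then (a == x)%:R * ((c != x)%:R *
     (if l is l'.+1 then (flanked l' (fun t => h [:: b, c & t]) s3)%:R else 0)) else 0) :> R.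
Proof.
rewrite /flanked /=; case: (eqVneq b x) => [bx|bx] /=; first by rewrite !mul0r addr0.
rewrite !mul1r; case: s => [|a [|c s3]] /=; rewrite ?addr0//.
- by case: (a == x) => /=; rewrite ?addr0.
- case: (eqVneq a x) => [ax|ax] /=; last by rewrite mul0r addr0.
  rewrite add0r mul1r; case: (eqVneq c x) => [_|cx] /=; first by rewrite mul0r.
  rewrite mul1r; case: (flanks x s3) => [u|] /=; case: l => [|l] //=.
  by rewrite mulnS !add2n !eqSS.
Qed.

Let bnd_pred n (q : nat -> pred (seq nat)) : bnd (fun b => Ex n (fun s => (q b s)%:R)).
Proof.
by exists 1 => b; apply: Ex_norm => // s _; case: (q b s); rewrite ?normr1 ?normr0.
Qed.

Let bndM (f g : nat -> R) : bnd f -> bnd g -> bnd (fun b => f b * g b).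
Proof.
move=> [C hC] [D hD]; exists (C * D) => b; rewrite normrM ler_pM//.
Qed.

Let bnd_avg (f : nat -> nat -> R) C : (forall b c, `|f b c| <= C) -> bnd (fun b => avg (f b)).
Proof. by move=> h; exists C => b; exact: avg_norm. Qed.

Lemma Ex_flanked_cons n l h : Ex n.+1 (fun s => (flanked l h s)%:R) =
  (1 - w x) * Ex n (fun s => (flanked l h s)%:R) +
  (if l is l'.+1 then if n is n2.+2 then w x * avg (fun b => avg (fun c =>
      (b != x)%:R * ((c != x)%:R * Ex n2 (fun s => (flanked l' (fun t => h [:: b, c & t]) s)%:R))))
   else 0 else 0).
Proof.
have n1 m l' (h' : pred (seq nat)) : `|Ex m (fun s => (flanked l' h' s)%:R)| <= 1.
  by apply: Ex_norm => // s _; case: flanked; rewrite ?normr1 ?normr0.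
have bn1 (b : bool) : `|b%:R : R| <= 1 by case: b; rewrite ?normr1 ?normr0.
have nbc m l' (b c : bool) (h' : pred (seq nat)) :
    `|b%:R * (c%:R * Ex m (fun s => (flanked l' h' s)%:R))| <= 1.
  by rewrite !normrM !mulr_ile1.
pose T b : R := if l is l'.+1 then if n is n2.+2 then w x * avg (fun c =>
      (b != x)%:R * ((c != x)%:R * Ex n2 (fun s => (flanked l' (fun t => h [:: b, c & t]) s)%:R)))
   else 0 else 0.
have bT : bnd T.
  rewrite /T; case: l {T} => [|l']; first by exists 0 => b; rewrite normr0.
  case: n => [|[|n2]]; [by exists 0 => b; rewrite normr0..|].
  by apply: bndM; [by exists (`|w x|)|apply: bnd_avg => b c; exact: nbc].
transitivity (avg (fun b => Ex n (fun s => (flanked l h s)%:R) * (b != x)%:R + T b)); last first.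
  rewrite (avgD w_ge0 w_sum)//; last by apply: bndM; [by exists 1|exact: bnd_bool].
  rewrite (avgZ w_ge0 w_sum); last exact: bnd_bool.
  rewrite avg_neq// mulrC; congr (_ + _); rewrite /T.
  case: l {T bT} => [|l']; first exact: avg_cst.
  case: n => [|[|n2]]; [exact: avg_cst..|].
  by rewrite (avgZ w_ge0 w_sum)//; apply: bnd_avg => b c; exact: nbc.
congr avg; apply/funext => b /=.
have bf m (f : seq nat -> R) : (forall s, `|f s| <= 1) -> bnds m f by move=> hf; exists 1 => s _; exact: hf.
transitivity (Ex n (fun s => (b != x)%:R * (flanked l h s)%:R + (b != x)%:R *
   (if s is a :: c :: s3 then (a == x)%:R * ((c != x)%:R *
     (if l is l'.+1 then (flanked l' (fun t => h [:: b, c & t]) s3)%:R else 0)) else 0))).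
  by apply: eq_Ex => s _; rewrite flanked_cons.
have bN : forall s, `|if s is a :: c :: s3 then (a == x)%:R * ((c != x)%:R *
     (if l is l'.+1 then (flanked l' (fun t => h [:: b, c & t]) s3)%:R else 0)) else 0 : R| <= 1.
  case=> [|a [|c s3]]; rewrite ?normr0//; case: l {T bT} => [|l']; first by rewrite !mulr0 normr0.
  by rewrite !normrM !mulr_ile1.
rewrite (ExD w_ge0 w_sum)//; [|by apply: bndsM; apply: bf..].
rewrite !(ExZ w_ge0 w_sum)//; [|exact: bf..]; rewrite mulrC; congr (_ + _); rewrite /T.
case: l {T bT} bN => [|l'] bN.
  rewrite [X in _ * X](_ : _ = Ex n (fun=> 0)); first by rewrite (Ex_cst w_ge0 w_sum) mulr0.
  by apply: eq_Ex; case=> [|a [|c s3]] _ //; rewrite !mulr0.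
case: n => [|[|n2]] /=; [by rewrite mulr0|by rewrite avg_cst// mulr0|].
transitivity ((b != x)%:R * avg (fun a => avg (fun c => (c != x)%:R * Ex n2 (fun s => (flanked l' (fun t => h [:: b, c & t]) s)%:R)) * (a == x)%:R)).
  congr (_ * avg _); apply/funext => a; rewrite mulrC -(avgZ w_ge0 w_sum)//; last first.
    by exists 1 => c; rewrite normrM mulr_ile1.
  congr avg; apply/funext => c.
  by rewrite -!(ExZ w_ge0 w_sum)//; apply: bf => s; rewrite ?normrM ?mulr_ile1.
rewrite (avgZ w_ge0 w_sum) ?avg_eq1//; last exact: bnd_bool.
rewrite mulrA mulrC; congr (_ * _); rewrite -(avgZ w_ge0 w_sum)//.
by exists 1 => c; rewrite normrM mulr_ile1.
Qed.

(** Placing [l] disjoint blocks of length 3 among n positions means choosing [l] out of n - 2 l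
    items, each a block or a single symbol. The n - 3 l symbols outside the blocks avoid [x], and so
    do the flanks, which are otherwise independent samples. *)
Lemma Ex_flanked n l h : Ex n (fun s => (flanked l h s)%:R) =
  'C(n - 2 * l, l)%:R * w x ^+ l * (1 - w x) ^+ (n - 3 * l) *
    Ex (2 * l) (fun t => (h t && (x \notin t))%:R).
Proof.
have [N] := ubnP n; elim: N n l h => // N IH [|n] l h.
  move=> _ /=; rewrite !sub0n bin0n /flanked; case: l => [|l] /=.
    by rewrite andbT; ring.
  by rewrite mulnS /= !mul0r.
rewrite ltnS => nN; rewrite Ex_flanked_cons IH//.
case: l => [|l].
  by rewrite !bin0 !subn0 expr0 exprS addr0 !mulrA; ring.
rewrite [Ex (2 * l.+1) _](_ : _ = avg (fun b => avg (fun c => (b != x)%:R * ((c != x)%:R *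
    Ex (2 * l) (fun t => (h [:: b, c & t] && (x \notin t))%:R))))); last first.
  rewrite (_ : 2 * l.+1 = (2 * l).+2)%N /=; last by lia.
  congr avg; apply/funext => b; congr avg; apply/funext => c.
  rewrite -!(ExZ w_ge0 w_sum); try exact: bnds_bool; try by apply: bndsM; [exact: bnds_cst|exact: bnds_bool].
  apply: eq_Ex => t _; rewrite !inE !negb_or (eq_sym x b) (eq_sym x c).
  by case: (b != x); case: (c != x); case: (h _); rewrite ?mul0r ?mul1r.
set E := avg _.
case: n nN => [|[|n2]] nN.
- have -> : (1 - 2 * l.+1 = 0)%N by lia.
  by rewrite sub0n !bin0n /= !mul0r mulr0 addr0.
- have -> : (1 - 2 * l.+1 = 0)%N by lia.
  have -> : (2 - 2 * l.+1 = 0)%N by lia.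
  by rewrite !bin0n /= !mul0r mulr0 addr0.
set K := 'C(n2 - 2 * l, l)%:R * w x ^+ l * (1 - w x) ^+ (n2 - 3 * l).
rewrite [avg _](_ : _ = K * E); last first.
  have e1 b c : `|(b != x)%:R * ((c != x)%:R * Ex (2 * l) (fun t => (h [:: b, c & t] && (x \notin t))%:R))| <= 1.
    rewrite !normrM !mulr_ile1//; try by case: (_ != _); rewrite ?normr1 ?normr0.
    by apply: Ex_norm => // s _; case: (_ && _); rewrite ?normr1 ?normr0.
  rewrite -(avgZ w_ge0 w_sum)//; last by apply: bnd_avg => b c; exact: e1.
  congr avg; apply/funext => b; rewrite -(avgZ w_ge0 w_sum)//; last by exists 1 => c; exact: e1.
  congr avg; apply/funext => c; rewrite IH; last by lia.
  by rewrite -/K; ring.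
(* Truncated subtraction: when the list is too short for the blocks, all the binomials involved
   vanish. *)
have [ln|ln] := ltnP n2 (2 * l).
  rewrite /K (_ : (n2 - 2 * l = 0)%N); last by lia.
  rewrite (_ : (n2.+2 - 2 * l.+1 = 0)%N); last by lia.
  rewrite (_ : (n2.+3 - 2 * l.+1 = (1 - (2 * l - n2)))%N); last by lia.
  rewrite (_ : (1 - (2 * l - n2) = 0)%N); last by lia.
  rewrite !bin0n (_ : (l == 0)%N = false); last by lia.
  by rewrite !mul0r !mulr0 addr0.
rewrite (_ : (n2.+3 - 2 * l.+1 = (n2 - 2 * l).+1)%N); last by lia.
rewrite (_ : (n2.+2 - 2 * l.+1 = n2 - 2 * l)%N); last by lia.
(* Pascal's rule mirrors the alternative for the first symbol. *)
rewrite /K binS natrD.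
have [ln2|ln2] := ltnP (n2 - 2 * l) l.+1.
  rewrite (bin_small ln2).
  have [ln3|ln3] := ltnP (n2 - 2 * l) l; first by rewrite (bin_small ln3); ring.
  rewrite (_ : (n2.+3 - 3 * l.+1 = n2 - 3 * l)%N); last by lia.
  by rewrite exprS; ring.
rewrite (_ : (n2.+3 - 3 * l.+1 = (n2.+2 - 3 * l.+1).+1)%N); last by lia.
rewrite (_ : (n2 - 3 * l = (n2.+2 - 3 * l.+1).+1)%N); last by lia.
by rewrite !exprS; ring.
Qed.

End BlockExpectation.

Section FlankedCounts.
Variables (cc : bool) (K : nat).
Hypothesis K_gt0 : (0 < K)%N.

Definition selected t := if cc then t else seconds t.
(** Rich and poor flanks split the symbols with separated visits at the degree threshold. Their
    counts bound from below the number of high-degree symbols and its complement in the range. *)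
Definition rich t := (K <= distinct (selected t))%N.
Definition poor t := (distinct (selected t) < K)%N.

(** At most one [l] contributes, half the length of the flank list. Starting at [l = 1] excludes
    symbols that are never visited. *)
Lemma sum_flanked_le x h s N : (\sum_(1 <= l < N) flanked x l h s <=
  if flanks x s is Some t then (t != [::]) && h t else false)%N.
Proof.
rewrite /flanked; case: (flanks x s) => [t|]; last by rewrite big1.
case: (h t); last by rewrite andbF big1// => l _; rewrite andbF.
rewrite andbT; case: eqP => [->|/eqP t0] /=.
  by rewrite big_nat big1// => l /andP[l1 _]; case: l l1.
apply: (@leq_trans (count_mem (size t)./2 (index_iota 1 N))); last first.
  by rewrite count_uniq_mem ?iota_uniq// leq_b1.
rewrite -sum1_count [leqRHS]big_mkcond /=; apply: leq_sum => l _.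
by rewrite andbT; case: eqP => //= e; rewrite e mul2n doubleK eqxx.
Qed.

Lemma sum_mem_le (q : pred nat) (r : seq nat) M : (forall x, q x -> x \in r) ->
  (\sum_(0 <= x < M) q x <= size r)%N.
Proof.
move=> h; rewrite (_ : (\sum_(0 <= x < M) q x)%N = count q (index_iota 0 M)); last first.
  by rewrite -sum1_count [RHS]big_mkcond.
rewrite -size_filter; apply: uniq_leq_size; first by rewrite filter_uniq// iota_uniq.
by move=> x; rewrite mem_filter => /andP[/h].
Qed.

Lemma mem_high x s : (x \in high cc K (edges s)) = (K <= deg cc (edges s) x)%N.
Proof.
rewrite mem_filter; case: (leqP K _) => // h /=.
have : (0 < deg cc (edges s) x)%N by exact: leq_trans h.
by rewrite -has_count => /hasP[y _ /adj_vertices /andP[]].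
Qed.

Lemma sum_rich_le s M N :
  (\sum_(0 <= x < M) \sum_(1 <= l < N) flanked x l rich s <= high_count cc K s)%N.
Proof.
apply: (@leq_trans (\sum_(0 <= x < M) (x \in high cc K (edges s)))%N); last exact: sum_mem_le.
apply: leq_sum => x _; apply: leq_trans (sum_flanked_le x rich s N) _.
case e : (flanks x s) => [t|//]; rewrite mem_high (flanks_deg cc e) /rich /selected.
by case: (t != [::]).
Qed.

(** Symbols with poor flanks are visited and fall short of the threshold, hence they are disjoint
    from the high ones within the range. *)
Lemma sum_poor_le s M N :
  (\sum_(0 <= x < M) \sum_(1 <= l < N) flanked x l poor s + high_count cc K s <= distinct s)%N.
Proof.
rewrite addnC -leq_subRL; last exact: size_high_distinct.
have uh : uniq (high cc K (edges s)) by rewrite filter_uniq// undup_uniq.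
set r := [seq x <- undup s | x \notin high cc K (edges s)].
apply: (@leq_trans (size r)); last first.
  rewrite leq_subRL; last exact: size_high_distinct.
  rewrite -size_cat; apply: uniq_leq_size.
    rewrite cat_uniq uh filter_uniq ?undup_uniq// andbT; apply/hasPn => x.
    by rewrite mem_filter => /andP[].
  move=> x; rewrite mem_cat => /orP[|]; last by rewrite mem_filter => /andP[].
  rewrite mem_filter => /andP[_]; rewrite !mem_undup mem_cat.
  by case/orP => /mapP[e /edgesP[j js ->] ->] /=; rewrite mem_nth//; exact: ltnW.
apply: (@leq_trans (\sum_(0 <= x < M) (x \in r))%N); last exact: sum_mem_le.
apply: leq_sum => x _; apply: leq_trans (sum_flanked_le x poor s N) _.
case e : (flanks x s) => [t|//]; rewrite mem_filter mem_high (flanks_deg cc e) mem_undup (flanks_in e).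
by rewrite /poor /selected -ltnNge andbC.
Qed.

End FlankedCounts.

Section MeanDegree.
Context {R : realType}.
Local Notation cl x := `|Num.ceil x|%N.
Variables (p : nat -> R) (gamma : R).
Hypothesis gamma01 : 0 < gamma < 1.
Hypothesis p_gt0 : forall i, (1 <= i)%N -> 0 < p i.
Hypothesis p_noninc : forall i j, (1 <= i)%N -> (i <= j)%N -> p j <= p i.
Hypothesis p_sum : (\sum_(1 <= i <oo) (p i)%:E = 1)%E.
Hypothesis p_rv : regularly_varying p (- gamma^-1).
Local Notation w := (weight p).
Let w_ge0 := weight_ge0 p_gt0.
Let w_sum := weight_sum p_gt0 p_sum.
Let p_cvg0 := weight_pos_cvg p_gt0 p_sum.
Local Notation Ex := (Ex w).
Local Notation r := (sibuya gamma).
Let w01 x : 0 <= w x <= 1. Proof. by rewrite w_ge0 (w_le1 w_ge0 w_sum). Qed.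

Lemma Ex_seconds l (f : seq nat -> R) : Ex (2 * l) (fun t => f (seconds t)) = Ex l f.
Proof.
elim: l f => [|l IH] f; first by rewrite muln0.
rewrite (_ : 2 * l.+1 = (2 * l).+2)%N; last by lia.
rewrite -[RHS](avg_cst w_ge0 w_sum) /=; congr avg; apply/funext => b.
by congr avg; apply/funext => c; rewrite -(IH (fun t => f (c :: t))).
Qed.

Lemma Ex_rich cc K l : Ex (2 * l) (fun t => (rich cc K t)%:R) =
  rangeF p K (if cc then 2 * l else l)%N.
Proof.
by rewrite /rich /selected /rangeF; case: cc => //; exact: (Ex_seconds l (fun t => (K <= distinct t)%:R)).
Qed.

Lemma Ex_poor cc K l : Ex (2 * l) (fun t => (poor cc K t)%:R) =
  1 - rangeF p K (if cc then 2 * l else l)%N.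
Proof.
rewrite -Ex_rich -[X in X - _](Ex_cst w_ge0 w_sum (2 * l)) -(ExB w_ge0 w_sum); last 2 first.
- exact: bnds_cst.
- exact: bnds_bool.
by apply: eq_Ex => t _; rewrite /rich /poor; case: leqP; rewrite ?subrr ?subr0.
Qed.

Lemma bernoulli_ineq (y : R) n : 0 <= y <= 1 -> 1 - (1 - y) ^+ n <= n%:R * y.
Proof.
move=> /andP[y0 y1]; elim: n => [|n IH]; first by rewrite expr0 mul0r subrr.
have h : 0 <= (1 - y) ^+ n <= 1 by rewrite exprn_ge0 ?exprn_ile1 ?subr_ge0 ?gerBl.
by rewrite exprS -natr1; move: IH h; set P := _ ^+ _; move=> IH /andP[h1 h2]; nra.
Qed.

Lemma ffact_ge n l : ((n - l) ^ l <= n ^_ l)%N.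
Proof.
rewrite ffact_prod -[X in (_ ^ X)%N](card_ord l) -prod_nat_const leq_prod// => i _.
by rewrite leq_sub2l// ltnW.
Qed.

(** A lower estimate of the binomial coefficient divided by m^l, with limit 1 / l!. *)
Let coef m l : R := ((m - 3 * l)%:R / m%:R) ^+ l / l`!%:R.

Lemma coef_le m l : (0 < m)%N -> coef m l * m%:R ^+ l <= 'C(m - 2 * l, l)%:R.
Proof.
move=> m0; rewrite /coef expr_div_n mulrAC divfK; last by rewrite expf_neq0// pnatr_eq0 -lt0n.
rewrite ler_pdivrMr ?ltr0n ?fact_gt0// -natrX -natrM ler_nat bin_ffact.
by apply: leq_trans (ffact_ge _ _); rewrite (_ : m - 3 * l = m - 2 * l - l)%N//; lia.
Qed.

Let pser m l (i : nat) (x : nat) : R := (m%:R * w x) ^+ i * (1 - w x) ^+ (m - 3 * l).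

(** Requiring the flanks to avoid [x] costs at most 2 l w_x by Bernoulli's inequality. This gives
    the second term, one power of m w_x higher but divided by m, hence negligible. *)
Lemma Ex_flanked_ge m x l (h : pred (seq nat)) : (0 < m)%N ->
  coef m l * (Ex (2 * l) (fun t => (h t)%:R) * pser m l l x - (2 * l)%:R / m%:R * pser m l l.+1 x) <=
  Ex m (fun s => (flanked x l h s)%:R).
Proof.
move=> m0; rewrite (Ex_flanked w_ge0 w_sum); have /andP[x0 x1] := w01 x.
set E := Ex (2 * l) (fun t => (h t)%:R); set E' := Ex (2 * l) _.
have EE : E - (2 * l)%:R * w x <= E'.
  rewrite lerBlDr -lerBlDl; apply: le_trans (bernoulli_ineq (2 * l) (w01 x)).
  rewrite -(Ex_in w_ge0 w_sum) lerBlDr -(ExD w_ge0 w_sum); [|exact: bnds_bool..].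
  apply: Ex_le => //; [exact: bnds_bool|by apply: bndsD; exact: bnds_bool|move=> t _].
  by case: (h t); case: (x \in t); rewrite /= ?addr0 ?add0r ?lerDl.
have c0 : 0 <= coef m l by rewrite divr_ge0// exprn_ge0// divr_ge0.
have E'0 : 0 <= E' by apply: Ex_ge0 => //; exact: bnds_bool.
have A0 : 0 <= w x ^+ l * (1 - w x) ^+ (m - 3 * l) by rewrite mulr_ge0 ?exprn_ge0 ?subr_ge0.
apply: (@le_trans _ _ (coef m l * m%:R ^+ l * (w x ^+ l * (1 - w x) ^+ (m - 3 * l)) * (E - (2 * l)%:R * w x))).
  rewrite le_eqVlt; apply/orP; left; apply/eqP; rewrite /pser !exprMn exprS.
  have := pnatr_eq0 R m; rewrite -[(m == 0)%N]negbK -lt0n m0 /= => mn0.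
  move: (m%:R) mn0 => z z0; set a := z ^+ l; set b := w x ^+ l; set e := _ ^+ (m - _).
  by rewrite [w x ^+ l.+1]exprS -/b; field; rewrite z0.
apply: (@le_trans _ _ (coef m l * m%:R ^+ l * (w x ^+ l * (1 - w x) ^+ (m - 3 * l)) * E')).
  by rewrite ler_wpM2l// mulr_ge0// mulr_ge0// exprn_ge0.
by rewrite !mulrA !ler_wpM2r ?coef_le ?exprn_ge0 ?subr_ge0.
Qed.

Lemma sum_cvg (f : nat -> nat -> R) (g : nat -> R) N : (forall l, (0 < l)%N -> f l @ \oo --> g l) ->
  (fun M => \sum_(1 <= l < N) f l M) @ \oo --> \sum_(1 <= l < N) g l.
Proof.
move=> h; elim: N => [|N IH].
  by rewrite big_geq// (_ : (fun M => _) = fun=> 0); [exact: cvg_cst|apply/funext => M; rewrite big_geq].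
case: N IH => [|N] IH.
  by rewrite big_geq// (_ : (fun M => _) = fun=> 0); [exact: cvg_cst|apply/funext => M; rewrite big_geq].
rewrite big_nat_recr//= (_ : (fun M => _) = (fun M => \sum_(1 <= l < N.+1) f l M + f N.+1 M)).
  by apply: cvgD => //; exact: h.
by apply/funext => M; rewrite big_nat_recr.
Qed.

(** Sample sizes at the scale a = 1, where the mean range is asymptotic to Gamma(1 - gamma) k. *)
Let m k := cl (1 / p k).
Let mp : (m k)%:R * p k @[k --> \oo] --> (1 : R). Proof. exact: scale_cvg. Qed.
Let m_y : m @ \oo --> \oo. Proof. exact: scale_cvgy. Qed.
Let k_y : (fun k : nat => k) @ \oo --> \oo. Proof. exact: cvg_id. Qed.

Let pser_cvg n l i : (0 < i)%N -> cvgn (series (pser n l i)).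
Proof.
move=> i0; case: i i0 => // i _.
rewrite (_ : pser n l i.+1 = (fun x => w x * (n%:R ^+ i.+1 * w x ^+ i * (1 - w x) ^+ (n - 3 * l)))); last first.
  by apply/funext => x; rewrite /pser exprMn [w x ^+ i.+1]exprS; ring.
apply: (avg_cvg w_ge0 w_sum); exists (n%:R ^+ i.+1) => x; have /andP[x0 x1] := w01 x.
rewrite ger0_norm ?mulr_ge0 ?exprn_ge0 ?subr_ge0// -mulrA ler_piMr ?exprn_ge0//.
by rewrite mulr_ile1 ?exprn_ge0 ?exprn_ile1 ?subr_ge0// gerBl.
Qed.

(** [Y] is not yet known to converge, so the conclusion offers a minorant that does. The mean number
    of symbols with l separated visits, divided by k, tends to gamma Gamma(l - gamma) / l!, that is
    Gamma(1 - gamma) r_l, and the flanks contribute the mean of [h]. *)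
Lemma flanked_lower (h : pred (seq nat)) N (Y : nat -> R) :
  (forall n M, Ex n (fun s => (\sum_(0 <= x < M) \sum_(1 <= l < N) flanked x l h s)%:R) <= Y n) ->
  exists2 LB : nat -> R, \forall k \near \oo, LB k <= Y (m k) / k%:R &
    LB @ \oo --> Gamma (1 - gamma) * \sum_(1 <= l < N) r l * Ex (2 * l) (fun t => (h t)%:R).
Proof.
move=> hY; pose E l := Ex (2 * l) (fun t => (h t)%:R).
pose s l i k := limn (series (pser (m k) l i)).
exists (fun k => \sum_(1 <= l < N) coef (m k) l * (E l * (s l l k / k%:R) - (2 * l)%:R / (m k)%:R * (s l l.+1 k / k%:R))).
  near=> k; have m0 : (0 < m k)%N by near: k; move/cvgnyPgt: m_y; exact.
  have k0 : (0 < k)%N by near: k; exact: nbhs_infty_gt.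
  rewrite ler_pdivlMr ?ltr0n// mulr_suml.
  rewrite (eq_big_nat _ _ (F2 := fun l => coef (m k) l * (E l * s l l k - (2 * l)%:R / (m k)%:R * s l l.+1 k))); last first.
    by move=> l _; field; rewrite !pnatr_eq0 -!lt0n m0.
  apply: (@ler_cvg_to _ \oo _ _ (fun M => \sum_(1 <= l < N) coef (m k) l * (E l * series (pser (m k) l l) M -
       (2 * l)%:R / (m k)%:R * series (pser (m k) l l.+1) M)) (fun=> Y (m k))).
  - apply: (@sum_cvg (fun l M => coef (m k) l * (E l * series (pser (m k) l l) M -
       (2 * l)%:R / (m k)%:R * series (pser (m k) l l.+1) M))) => l l0; apply: cvgM; first exact: cvg_cst.
    by apply: cvgB; apply: cvgM; [exact: cvg_cst|exact: pser_cvg|exact: cvg_cst|exact: pser_cvg].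
  - exact: cvg_cst.
  apply: nearW => M; apply: le_trans (hY (m k) M).
  rewrite (_ : Ex _ _ = \sum_(1 <= l < N) \sum_(0 <= x < M) Ex (m k) (fun s => (flanked x l h s)%:R)); last first.
    rewrite exchange_big /=.
    rewrite (eq_bigr (fun x => Ex (m k) (fun s' => \sum_(1 <= l < N) (flanked x l h s')%:R))); last first.
      by move=> x _; rewrite (Ex_sum w_ge0 w_sum)// => l; exact: bnds_bool.
    rewrite -(Ex_sum w_ge0 w_sum); last first.
      by move=> x; apply: bnds_sum => l; exact: bnds_bool.
    by apply: eq_Ex => s' _; rewrite natr_sum; apply: eq_bigr => x _; rewrite natr_sum.
  apply: ler_sum => l _; rewrite /series /= !mulr_sumr -sumrB mulr_sumr.
  by apply: ler_sum => x _; exact: Ex_flanked_ge.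
have minv : (fun k => ((m k)%:R)^-1 : R) @ \oo --> (0 : R).
  have c : (fun n : nat => (n%:R : R)^-1) @ \oo --> (0 : R) by rewrite -cvg_shiftS; exact: cvg_harmonic.
  exact: (cvg_comp _ _ m_y c).
rewrite mulr_sumr; apply: sum_cvg => l l0.
have hs i : (0 < i)%N -> s l i k / k%:R @[k --> \oo] --> 1 `^ gamma * (gamma * Gamma (i%:R - gamma)).
  move=> i0; apply: (karlin_pois gamma01 p_gt0 p_noninc p_sum p_rv k_y ltr01 mp (l := i) (c := 3 * l)) => // k.
  exact: pser_cvg.
have hc : coef (m k) l @[k --> \oo] --> (l`!%:R : R)^-1.
  rewrite -[X in _ --> X]mul1r; apply: cvgM; last exact: cvg_cst.
  rewrite -[X in _ --> X](expr1n _ l); apply: (cvg_comp _ (fun y : R => y ^+ l)); last exact: exprn_continuous.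
  have h0 : (fun k => 1 - (3 * l)%:R * ((m k)%:R)^-1) @ \oo --> (1 - (3 * l)%:R * 0 : R).
    by apply: cvgB; [exact: cvg_cst|apply: cvgM => //; exact: cvg_cst].
  rewrite mulr0 subr0 in h0; apply: cvg_trans h0; apply: near_eq_cvg; near=> k.
  have ml : (3 * l < m k)%N by near: k; move/cvgnyPgt: m_y; exact.
  by rewrite natrB ?(ltnW ml)// mulrBl divff// pnatr_eq0 -lt0n; lia.
rewrite (_ : Gamma (1 - gamma) * _ = (l`!%:R)^-1 * (E l * (1 `^ gamma * (gamma * Gamma (l%:R - gamma))) -
   (2 * l)%:R * 0 * (1 `^ gamma * (gamma * Gamma (l.+1%:R - gamma))))); last first.
  rewrite powR1 /sibuya Gamma_nat -/(E l) mulr0 mul0r subr0 mul1r.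
  by field; rewrite pnatr_eq0 -lt0n fact_gt0 gt_eqF// GammaC_gt0.
apply: cvgM => //; apply: cvgB.
  by apply: cvgM; [exact: cvg_cst|exact: hs].
apply: cvgM; last exact: hs.
by apply: cvgM => //; exact: cvg_cst.
Unshelve. all: by end_near. Qed.

Lemma sum_sibuya N : \sum_(1 <= l < N.+1) r l = 1 - sib gamma N.+1.
Proof.
elim: N => [|N IH]; first by rewrite big_geq// sib1 subrr.
by rewrite big_nat_recr//= IH (sibuya_diff gamma01)//; ring.
Qed.

(** Both [X] and [D - X] have minorants, whose limits add up to Gamma(1 - gamma) (1 - sib N), while
    D / k tends to Gamma(1 - gamma). This pins X / k down to within the Sibuya tail beyond N. *)
Lemma mean_high_cvg cc K (L : R) : (0 < K)%N ->
  (fun M => \sum_(1 <= l < M) r l * rangeF p K (if cc then 2 * l else l)%N) @ \oo --> L ->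
  Ex (cl (1 / p k)) (fun s => (high_count cc K s)%:R) / k%:R @[k --> \oo] --> Gamma (1 - gamma) * L.
Proof.
move=> K0 hL; have G0 := GammaC_gt0 gamma01.
pose X n := Ex n (fun s => (high_count cc K s)%:R); pose D n := Ex n (fun s => (distinct s)%:R).
have bX n : bnds n (fun s => (high_count cc K s)%:R : R) by exact: bnds_high.
have bD n : bnds n (fun s => (distinct s)%:R : R) by exact: bnds_distinct.
have bF h n M N : bnds n (fun s => (\sum_(0 <= x < M) \sum_(1 <= l < N) flanked x l h s)%:R : R).
  rewrite (_ : (fun s => _) = (fun s => \sum_(0 <= x < M) \sum_(1 <= l < N) (flanked x l h s)%:R)).
    by apply: bnds_sum => x; apply: bnds_sum => l; exact: bnds_bool.
  by apply/funext => s; rewrite natr_sum; apply: eq_bigr => x _; rewrite natr_sum.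
have hD : D (m k) / k%:R @[k --> \oo] --> Gamma (1 - gamma).
  have := mean_distinct_cvg gamma01 p_gt0 p_noninc p_sum p_rv ltr01.
  by rewrite powR1 mul1r.
have Ipos l : (0 < l)%N -> 0 < r l by exact: sibuya_gt0.
apply/cvgrPdist_le => e e0; set G := Gamma _ in G0 hD *.
have e3 : 0 < e / (3 * G) by rewrite divr_gt0// mulr_gt0.
have hs := sib_cvg0 gamma01.
near \oo => N0; pose N := N0.+1.
(* The error splits in three: the Sibuya tail, the truncation of the series for [L], and the
   convergence in k. The divisor G compensates for the prefactor. *)
have sN : sib gamma N < e / (3 * G) by rewrite /N; near: N0; move: hs; rewrite -cvg_shiftS => hs; exact: (cvgr_lt _ hs).
pose TN : R := \sum_(1 <= l < N) r l * rangeF p K (if cc then 2 * l else l)%N.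
have TNL : `|L - TN| <= e / (3 * G).
  rewrite /TN /N; near: N0; move: hL; rewrite -cvg_shiftS => /cvgrPdist_le; exact.
have [LB1 h1 c1] : exists2 LB : nat -> R, \forall k \near \oo, LB k <= X (m k) / k%:R & LB @ \oo --> G * TN.
  have [|LB a b] := @flanked_lower (rich cc K) N X.
    move=> n M; apply: Ex_le => // s _; rewrite ler_nat; exact: sum_rich_le.
  exists LB => //; rewrite /TN (eq_bigr (fun l => r l * Ex (2 * l) (fun t => (rich cc K t)%:R)))//.
  by move=> l _; rewrite Ex_rich.
have [LB2 h2 c2] : exists2 LB : nat -> R, \forall k \near \oo, LB k <= (D (m k) - X (m k)) / k%:R &
    LB @ \oo --> G * (1 - sib gamma N - TN).
  have [|LB a b] := @flanked_lower (poor cc K) N (fun n => D n - X n).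
    move=> n M; rewrite /D /X -(ExB w_ge0 w_sum)//; apply: Ex_le => //; first exact: bndsB.
    by move=> s _; rewrite lerBrDr -natrD ler_nat; exact: sum_poor_le.
  exists LB => //; rewrite -sum_sibuya /TN -sumrB.
  rewrite (eq_bigr (fun l => r l * Ex (2 * l) (fun t => (poor cc K t)%:R)))//.
  by move=> l _; rewrite Ex_poor; ring.
have Ge : G * (e / (3 * G)) = e / 3 by field; rewrite gt_eqF.
have u1 : \forall k \near \oo, G * TN - e / 3 <= LB1 k by apply: (cvgr_ge _ c1); lra.
have c3 : (fun k => D (m k) / k%:R - LB2 k) @ \oo --> G - G * (1 - sib gamma N - TN) by exact: cvgB.
have u2 : \forall k \near \oo, D (m k) / k%:R - LB2 k <= G - G * (1 - sib gamma N - TN) + e / 3.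
  by apply: (cvgr_le _ c3); lra.
near=> k; rewrite -/(X (m k)).
have v1 : G * TN - e / 3 <= X (m k) / k%:R.
  by apply: (@le_trans _ _ (LB1 k)); near: k.
have v2 : X (m k) / k%:R <= G - G * (1 - sib gamma N - TN) + e / 3.
  apply: (@le_trans _ _ (D (m k) / k%:R - LB2 k)); last by near: k.
  have : LB2 k <= (D (m k) - X (m k)) / k%:R by near: k.
  by rewrite mulrBl; lra.
move: TNL v1 v2 Ge sN; rewrite !ler_norml; set y := X _ / _; set q := e / (3 * G); set sg := sib _ _.
by move=> /andP[t1 t2] v1 v2 Ge sN; apply/andP; split; nra.
Unshelve. all: by end_near. Qed.

End MeanDegree.

(** * From lists to trajectories *)

Section SampleLaw.
Context {R : realType} d {T : measurableType d} (P : probability T R).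
Variables (p : nat -> R) (xi : nat -> {RV P >-> nat}).
Hypothesis p_gt0 : forall i, (1 <= i)%N -> 0 < p i.
Hypothesis p_sum : (\sum_(1 <= i <oo) (p i)%:E = 1)%E.
Hypothesis hxi : iid_sample p xi.
Local Notation w := (weight p).
Let w_ge0 := weight_ge0 p_gt0.
Let w_sum := weight_sum p_gt0 p_sum.
Local Notation Ex := (Ex w).

Definition sample n (t : T) : seq nat := mkseq (fun i => xi i.+1 t) n.

Lemma sampleS n t : sample n.+1 t = rcons (sample n t) (xi n.+1 t).
Proof. exact: mkseqS. Qed.

Lemma size_sample n t : size (sample n t) = n.
Proof. exact: size_mkseq. Qed.

Let xi_measurable n x : measurable (xi n @^-1` [set x]).
Proof. exact: measurable_funPTI. Qed.

Lemma measurable_sample n (q : pred (seq nat)) : measurable [set t | q (sample n t)].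
Proof.
elim: n q => [|n IH] q.
  rewrite /sample /mkseq /=; case: (q [::]); first by rewrite (_ : [set _ | _] = setT)//; apply/seteqP; split.
  by rewrite (_ : [set _ | _] = set0)//; apply/seteqP; split.
rewrite (_ : [set t | _] = \bigcup_x (xi n.+1 @^-1` [set x] `&` [set t | q (rcons (sample n t) x)])).
  apply: bigcupT_measurable => x; apply: measurableI => //.
  exact: (IH (fun s => q (rcons s x))).
apply/seteqP; split => [t /= h|t [x _ [/= <-]]]; last by rewrite sampleS.
by exists (xi n.+1 t) => //; split => //=; rewrite -sampleS.
Qed.

Let prob_xi n x : (0 < n)%N -> P (xi n @^-1` [set x]) = (w x)%:E.
Proof.
case: hxi => pos law _ n0; case: x => [|x]; last by rewrite law.
rewrite (_ : _ @^-1` _ = set0) ?measure0//; apply/seteqP; split => // t /= e.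
by have := pos n t n0; rewrite e.
Qed.

Lemma prob_sample_eq u : P [set t | sample (size u) t = u] = (\prod_(x <- u) w x)%:E.
Proof.
case: hxi => pos law indep; set n := size u.
pose J := [fset i in iota 1 n]%fset.
have memJ i : (i \in J) = (1 <= i < n.+1)%N by rewrite !inE mem_iota add1n.
have := indep J (fun i => [set nth 0%N u i.-1]).
rewrite (_ : \bigcap_(i in _) _ = [set t | sample n t = u]); last first.
  apply/seteqP; split => t /= h.
    apply: (@eq_from_nth _ 0%N); rewrite size_sample// => i ilt.
    by rewrite nth_mkseq//; apply: (h i.+1); rewrite /= memJ; apply/andP; split.
  move=> i; rewrite /= memJ => /andP[i1 ilt].
  by rewrite -h nth_mkseq ?prednK//; lia.
move=> ->//; last first.
  by move=> i /=; rewrite memJ => /andP[].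
rewrite (perm_big (iota 1 n)) /=; last first.
  apply: uniq_perm; [exact: fset_uniq|exact: iota_uniq|move=> i].
  by rewrite memJ mem_iota add1n.
rewrite (_ : iota 1 n = index_iota 1 n.+1); last by rewrite /index_iota subn1.
rewrite big_add1 /= [in RHS](big_nth 0%N) -prodEFin.
by apply: eq_big_nat => i _; rewrite prob_xi.
Qed.

(** The known prefix is generalised so that the induction on the remaining number of draws can
    append one value to it; countable additivity over this value reproduces the outer series of
    [Ex]. *)
Lemma prob_prefix n u (q : pred (seq nat)) :
  P [set t | sample (size u) t = u /\ q (sample (size u + n) t)] =
  ((\prod_(x <- u) w x) * Ex n (fun s => (q (u ++ s))%:R))%:E.
Proof.
elim: n u => [|n IH] u.
  rewrite addn0 /= cats0; case qu : (q u).
    rewrite mulr1 -prob_sample_eq; congr (P _); apply/seteqP; split => t /=; first by case.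
    by move=> e; split=> //; rewrite e.
  rewrite mulr0 (_ : [set _ | _] = set0) ?measure0//; apply/seteqP; split => // t /= [-> ].
  by rewrite qu.
pose A x := [set t | sample (size (rcons u x)) t = rcons u x /\ q (sample (size (rcons u x) + n) t)].
have mA x : measurable (A x).
  rewrite (_ : A x = [set t | (take (size u).+1 (sample (size u + n.+1) t) == rcons u x) && q (sample (size u + n.+1) t)]).
    exact: (measurable_sample _ (fun s => (take (size u).+1 s == rcons u x) && q s)).
  have tk t : take (size u).+1 (sample (size u + n.+1) t) = sample (size u).+1 t.
    by rewrite /sample /mkseq -map_take take_iota (minn_idPl _)//; lia.
  apply/seteqP; split => t /=; rewrite /A /= size_rcons addSnnS tk.
    by case=> -> ->; rewrite eqxx.
  by case/andP => /eqP.
rewrite (_ : [set _ | _] = \bigcup_x A x); last first.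
  apply/seteqP; split => t /=.
    case=> e1 e2; exists (xi (size u).+1 t) => //; rewrite /A /= size_rcons addSnnS; split=> //.
    by rewrite sampleS e1.
  case=> x _; rewrite /A /= size_rcons addSnnS sampleS => -[/eqP]; rewrite eqseq_rcons => /andP[/eqP ? _] ?.
  by split.
rewrite measure_semi_bigcup//; last 2 first.
- apply/trivIsetP => x y _ _ xy; apply/seteqP; split => // t [].
  rewrite /A /= !size_rcons => -[e1 _] [e2 _]; have : rcons u x = rcons u y by rewrite -e1 -e2.
  by move=> /eqP; rewrite eqseq_rcons => /andP[_ /eqP e]; rewrite e eqxx in xy.
- exact: bigcupT_measurable.
pose f x := Ex n (fun s => (q (u ++ x :: s))%:R).
have bf : bnd f by exists 1 => x; apply: Ex_norm => // s _; case: (q _); rewrite ?normr1 ?normr0.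
rewrite (eq_eseriesr (g := fun x => ((\prod_(y <- u) w y) * (w x * f x))%:E)); last first.
  move=> x _; transitivity ((\prod_(y <- rcons u x) w y * Ex n (fun s => (q (rcons u x ++ s))%:R))%:E).
    exact: (IH (rcons u x)).
  rewrite -cats1 big_cat /= big_seq1 mulrA /f; congr (_ * _)%:E.
  by apply: eq_Ex => s _; rewrite -catA.
apply: nneseries_real; rewrite [Ex _ _]/= -/(f _).
rewrite (_ : (fun N => _) = (fun N => (\prod_(y <- u) w y) * series (fun x => w x * f x) N)); last first.
  by apply/funext => N; rewrite /series /= mulr_sumr.
by apply: cvgM; [exact: cvg_cst|exact: (avg_cvg w_ge0 w_sum bf)].
Qed.

Lemma prob_sample n (q : pred (seq nat)) : P [set t | q (sample n t)] = (Ex n (fun s => (q s)%:R))%:E.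
Proof.
have := prob_prefix n [::] q; rewrite big_nil mul1r add0n => <-.
by congr (P _); apply/seteqP; split => t /=; [split|case].
Qed.

End SampleLaw.

Section Graph.
Variable s : nat -> nat.
Implicit Types n k x y : nat.
Local Notation path n := (mkseq (fun i => s i.+1) n).

Lemma card_fset_seq (A : {fset nat}) (l : seq nat) : uniq l -> (forall x, (x \in A) = (x \in l)) ->
  #|` A|%fset = size l.
Proof. by move=> ul h; apply/perm_size/uniq_perm => //; exact: fset_uniq. Qed.

Lemma mem_visited n x : (x \in visited s n) = (x \in path n).
Proof.
rewrite /mkseq; apply/imfsetP/mapP => /= -[i].
  rewrite mem_iota => /andP[i1 i2] ->; exists i.-1; last by rewrite prednK.
  by rewrite mem_iota; lia.
by rewrite mem_iota => h ->; exists i.+1 => //; rewrite mem_iota; lia.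
Qed.

Lemma range_sizeE n : range_size s n = distinct (path n).
Proof.
apply: card_fset_seq; first exact: undup_uniq.
by move=> x; rewrite mem_undup mem_visited.
Qed.

Lemma transitions_edges n x y : (1 <= transitions s n x y)%N = ((x, y) \in edges (path n)).
Proof.
rewrite /transitions lt0n sum_nat_seq_neq0; apply/hasP/edgesP => [[i]|[j]]; rewrite ?size_mkseq.
  rewrite mem_index_iota eqb0 negbK /= => /andP[i1 i2] /andP[/eqP ex /eqP ey].
  exists i.-1; first by rewrite prednK.
  by rewrite !nth_mkseq ?prednK//; [rewrite ex ey|lia].
move=> jn; rewrite !nth_mkseq//; last by lia.
by case=> -> ->; exists j.+1; rewrite ?mem_index_iota//= !eqxx.
Qed.

Lemma out_degreeE n x : out_degree_noloop s n x = deg false (edges (path n)) x.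
Proof.
rewrite degE; apply: card_fset_seq; first by rewrite filter_uniq// undup_uniq.
move=> y; rewrite in_fsetD1 in_out_nbrs transitions_edges mem_filter /adj /= orbF.
case: (boolP (_ && _)) => //= h.
by have /adj_vertices /andP[_ ->] : adj false (edges (path n)) x y by rewrite /adj /= orbF.
Qed.

Lemma degreeE n x : degree_noloop s n x = deg true (edges (path n)) x.
Proof.
rewrite degE; apply: card_fset_seq; first by rewrite filter_uniq// undup_uniq.
move=> y; rewrite in_fsetD1 in_nbrs addn_gt0 !transitions_edges mem_filter.
rewrite -/(adj true (edges (path n)) x y); case: (boolP (adj _ _ _ _)) => //= h.
by have /andP[_ ->] := adj_vertices h.
Qed.

(** Degree exactly k is degree at least k without degree at least k + 1. Since k > 0, a symbol of
    that degree lies on an edge, so the vertices of the edge list miss none of them. *)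
Lemma degree_countE cc n k (A : {fset nat}) : (0 < k)%N ->
  (forall x, (x \in A) = (x \in visited s n) && (deg cc (edges (path n)) x == k)) ->
  (#|` A|%fset + high_count cc k.+1 (path n) = high_count cc k (path n))%N.
Proof.
move=> k0 hA; set E := edges (path n).
rewrite (@card_fset_seq _ [seq x <- high cc k E | deg cc E x == k]); last 2 first.
- by rewrite !filter_uniq// undup_uniq.
- move=> x; rewrite hA mem_visited !mem_filter -/E andbC; case: eqP => //= e.
  rewrite e leqnn /=; apply/idP/idP.
    move=> _; have : (0 < deg cc E x)%N by rewrite e.
    by rewrite -has_count => /hasP[y _ /adj_vertices /andP[]].
  rewrite mem_undup mem_cat => /orP[] /mapP[f /edgesP[j js ->] ->] /=; rewrite mem_nth//.
  exact: ltnW.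
rewrite /high_count -/E (_ : high cc k.+1 E = [seq x <- high cc k E | deg cc E x != k]).
  rewrite size_filter [X in (_ + X)%N]size_filter.
  exact: (count_predC (fun x => deg cc E x == k) (high cc k E)).
rewrite /high -filter_predI; apply: eq_filter => x /=.
by rewrite ltn_neqAle eq_sym.
Qed.

Lemma out_degree_countE n k : (0 < k)%N ->
  (out_degree_count_noloop s n k + high_count false k.+1 (path n) = high_count false k (path n))%N.
Proof.
by move=> k0; apply: degree_countE => // x; rewrite !inE /= out_degreeE.
Qed.

Lemma undirected_degree_countE n k : (0 < k)%N ->
  (degree_count_noloop s n k + high_count true k.+1 (path n) = high_count true k (path n))%N.
Proof.
by move=> k0; apply: degree_countE => // x; rewrite !inE /= degreeE.
Qed.

End Graph.

(** * Almost sure convergence *)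

Section Interpolation.
Context {R : realType}.

(** [J n] is the largest index j with [N j <= n]; it exists because N tends to infinity. *)
Lemma interpolate (N : nat -> nat) : N @ \oo --> \oo ->
  exists2 J : nat -> nat, J @ \oo --> \oo & \forall n \near \oo, (N (J n) <= n < N (J n).+1)%N.
Proof.
move=> Ny.
have ex n : exists J, (N 0%N <= n)%N -> (N J <= n)%N /\ forall j, (N j <= n)%N -> (j <= J)%N.
  have [h|h] := leqP (N 0%N) n; last by exists 0%N.
  have /cvgnyPgt/(_ n)[B _ hB] := Ny.
  have b j : (N j <= n)%N -> (j <= B)%N.
    by move=> hj; rewrite leqNgt; apply/negP => /ltnW /hB /=; lia.
  have e : exists j, (N j <= n)%N by exists 0%N.
  by case: (ex_maxnP e b) => J J1 J2; exists J => _; split.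
have [J hJ] := choice ex; exists J.
  apply/cvgnyPge => A; near=> n.
  have n0 : (N 0%N <= n)%N by near: n; exact: nbhs_infty_ge.
  have nA : (N A <= n)%N by near: n; exact: nbhs_infty_ge.
  by have [_] := hJ n n0; exact.
near=> n; have n0 : (N 0%N <= n)%N by near: n; exact: nbhs_infty_ge.
have [-> h] := hJ n n0; rewrite ltnNge; apply/negP => /h; lia.
Unshelve. all: by end_near. Qed.

(** Monotonicity encloses [y n] between the values at the two surrounding subsequence times, whose
    normalisations have ratio tending to 1. *)
Lemma interpolate_cvg (N J : nat -> nat) (y : nat -> R) (c : R) :
  J @ \oo --> \oo -> (\forall n \near \oo, (N (J n) <= n < N (J n).+1)%N) ->
  (forall n, 0 <= y n) -> {homo y : m n / (m <= n)%N >-> m <= n} ->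
  (fun j => y (N j) / j.+1%:R ^+ 2) @ \oo --> c ->
  (fun n => y n / (J n).+1%:R ^+ 2) @ \oo --> c.
Proof.
move=> Jy hJ y0 ym hy.
have h1 := cvg_comp _ _ Jy hy.
have hr : (fun j => (j.+2%:R / j.+1%:R : R) ^+ 2) @ \oo --> (1 : R).
  have h0 : (fun j : nat => (1 + (j.+1%:R : R)^-1)) @ \oo --> (1 + 0 : R).
    by apply: cvgD; [exact: cvg_cst|exact: cvg_harmonic].
  rewrite addr0 in h0.
  have h2 : (fun j : nat => (1 + (j.+1%:R : R)^-1) * (1 + (j.+1%:R : R)^-1)) @ \oo --> (1 * 1 : R) by exact: cvgM.
  rewrite mulr1 in h2; apply: cvg_trans h2; apply: near_eq_cvg; apply: nearW => j /=.
  by rewrite -[j.+2%:R]natr1 [X in _ = X ^+ 2]mulrDl divff ?pnatr_eq0// div1r expr2.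
have hy2 : (fun j => y (N j.+1) / j.+1%:R ^+ 2) @ \oo --> c.
  have hS : (fun j => y (N j.+1) / j.+2%:R ^+ 2) @ \oo --> c by rewrite (cvg_shiftS (fun j => y (N j) / j.+1%:R ^+ 2)).
  rewrite -[c]mulr1; apply: cvg_trans (cvgM hS hr); apply: near_eq_cvg; apply: nearW => j /=.
  by rewrite expr_div_n mulrA divfK// expf_neq0// pnatr_eq0.
have h2 := cvg_comp _ _ Jy hy2.
apply: (@squeeze_cvgr _ _ _ _ _ _ _ _ _ h1 h2).
near=> n; have /andP[a b] : (N (J n) <= n < N (J n).+1)%N by near: n.
by rewrite /= !ler_wpM2r ?invr_ge0 ?sqr_ge0// ym// ltnW.
Unshelve. all: by end_near. Qed.

Lemma sum_inv_sq_le n : \sum_(0 <= j < n) (j.+1%:R ^+ 2)^-1 <= 2 :> R.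
Proof.
suff h m : \sum_(0 <= j < m.+1) (j.+1%:R ^+ 2)^-1 <= 2 - (m.+1%:R)^-1 :> R.
  case: n => [|n]; first by rewrite big_geq.
  by apply: le_trans (h n) _; rewrite gerBl invr_ge0.
elim: m => [|m IH]; first by rewrite big_nat1 expr1n invr1; lra.
rewrite big_nat_recr//=; apply: le_trans (lerD IH (lexx _)) _.
have a0 : 0 < m.+1%:R :> R by rewrite ltr0n.
rewrite -[m.+2%:R]natr1; move: (m.+1%:R) a0 => a a0.
have a1 : 0 < a + 1 by lra.
rewrite -lerBrDl (_ : 2 - (a + 1)^-1 - (2 - a^-1) = (a * (a + 1))^-1); last by field; rewrite !gt_eqF.
by rewrite lef_pV2 ?posrE ?exprn_gt0 ?mulr_gt0// expr2 ler_wpM2r ?(ltW a1)//; lra.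
Qed.

End Interpolation.

Section AlmostSure.
Context {R : realType} d {T : measurableType d} (P : probability T R).

(** The deviation probabilities are summable, so Borel-Cantelli applies to each precision 1 / (i +
    1); the countable union over i is still negligible. *)
Lemma as_cvg_square (Y : nat -> T -> R) (e : nat -> R) (c : R) :
  (forall eps : R, 0 < eps -> exists2 C : R, 0 <= C & forall j,
     measurable [set t | eps * j.+1%:R ^+ 2 <= `|Y j t - e j|] /\
     (P [set t | (eps * j.+1%:R ^+ 2 <= `|Y j t - e j|)%R] <= (C / j.+1%:R ^+ 2)%:E)%E) ->
  (fun j => e j / j.+1%:R ^+ 2) @ \oo --> c ->
  {ae P, forall t, (fun j => Y j t / j.+1%:R ^+ 2) @ \oo --> c}.
Proof.
move=> hY he; pose A i j := [set t | (i.+1%:R)^-1 * j.+1%:R ^+ 2 <= `|Y j t - e j|].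
have i0 i : 0 < (i.+1%:R)^-1 :> R by rewrite invr_gt0.
have mA i j : measurable (A i j) by have [C _ /(_ j)[]] := hY _ (i0 i).
have nA i : P.-negligible (lim_sup_set (A i)).
  have [C C0 hC] := hY _ (i0 i).
  exists (lim_sup_set (A i)); split => //.
    by apply: bigcapT_measurable => n; apply: bigcup_measurable.
  apply: lim_sup_set_cvg0 => //; apply: (@le_lt_trans _ _ (2 * C)%:E); last exact: ltry.
  apply: lime_le; first by apply: is_cvg_nneseries.
  apply: nearW => n; apply: (@le_trans _ _ (\sum_(0 <= j < n) (C / j.+1%:R ^+ 2)%:E)%E).
    by apply: lee_sum => j _; have [] := hC j.
  by rewrite sumEFin lee_fin -mulr_sumr mulrC ler_wpM2r// sum_inv_sq_le.
apply: (negligibleS _ (negligible_bigcup nA)) => t /= nQ; apply: contrapT => nU; apply: nQ.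
have ev i : \forall j \near \oo, `|Y j t - e j| < (i.+1%:R)^-1 * j.+1%:R ^+ 2.
  have : ~ lim_sup_set (A i) t by move=> h; apply: nU; exists i.
  move=> /existsNP[n /not_implyP[_ hn]]; exists n => // j /= nj.
  by rewrite ltNge; apply/negP => h; apply: hn; exists j.
have h0 : (fun j => (Y j t - e j) / j.+1%:R ^+ 2) @ \oo --> (0 : R).
  apply/cvgr0Pnorm_le => eps eps0.
  have hh : (fun n => (n.+1%:R)^-1 : R) @ \oo --> (0 : R) by exact: cvg_harmonic.
  have [i _ /(_ i (leqnn i)) hi] : \forall i \near \oo, (i.+1%:R)^-1 <= eps by exact: (cvgr_le _ hh).
  near=> j; rewrite normrM normfV [X in _ / X]ger0_norm ?sqr_ge0// ler_pdivrMr ?exprn_gt0//.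
  apply: le_trans (_ : _ <= (i.+1%:R)^-1 * j.+1%:R ^+ 2) _; last by rewrite ler_wpM2r ?sqr_ge0.
  by apply: ltW; near: j; exact: ev.
have h2 : (fun j => (Y j t - e j) / j.+1%:R ^+ 2 + e j / j.+1%:R ^+ 2) @ \oo --> 0 + c by exact: cvgD.
rewrite add0r in h2; apply: cvg_trans h2; apply: near_eq_cvg; apply: nearW => j /=.
by rewrite mulrBl subrK.
Unshelve. all: by end_near. Qed.

Variables (p : nat -> R) (xi : nat -> {RV P >-> nat}).
Hypothesis p_gt0 : forall i, (1 <= i)%N -> 0 < p i.
Hypothesis p_sum : (\sum_(1 <= i <oo) (p i)%:E = 1)%E.
Hypothesis hxi : iid_sample p xi.
Local Notation w := (weight p).
Let w_ge0 := weight_ge0 p_gt0.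
Let w_sum := weight_sum p_gt0 p_sum.
Local Notation Ex := (Ex w).

(** Along [N] the variance is of order j^2, so Chebyshev's inequality at deviation eps j^2 gives a
    probability of order j^(-2). *)
Lemma sample_as_cvg (X : seq nat -> nat) (N : nat -> nat) (C c b : R) :
  (forall n, bnds n (fun s => (X s)%:R : R)) ->
  (forall n, Var w n (fun s => (X s)%:R) <= C * Ex n (fun s => (distinct s)%:R)) -> 0 <= C ->
  Ex (N j) (fun s => (distinct s)%:R) / j.+1%:R ^+ 2 @[j --> \oo] --> b ->
  Ex (N j) (fun s => (X s)%:R) / j.+1%:R ^+ 2 @[j --> \oo] --> c ->
  {ae P, forall t, (fun j => (X (sample xi (N j) t))%:R / j.+1%:R ^+ 2) @ \oo --> c}.
Proof.
move=> bX vX C0 hD; apply: as_cvg_square => eps eps0.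
have [B hB] : exists B : R, forall j, Ex (N j) (fun s => (distinct s)%:R) / j.+1%:R ^+ 2 <= B.
  have /cvg_seq_bounded[M [_ hM]] := cvgP _ hD; exists (M + 1) => j.
  by apply: le_trans (ler_norm _) _; apply: hM => //; rewrite ltrDl.
have D0 n : 0 <= Ex n (fun s => (distinct s)%:R) by apply: Ex_ge0 => //; exact: bnds_distinct.
have B0 : 0 <= B by apply: le_trans (hB 0%N); rewrite divr_ge0 ?sqr_ge0.
exists (C * B / eps ^+ 2) => [|j]; first by rewrite divr_ge0 ?sqr_ge0// mulr_ge0.
have j0 : 0 < j.+1%:R ^+ 2 :> R by rewrite exprn_gt0.
pose q (s : seq nat) := eps * j.+1%:R ^+ 2 <= `|(X s)%:R - Ex (N j) (fun s => (X s)%:R)|.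
split; first exact: (measurable_sample xi (N j) q).
rewrite (prob_sample p_gt0 p_sum hxi (N j) q) lee_fin.
apply: le_trans (Chebyshev w_ge0 w_sum (bX (N j)) (mulr_gt0 eps0 j0)) _.
apply: le_trans (_ : _ <= C * Ex (N j) (fun s => (distinct s)%:R) / (eps * j.+1%:R ^+ 2) ^+ 2) _.
  by rewrite ler_wpM2r ?invr_ge0 ?sqr_ge0.
rewrite (_ : C * _ / _ = C / eps ^+ 2 / j.+1%:R ^+ 2 * (Ex (N j) (fun s => (distinct s)%:R) / j.+1%:R ^+ 2)); last first.
  have : j.+1%:R != 0 :> R by rewrite pnatr_eq0.
  by move: (Ex _ _) (j.+1%:R) => z y y0; field; rewrite y0 gt_eqF.
rewrite [leRHS](_ : _ = C / eps ^+ 2 / j.+1%:R ^+ 2 * B); last by ring.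
by rewrite ler_wpM2l// !divr_ge0 ?sqr_ge0.
Qed.

End AlmostSure.

(** * Regular variation of the masses and telescoping of their tails *)

Section Transfer.
Context {R : realType}.
Local Notation cl x := `|Num.ceil x|%N.
Variables (p : nat -> R) (gamma : R).
Hypothesis gamma01 : 0 < gamma < 1.
Hypothesis p_gt0 : forall i, (1 <= i)%N -> 0 < p i.
Hypothesis p_cvg0 : p @ \oo --> (0 : R).
Hypothesis p_rv : regularly_varying p (- gamma^-1).

Lemma powR_cvg0_seq : p k `^ gamma @[k --> \oo] --> (0 : R).
Proof.
case/andP: (gamma01) => g0 _.
apply/cvgr0Pnorm_le => e e0; near=> k.
have pk : 0 < p k by apply: p_gt0; near: k; exact: nbhs_infty_gt.
have pe : p k <= e `^ gamma^-1 by near: k; apply: (cvgr_le _ p_cvg0); exact: powR_gt0.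
rewrite ger0_norm ?powR_ge0//; apply: (@le_trans _ _ ((e `^ gamma^-1) `^ gamma)).
  by apply: ge0_ler_powR; rewrite ?nnegrE ?powR_ge0 ?(ltW g0) ?(ltW pk).
by rewrite -powRrM mulVf ?gt_eqF// powRr1// ltW.
Unshelve. all: by end_near. Qed.

Lemma inv_cvg0_pinfty : (x^-1 : R) @[x --> +oo] --> (0 : R).
Proof.
apply/cvgr0Pnorm_le => e e0; near=> x.
have x0 : 0 < x by near: x; apply: nbhs_pinfty_gt; exact: num_real.
have xe : e^-1 <= x by near: x; apply: nbhs_pinfty_ge; exact: num_real.
rewrite ger0_norm ?invr_ge0 ?(ltW x0)// -[leRHS]invrK lef_pV2 ?posrE ?invr_gt0//.
Unshelve. all: by end_near. Qed.

Lemma cl_cvgy (t : R) : 0 < t -> cl (t * x) @[x --> +oo] --> \oo.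
Proof.
move=> t0; apply/cvgnyPge => A; near=> x; apply: cl_ge.
rewrite mulrC -ler_pdivrMr//; near: x; apply: nbhs_pinfty_ge; exact: num_real.
Unshelve. all: by end_near. Qed.

Lemma cl_ratio (t : R) : 0 < t -> ((cl x)%:R / (cl (t * x))%:R : R) @[x --> +oo] --> t^-1.
Proof.
move=> t0.
(* This lower bound is chosen so that its product with t x + 1, which exceeds the ceiling of t x,
   falls just below x. *)
have h0 : (fun x : R => t^-1 - t^-1 ^+ 2 * x^-1) @ +oo --> (t^-1 - t^-1 ^+ 2 * 0 : R).
  by apply: cvgB; [exact: cvg_cst|apply: cvgM inv_cvg0_pinfty; exact: cvg_cst].
have h1 : (fun x : R => t^-1 + t^-1 * x^-1) @ +oo --> (t^-1 + t^-1 * 0 : R).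
  by apply: cvgD; [exact: cvg_cst|apply: cvgM inv_cvg0_pinfty; exact: cvg_cst].
rewrite mulr0 subr0 in h0; rewrite mulr0 addr0 in h1.
apply: (@squeeze_cvgr _ _ _ _ _ _ _ _ _ h0 h1); near=> x.
have x0 : 0 < x by near: x; apply: nbhs_pinfty_gt; exact: num_real.
have tx : 0 < t * x by rewrite mulr_gt0.
have a1 := le_cl (ltW x0); have a2 := cl_lt (ltW x0).
have b1 := le_cl (ltW tx); have b2 := cl_lt (ltW tx).
have c0 : 0 < (cl (t * x))%:R :> R by exact: lt_le_trans b1.
apply/andP; split.
  rewrite ler_pdivlMr//; have [neg|pos] := leP (t^-1 - t^-1 ^+ 2 * x^-1) 0.
    by apply: (@le_trans _ _ 0); rewrite // mulr_le0_ge0// ltW.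
  apply: le_trans a1.
  apply: (@le_trans _ _ ((t^-1 - t^-1 ^+ 2 * x^-1) * (t * x + 1))).
    by rewrite ler_wpM2l ?(ltW pos)// ltW.
  rewrite [leLHS](_ : _ = x - t^-1 ^+ 2 * x^-1); last by field; rewrite !gt_eqF.
  by rewrite gerBl mulr_ge0 ?sqr_ge0// invr_ge0 ltW.
rewrite ler_pdivrMr//; apply: (@le_trans _ _ ((t^-1 + t^-1 * x^-1) * (t * x))).
  rewrite [leRHS](_ : _ = x + 1); last by field; rewrite !gt_eqF.
  exact: ltW.
by rewrite ler_wpM2l// addr_ge0 ?mulr_ge0 ?invr_ge0 ?(ltW t0) ?(ltW x0).
Unshelve. all: by end_near. Qed.

(** The index arises as -1 / gamma times gamma, from p^gamma, plus -1 from the division by k. *)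
Lemma rv_mass (q : nat -> R) (c : R) : 0 < c -> (forall k, (0 < k)%N -> 0 < q k) ->
  (fun k => q k / (p k `^ gamma / k%:R)) @ \oo --> c -> regularly_varying q (- 2).
Proof.
move=> c0 q0 hq; split=> // t t0; case/andP: (gamma01) => g0 g1.
have hp := p_rv.2 t t0; have l0 : 0 < t `^ (- gamma^-1) by exact: powR_gt0.
have cg := @continuous_powR R gamma _ l0.
have h1 := cvg_comp _ _ hp cg.
have h2 := cvg_comp _ _ (cl_cvgy t0) hq.
have y1 : (cl x) @[x --> (+oo : set_system R)] --> \oo.
  by have := cl_cvgy ltr01; under eq_fun do rewrite mul1r.
have h3 := cvg_comp _ _ y1 hq.
have h : (fun x : R => (q (cl (t * x)) / (p (cl (t * x)) `^ gamma / (cl (t * x))%:R)) *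
   ((p (cl (t * x)) / p (cl x)) `^ gamma * ((cl x)%:R / (cl (t * x))%:R)) *
   (q (cl x) / (p (cl x) `^ gamma / (cl x)%:R))^-1) @ +oo --> c * ((t `^ (- gamma^-1)) `^ gamma * t^-1) * c^-1.
  apply: cvgM; last by apply: cvgV; [rewrite gt_eqF|exact: h3].
  by apply: cvgM; [exact: h2|apply: cvgM; [exact: h1|exact: cl_ratio]].
rewrite (_ : t `^ (- 2) = c * ((t `^ (- gamma^-1)) `^ gamma * t^-1) * c^-1); last first.
  rewrite -powRrM mulNr mulVf ?gt_eqF// !powRN powRr1 ?(ltW t0)//.
  rewrite -[2]/(2%:R) powR_mulrn ?(ltW t0)//; field; rewrite !gt_eqF//.
apply: cvg_trans h; apply: near_eq_cvg; near=> x.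
have x0 : 0 < x by near: x; apply: nbhs_pinfty_gt; exact: num_real.
have tx : 0 < t * x by rewrite mulr_gt0.
have n0 := cl_gt0 x0; have n1 := cl_gt0 tx.
move: (p_gt0 n0) (p_gt0 n1) (q0 _ n0) (n0) (n1); set a := cl x; set b := cl (t * x) => pa pb qa a0 b0.
rewrite powRM ?(ltW pb) ?invr_ge0 ?(ltW pa)// -[(p a)^-1]powR_inv1 ?(ltW pa)// -powRrM mulN1r powRN.
have ga := powR_gt0 gamma pa; have gb := powR_gt0 gamma pb.
by field; rewrite !gt_eqF ?ltr0n.
Unshelve. all: by end_near. Qed.

Lemma tail_telescope (q S : nat -> R) k : (forall j, (0 < j)%N -> q j = S j - S j.+1) ->
  S @ \oo --> (0 : R) -> (0 < k)%N -> tail q k = S k.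
Proof.
move=> qS S0 k0; rewrite /tail (nneseries_real (l := S k))//.
rewrite -[S k]subr0; have h : (fun N => S k - S N) @ \oo --> S k - 0 by apply: cvgB => //; exact: cvg_cst.
apply: cvg_trans h; apply: near_eq_cvg; near=> N.
have kN : (k <= N)%N by near: N; exact: nbhs_infty_ge.
rewrite (eq_big_nat _ _ (F2 := fun j => - (S j.+1 - S j))); last first.
  by move=> j /andP[kj _]; rewrite qS ?opprB//; exact: leq_trans kj.
by rewrite sumrN telescope_sumr// opprB.
Unshelve. all: by end_near. Qed.

End Transfer.

(** * Masses and degree frequencies on the given probability space *)

Section RangeRenewal.
Context {R : realType} (gamma : R) (p : nat -> R) d {T : measurableType d} (P : probability T R).
Local Notation cl x := `|Num.ceil x|%N.
Variable xi : nat -> {RV P >-> nat}.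
Hypothesis gamma01 : 0 < gamma < 1.
Hypothesis p_gt0 : forall i, (1 <= i)%N -> 0 < p i.
Hypothesis p_noninc : forall i j, (1 <= i)%N -> (i <= j)%N -> p j <= p i.
Hypothesis p_sum : (\sum_(1 <= i <oo) (p i)%:E = 1)%E.
Hypothesis p_rv : regularly_varying p (- gamma^-1).
Hypothesis hxi : iid_sample p xi.
Local Notation w := (weight p).
Let w_ge0 := weight_ge0 p_gt0.
Let w_sum := weight_sum p_gt0 p_sum.
Let p_cvg0 := weight_pos_cvg p_gt0 p_sum.
Local Notation Ex := (Ex w).
Local Notation r := (sibuya gamma).
Local Notation Sd := (stieltjes p (sib gamma)).
Local Notation Su := (stieltjes p (fun m => sib gamma (uphalf m))).

Lemma prob_range l k :
  P [set t | range_size (trajectory xi t) l = k] = (rangeQ p k l)%:E.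
Proof.
rewrite -(prob_sample p_gt0 p_sum hxi l (fun s => distinct s == k)); congr (P _).
by apply/seteqP; split => t /=; rewrite range_sizeE => /eqP.
Qed.

(** A single trajectory [u] already has positive probability. This yields the positivity of the
    masses that is part of regular variation. *)
Lemma rangeQ_gt0 (u : seq nat) : all (leq 1) u -> 0 < rangeQ p (distinct u) (size u).
Proof.
move=> /allP u1; rewrite -lte_fin -prob_range.
apply: (@lt_le_trans _ _ (P [set t | sample xi (size u) t = u])).
  rewrite (prob_sample_eq hxi) lte_fin big_seq; apply: prodr_gt0 => x /u1 x1.
  by rewrite weightE// p_gt0.
apply: le_measure; rewrite ?inE.
- rewrite (_ : [set _ | _] = [set t | sample xi (size u) t == u]); last by apply/seteqP; split => t /= /eqP.
  exact: (measurable_sample xi (size u) (fun s => s == u)).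
- rewrite (_ : [set _ | _] = [set t | distinct (sample xi (size u) t) == distinct u]).
    exact: (measurable_sample xi (size u) (fun s => distinct s == distinct u)).
  by apply/seteqP; split => t /=; rewrite range_sizeE => /eqP.
- by move=> t /= e; rewrite range_sizeE -[mkseq _ _]/(sample xi (size u) t) e.
Qed.

Let rQ_ge0 k l : 0 <= rangeQ p k l.
Proof. by apply: Ex_ge0 => //; exact: bnds_bool. Qed.

Lemma out_mass_series k : (0 < k)%N ->
  (fun M => \sum_(1 <= l < M) r l * rangeQ p k l) @ \oo --> out_mass gamma xi k /\
  out_mass gamma xi k = Sd k - Sd k.+1.
Proof.
move=> k0.
have h : (fun M => \sum_(1 <= l < M) r l * rangeQ p k l) @ \oo --> Sd k - Sd k.+1.
  rewrite (_ : (fun M => _) = (fun M => \sum_(1 <= l < M) r l * rangeF p k l - \sum_(1 <= l < M) r l * rangeF p k.+1 l)).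
    by apply: cvgB; exact: out_tail_series.
  by apply/funext => M; rewrite -sumrB; apply: eq_bigr => l _; rewrite rangeQE// mulrBr.
suff e : out_mass gamma xi k = Sd k - Sd k.+1 by rewrite e.
rewrite /out_mass (eq_eseriesr (g := fun l => (r l * rangeQ p k l)%:E)); last first.
  by move=> l _; rewrite prob_range EFinM.
by rewrite (nneseries_real h).
Qed.

Lemma mass_series k : (0 < k)%N ->
  (fun M => \sum_(1 <= l < M) r l * rangeQ p k (2 * l)%N) @ \oo --> mass gamma xi k /\
  mass gamma xi k = Su k - Su k.+1.
Proof.
move=> k0.
have h : (fun M => \sum_(1 <= l < M) r l * rangeQ p k (2 * l)%N) @ \oo --> Su k - Su k.+1.
  rewrite (_ : (fun M => _) = (fun M => \sum_(1 <= l < M) r l * rangeF p k (2 * l)%N - \sum_(1 <= l < M) r l * rangeF p k.+1 (2 * l)%N)).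
    by apply: cvgB; exact: tail_series.
  by apply/funext => M; rewrite -sumrB; apply: eq_bigr => l _; rewrite rangeQE// mulrBr.
suff e : mass gamma xi k = Su k - Su k.+1 by rewrite e.
rewrite /mass (eq_eseriesr (g := fun l => (r l * rangeQ p k (2 * l)%N)%:E)); last first.
  by move=> l _; rewrite prob_range EFinM.
by rewrite (nneseries_real h).
Qed.

Lemma series_gt0 (q : nat -> R) (L : R) k : (0 < k)%N -> (forall l, 0 <= q l) -> 0 < q k ->
  (fun M => \sum_(1 <= l < M) r l * q l) @ \oo --> L -> 0 < L.
Proof.
move=> k0 q0 qk hL; apply: (@lt_le_trans _ _ (r k * q k)); first by rewrite mulr_gt0// sibuya_gt0.
apply: (@ler_cvg_to _ \oo _ _ (fun=> r k * q k) _ _ _ _ hL); first exact: cvg_cst.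
near=> M; have kM : (k < M)%N by near: M; exact: nbhs_infty_gt.
rewrite (bigD1_seq k) ?mem_index_iota ?k0 ?iota_uniq//= lerDl big_seq_cond.
apply: sumr_ge0 => l /andP[]; rewrite mem_index_iota => /andP[l1 _] _.
by rewrite mulr_ge0// ltW// sibuya_gt0.
Unshelve. all: by end_near. Qed.

Lemma out_mass_gt0 k : (0 < k)%N -> 0 < out_mass gamma xi k.
Proof.
move=> k0; have [h _] := out_mass_series k0; apply: (series_gt0 k0 _ _ h) => //.
have u1 : all (leq 1) (iota 1 k) by apply/allP => x; rewrite mem_iota => /andP[].
have := rangeQ_gt0 u1; rewrite size_iota (_ : distinct (iota 1 k) = k)//.
by rewrite /distinct undup_id ?iota_uniq// size_iota.
Qed.

Lemma mass_gt0 k : (0 < k)%N -> 0 < mass gamma xi k.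
Proof.
move=> k0; have [h _] := mass_series k0.
apply: (series_gt0 (q := fun l => rangeQ p k (2 * l)%N) k0 _ _ h) => //.
(* A trajectory of even length 2 k with exactly k distinct values: the value 1 repeated k times,
   then 1, ..., k. *)
have u1 : all (leq 1) (nseq k 1%N ++ iota 1 k).
  by rewrite all_cat all_nseq orbT /=; apply/allP => x; rewrite mem_iota => /andP[].
have := rangeQ_gt0 u1; rewrite size_cat size_nseq size_iota addnn -mul2n.
rewrite (_ : distinct _ = k)// /distinct -[RHS](size_iota 1 k).
apply/perm_size/uniq_perm; [exact: undup_uniq|exact: iota_uniq|move=> x].
rewrite mem_undup mem_cat mem_nseq mem_iota add1n ltnS k0 /=.
by case: eqVneq => //= ->; rewrite /= k0.
Qed.

Let N j := cl (1 / p (j.+1 ^ 2)%N).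
Let sq_y : (fun j => j.+1 ^ 2)%N @ \oo --> \oo.
Proof. by apply/cvgnyPge => A; exists A => // j /= Aj; rewrite -mulnn; nia. Qed.

Let N_y : N @ \oo --> \oo.
Proof. exact: (cvg_comp _ _ sq_y (scale_cvgy p_gt0 p_cvg0 ltr01)). Qed.

Lemma high_as cc K (L : R) : (0 < K)%N ->
  (fun M => \sum_(1 <= l < M) r l * rangeF p K (if cc then 2 * l else l)%N) @ \oo --> L ->
  {ae P, forall t, (fun j => (high_count cc K (sample xi (N j) t))%:R / j.+1%:R ^+ 2) @ \oo -->
     Gamma (1 - gamma) * L} /\
  {ae P, forall t, (fun j => (distinct (sample xi (N j) t))%:R / j.+1%:R ^+ 2) @ \oo -->
     Gamma (1 - gamma)}.
Proof.
move=> K0 hL.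
have sqE (f : nat -> R) : (fun j => f (N j) / (j.+1 ^ 2)%:R) = (fun j => f (N j) / j.+1%:R ^+ 2).
  by apply/funext => j; rewrite natrX.
have hD : Ex (N j) (fun s => (distinct s)%:R) / j.+1%:R ^+ 2 @[j --> \oo] --> Gamma (1 - gamma).
  have h := mean_distinct_cvg gamma01 p_gt0 p_noninc p_sum p_rv ltr01.
  rewrite powR1 mul1r in h; rewrite -(sqE (fun n => Ex n (fun s => (distinct s)%:R))).
  exact: (cvg_comp _ _ sq_y h).
split.
  apply: (sample_as_cvg p_gt0 p_sum hxi (C := 6 * K%:R) _ _ _ hD).
  - by move=> n; exact: bnds_high.
  - by move=> n; exact: Var_high.
  - by rewrite mulr_ge0.
  - rewrite -(sqE (fun n => Ex n (fun s => (high_count cc K s)%:R))).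
    exact: (cvg_comp _ _ sq_y (mean_high_cvg gamma01 p_gt0 p_noninc p_sum p_rv K0 hL)).
apply: (sample_as_cvg p_gt0 p_sum hxi (C := 1) _ _ _ hD) => //.
- by move=> n; exact: bnds_distinct.
- by move=> n; rewrite mul1r; exact: Var_distinct.
Qed.

(** The number of symbols of degree exactly k is not monotone in n, but it is the difference of two
    counts that are. Each is interpolated with the same index J n, so the normalisation and Gamma(1
    - gamma) cancel against the range. *)
Lemma count_as cc k (L1 L2 : R) (cnt : nat -> T -> nat) : (0 < k)%N ->
  (fun M => \sum_(1 <= l < M) r l * rangeF p k (if cc then 2 * l else l)%N) @ \oo --> L1 ->
  (fun M => \sum_(1 <= l < M) r l * rangeF p k.+1 (if cc then 2 * l else l)%N) @ \oo --> L2 ->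
  (forall n t, (cnt n t + high_count cc k.+1 (sample xi n t) = high_count cc k (sample xi n t))%N) ->
  {ae P, forall t, (cnt n t)%:R / (distinct (sample xi n t))%:R @[n --> \oo] --> L1 - L2}.
Proof.
move=> k0 h1 h2 hc; have G0 := GammaC_gt0 gamma01.
have [a1 aD] := high_as k0 h1; have [a2 _] := high_as (ltn0Sn k) h2.
have [J Jy hJ] := interpolate N_y.
apply: filterS3 a1 a2 aD => t b1 b2 bD.
have mono K m n : (0 < K)%N -> (m <= n)%N ->
    (high_count cc K (sample xi m t) <= high_count cc K (sample xi n t))%N.
  move=> K0 /subnKC <-; move: (n - m)%N => i; elim: i => [|i IH]; first by rewrite addn0.
  apply: leq_trans IH _; rewrite addnS; apply: high_sub => //.
  have h := @edges_rcons (sample xi (m + i) t) (xi (m + i).+1 t).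
  by rewrite -sampleS in h; exact: h.
have monoD m n : (m <= n)%N -> (distinct (sample xi m t) <= distinct (sample xi n t))%N.
  move=> mn; have := @distinct_take m n (sample xi n t) mn.
  by rewrite [take n _]take_oversize ?size_sample// /sample /mkseq -map_take take_iota (minn_idPl mn).
have c1 := interpolate_cvg (y := fun n => (high_count cc k (sample xi n t))%:R) Jy hJ (fun n => ler0n R _) _ b1.
have c2 := interpolate_cvg (y := fun n => (high_count cc k.+1 (sample xi n t))%:R) Jy hJ (fun n => ler0n R _) _ b2.
have cD := interpolate_cvg (y := fun n => (distinct (sample xi n t))%:R) Jy hJ (fun n => ler0n R _) _ bD.
have h : (fun n => ((high_count cc k (sample xi n t))%:R / (J n).+1%:R ^+ 2 -
    (high_count cc k.+1 (sample xi n t))%:R / (J n).+1%:R ^+ 2) *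
   ((distinct (sample xi n t))%:R / (J n).+1%:R ^+ 2)^-1) @ \oo -->
   (Gamma (1 - gamma) * L1 - Gamma (1 - gamma) * L2) * (Gamma (1 - gamma))^-1.
  apply: cvgM.
    apply: cvgB; [apply: c1|apply: c2] => m n mn; rewrite ler_nat; exact: mono.
  apply: cvgV; first by rewrite gt_eqF.
  by apply: cD => m n mn; rewrite ler_nat; exact: monoD.
rewrite (_ : (_ - _) * _^-1 = L1 - L2) in h; last by field; rewrite gt_eqF.
apply: cvg_trans h; apply: near_eq_cvg; apply: nearW => n.
by rewrite -(hc n t) natrD -mulrBl addrK invf_div mulrA divfK.
Qed.

End RangeRenewal.

Theorem theorem1 (R : realType) (gamma : R) (p : nat -> R)
    (d : measure_display) (T : measurableType d) (P : probability T R)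
    (xi : nat -> {RV P >-> nat})
    (hgamma : 0 < gamma < 1)
    (p_gt0 : forall i, (1 <= i)%N -> 0 < p i)
    (p_noninc : forall i j, (1 <= i)%N -> (i <= j)%N -> p j <= p i)
    (p_sum : (\sum_(1 <= i <oo) (p i)%:E = 1)%E)
    (p_rv : regularly_varying p (- gamma^-1))
    (hxi : iid_sample p xi) :
  let rd : nat -> R := out_mass gamma xi in
  let ru : nat -> R := mass gamma xi in
  (asymp_equiv (tail rd) (fun k => p k `^ gamma) /\
   asymp_equiv (tail ru) (fun k => 2 `^ gamma * p k `^ gamma)) /\
  (asymp_equiv rd (fun k => p k `^ gamma / k%:R) /\
   asymp_equiv ru (fun k => 2 `^ gamma * p k `^ gamma / k%:R)) /\
  (regularly_varying rd (- 2) /\ regularly_varying ru (- 2)) /\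
  ru k / rd k @[k --> \oo] --> 2 `^ gamma /\
  (forall k : nat, (1 <= k)%N ->
     {ae P, forall w, out_freq_noloop xi n k w @[n --> \oo] --> rd k} /\
     {ae P, forall w, freq_noloop xi n k w @[n --> \oo] --> ru k}).
Proof.
move=> rd ru.
have p_cvg0 := weight_pos_cvg p_gt0 p_sum.
have pg0 := powR_cvg0_seq hgamma p_gt0 p_cvg0.
have two0 : 0 < (2 : R) `^ gamma by exact: powR_gt0.
have Td := out_tail_asymp hgamma p_gt0 p_noninc p_sum p_rv.
have Tu := tail_asymp hgamma p_gt0 p_noninc p_sum p_rv.
have pgt : \forall k \near \oo, 0 < p k `^ gamma.
  near=> k; apply: powR_gt0; apply: p_gt0; near: k; exact: nbhs_infty_gt.
(* The Stieltjes sums vanish at infinity; hence summing their differences, which are the masses,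
   gives them back as the tails. *)
have tail0 (S : nat -> R) (c : R) : 0 < c -> S k / (c * p k `^ gamma) @[k --> \oo] --> (1 : R) ->
    S @ \oo --> (0 : R).
  move=> c0 hS.
  have h : (fun k => S k / (c * p k `^ gamma) * (c * p k `^ gamma)) @ \oo --> 1 * (c * 0).
    by apply: cvgM => //; apply: cvgM => //; exact: cvg_cst.
  rewrite mulr0 mulr0 in h; apply: cvg_trans h; apply: near_eq_cvg; near=> k.
  by rewrite divfK// gt_eqF// mulr_gt0//; near: k.
have Sd0 := tail0 (stieltjes p (sib gamma)) 1 ltr01.
have {}Sd0 : stieltjes p (sib gamma) @ \oo --> (0 : R).
  by apply: Sd0; under eq_fun do rewrite mul1r; exact: Td.
have Su0 := tail0 _ _ two0 Tu.
have rdE j : (0 < j)%N -> rd j = stieltjes p (sib gamma) j - stieltjes p (sib gamma) j.+1.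
  by move=> j0; have [] := out_mass_series hgamma p_gt0 p_sum hxi j0.
have ruE j : (0 < j)%N -> ru j = stieltjes p (fun m => sib gamma (uphalf m)) j -
    stieltjes p (fun m => sib gamma (uphalf m)) j.+1.
  by move=> j0; have [] := mass_series hgamma p_gt0 p_sum hxi j0.
have Ad : (fun k => rd k / (p k `^ gamma / k%:R)) @ \oo --> (1 : R).
  apply: (out_mass_asymp hgamma p_gt0 p_noninc p_sum p_rv) => k k0.
  by have [] := out_mass_series hgamma p_gt0 p_sum hxi k0.
have Au : (fun k => ru k / (2 `^ gamma * p k `^ gamma / k%:R)) @ \oo --> (1 : R).
  apply: (mass_asymp hgamma p_gt0 p_noninc p_sum p_rv) => k k0.
  by have [] := mass_series hgamma p_gt0 p_sum hxi k0.
have Au2 : (fun k => ru k / (p k `^ gamma / k%:R)) @ \oo --> 2 `^ gamma.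
  have h : (fun k => 2 `^ gamma * (ru k / (2 `^ gamma * p k `^ gamma / k%:R))) @ \oo --> 2 `^ gamma * (1 : R).
    by apply: cvgM Au; exact: cvg_cst.
  rewrite mulr1 in h; apply: cvg_trans h; apply: near_eq_cvg; near=> k.
  have k0 : (0 < k)%N by near: k; exact: nbhs_infty_gt.
  have g0 : 0 < p k `^ gamma by near: k.
  by field; rewrite !gt_eqF ?ltr0n.
have rd0 := out_mass_gt0 hgamma p_gt0 p_sum hxi; have ru0 := mass_gt0 hgamma p_gt0 p_sum hxi.
split; [split|split; [split|split; [split|split]]] => //.
- apply: cvg_trans Td; apply: near_eq_cvg; near=> k.
  have k0 : (0 < k)%N by near: k; exact: nbhs_infty_gt.
  by rewrite (tail_telescope rdE Sd0 k0).
- apply: cvg_trans Tu; apply: near_eq_cvg; near=> k.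
  have k0 : (0 < k)%N by near: k; exact: nbhs_infty_gt.
  by rewrite (tail_telescope ruE Su0 k0).
- exact: (rv_mass hgamma p_gt0 p_rv ltr01 rd0 Ad).
- exact: (rv_mass hgamma p_gt0 p_rv two0 ru0 Au2).
- have h : (fun k => (ru k / (p k `^ gamma / k%:R)) * (rd k / (p k `^ gamma / k%:R))^-1) @ \oo --> 2 `^ gamma * (1 : R)^-1.
    by apply: cvgM => //; apply: cvgV => //; rewrite oner_neq0.
  rewrite invr1 mulr1 in h; apply: cvg_trans h; apply: near_eq_cvg; near=> k.
  have k0 : (0 < k)%N by near: k; exact: nbhs_infty_gt.
  have g0 : 0 < p k `^ gamma by near: k.
  by have r0 := rd0 k k0; field; rewrite !gt_eqF ?ltr0n.
(* The mass at k becomes a difference of consecutive tails, matching the count of degree k as a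
   difference of two threshold counts. *)
move=> k k0; rewrite rdE// ruE//; split.
- have := @count_as R gamma p d T P xi hgamma p_gt0 p_noninc p_sum p_rv hxi false k _ _
    (fun n t => out_degree_count_noloop (trajectory xi t) n k) k0
    (out_tail_series hgamma p_gt0 p_sum k0) (out_tail_series hgamma p_gt0 p_sum (ltn0Sn k))
    (fun n t => out_degree_countE (trajectory xi t) n k0).
  apply: filterS => t; apply: cvg_trans; apply: near_eq_cvg; apply: nearW => n.
  by rewrite /out_freq_noloop range_sizeE.
- have := @count_as R gamma p d T P xi hgamma p_gt0 p_noninc p_sum p_rv hxi true k _ _
    (fun n t => degree_count_noloop (trajectory xi t) n k) k0
    (tail_series hgamma p_gt0 p_sum k0) (tail_series hgamma p_gt0 p_sum (ltn0Sn k))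
    (fun n t => undirected_degree_countE (trajectory xi t) n k0).
  apply: filterS => t; apply: cvg_trans; apply: near_eq_cvg; apply: nearW => n.
  by rewrite /freq_noloop range_sizeE.
Unshelve. all: by end_near. Qed.
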